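(* Suppose that $Y_1,\dots,Y_n$ and $\varepsilon_1^*,\dots,\varepsilon_m^*$ are independent. Let $q\in\mathbb R$ and $\alpha,\beta,R,r,\zeta>0$, $\gamma\ge0$. Then for any $C>0$ there is some $\delta>0$ such that, for all $n,m$ with $n\wedge m$ sufficiently large, $$\inf_{\bar F_{n,m}}\ \sup_{F\in\widetilde{\mathcal C}^{\alpha+1}(R,r,[q-\zeta,q+\zeta])}\ \sup_{f_\varepsilon\in\mathcal D^\beta(R,\gamma)}P\Bigl(|\bar F_{n,m}(q)-F(q)|>C(n\wedge m)^{-(\alpha+1)/(2\alpha+(2\beta)\vee1+1)}\Bigr)\ge\delta,$$ $$\inf_{\bar q_{\tau,n,m}}\ \sup_{F\in\widetilde{\mathcal C}^{\alpha+1}(R,r,\zeta)}\ \sup_{f_\varepsilon\in\mathcal D^\beta(R,\gamma)}P\Bigl(|\bar q_{\tau,n,m}-q_\tau|>C(n\wedge m)^{-(\alpha+1)/(2\alpha+(2\beta)\vee1+1)}\Bigr)\ge\delta,$$ where the infima are taken over all estimators $\bar F_{n,m}$ and $\bar q_{\tau,n,m}$ (measurable functions of $Y_1,\dots,Y_n,\varepsilon_1^*,\dots,\varepsilon_m^*$), respectively.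
   Context: Model. $X_1,\dots,X_n$ are i.i.d. with cumulative distribution function (c.d.f.) $F$; $\varepsilon_1,\dots,\varepsilon_n$ are i.i.d. with Lebesgue density $f_\varepsilon$, independent of $(X_j)$. One observes $Y_j=X_j+\varepsilon_j$, $j=1,\dots,n$, and an i.i.d. sample $\varepsilon_1^*,\dots,\varepsilon_m^*$ from $f_\varepsilon$. Fix $\tau\in(0,1)$; $q_\tau$ denotes the $\tau$-quantile of $F$. $\mathcal F g(u)=\int_{\mathbb R}e^{iux}g(x)\,dx$. $\langle\alpha\rangle$ is the largest integer strictly smaller than $\alpha$. Hölder norm on an interval $I$: $\|g\|_{C^\alpha(I)}=\sum_{k=0}^{\langle\alpha\rangle}\|g^{(k)}\|_{L^\infty(I)}+\sup_{x\ne y\in I}\frac{|g^{(\langle\alpha\rangle)}(x)-g^{(\langle\alpha\rangle)}(y)|}{|x-y|^{\alpha-\langle\alpha\rangle}}$, and $C^\alpha(I,R)=\{g \text{ continuous and bounded on } I:\|g\|_{C^\alpha(I)}\le R\}$. Classes. For an interval $I\subseteq\mathbb R$, $\widetilde{\mathcal C}^{\alpha+1}(R,r,I)$ is the set of c.d.f.s $F$ that have on $I$ a Lebesgue density $f\in C^\alpha(I,R)$ with $\inf_{x\in I}f(x)\ge r$. $\widetilde{\mathcal C}^{\alpha+1}(R,r,\zeta)$ is the set of c.d.f.s $F$ having a $\tau$-quantile $q_\tau\in\mathbb R$ with $F\in\widetilde{\mathcal C}^{\alpha+1}(R,r,[q_\tau-\zeta,q_\tau+\zeta])$. $\mathcal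 D^\beta(R,\gamma)$ is the set of probability densities $f_\varepsilon$ on $\mathbb R$ with $\frac1R(1+|u|)^{-\beta}\le|\mathcal F f_\varepsilon(u)|\le R(1+|u|)^{-\beta}$, $|(\mathcal F f_\varepsilon)'(u)|\le R(1+|u|)^{-1-\beta}$ for all $u\in\mathbb R$, and $\int|x|^\gamma f_\varepsilon(x)\,dx\le R$.
   Formalization: Since the classes can be empty or degenerate (e.g. R<1), the formal theorem also assumes r<R, that D^β(R',γ) is nonempty for some R'<R, 2ζr<1 for the first bound, and ζr<min(τ,1−τ) for the second. *)

(* Defs.v *)
From HB Require Import structures.
From mathcomp Require Import all_boot all_order all_algebra.
From mathcomp Require Import complex.
From mathcomp Require Import all_classical all_reals all_analysis.
From mathcomp Require Import measurable_realfun.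

Set Implicit Arguments.
Unset Strict Implicit.
Unset Printing Implicit Defensive.

Import Order.TTheory GRing.Theory Num.Theory.
Import numFieldNormedType.Exports.

Local Open Scope classical_set_scope.
Local Open Scope ring_scope.

Section product_probability.
Context d (T : measurableType d) (R : realType).

Definition tuple_cons n (xt : T * n.-tuple T) : n.+1.-tuple T :=
  [tuple of xt.1 :: xt.2].

Lemma measurable_tuple_cons n : measurable_fun setT (@tuple_cons n).
Proof. exact: measurable_cons. Qed.

HB.instance Definition _ n :=
  isMeasurableFun.Build _ _ _ _ (@tuple_cons n) (@measurable_tuple_cons n).

(* The n-fold product measure P x ... x P, see iid_law_rectangle *)
Fixpoint iid_law (P : probability T R) n : probability (n.-tuple T) R :=
  match n with
  | 0 => \d_ [tuple]
  | n'.+1 => distribution (P \x iid_law P n')%E (@tuple_cons n')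
  end.

Lemma iid_law_rectangle (P : probability T R) n (A : 'I_n -> set T) :
  (forall i, measurable (A i)) ->
  iid_law P n [set t | forall i, A i (tnth t i)] = (\prod_(i < n) P (A i))%E.
Proof.
elim: n A => [|n IH] A mA.
  rewrite big_ord0 /= diracE mem_set//=; case=> //.
rewrite big_ord_recl -IH//= /distribution /pushforward.
rewrite (_ : _ @^-1` _ = A ord0 `*`
    [set t | forall i, A (lift ord0 i) (tnth t i)]); last first.
  apply/seteqP; split=> -[x t] /=.
    move=> h; split; first exact: (h ord0).
    by move=> i; have := h (lift ord0 i); rewrite /tuple_cons/= tnthS.
  move=> [h0 h] i; case: (unliftP ord0 i) => [j ->|->//].
  by rewrite /tuple_cons/= tnthS.
have mB : measurable [set t : n.-tuple T |
    forall i, A (lift ord0 i) (tnth t i)].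
  rewrite (_ : [set _ | _] = \bigcap_(i in [set: 'I_n])
      ((@tnth _ T ^~ i) @^-1` A (lift ord0 i))).
    apply: fin_bigcap_measurable => // i _; rewrite -[X in measurable X]setTI.
    exact: measurable_tnth.
  by apply/seteqP; split=> t /= h i; [move=> _|]; exact: h.
by rewrite product_measure1E.
Qed.

End product_probability.

Section densities.
Context (R : realType).
Local Notation mu := (@lebesgue_measure R).

Record density := Density {
  density_fun :> R -> R ;
  density_measurable : measurable_fun setT density_fun ;
  density_ge0 : forall x, 0 <= density_fun x ;
  density_int1 : (\int[mu]_x (density_fun x)%:E = 1)%E }.

Definition density_prob (f : density) (A : set (measurableTypeR R)) : \bar R :=
  (\int[mu]_(x in A) (f x)%:E)%E.

Variable f : density.

Let density_prob0 : density_prob f set0 = 0%E.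
Proof. exact: integral_set0. Qed.

Let density_prob_ge0 A : (0 <= density_prob f A)%E.
Proof. by apply: integral_ge0 => x _; rewrite lee_fin density_ge0. Qed.

Let density_prob_sigma_additive : semi_sigma_additive (density_prob f).
Proof.
move=> A mA tA mUA; rewrite /density_prob ge0_integral_bigcup//=.
- apply: is_cvg_ereal_nneg_natsum_cond => n _ _; exact: density_prob_ge0.
- apply/measurable_EFinP; apply: measurable_funTS; exact: density_measurable.
- by move=> x _; rewrite lee_fin density_ge0.
Qed.

HB.instance Definition _ := isMeasure.Build _ _ _ (density_prob f)
  density_prob0 density_prob_ge0 density_prob_sigma_additive.

Let density_prob_setT : density_prob f setT = 1%E.
Proof. exact: density_int1. Qed.

HB.instance Definition _ :=
  Measure_isProbability.Build _ _ R (density_prob f) density_prob_setT.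

End densities.

Section classes.
Context (R : realType).
Local Notation mu := (@lebesgue_measure R).
Local Notation normc := ComplexField.Normc.normc.
Implicit Types (I : set R) (f g : R -> R).

(* A c.d.f. is a nondecreasing right-continuous function with limits 0 and 1;
   its law is its Lebesgue-Stieltjes measure. *)
Definition cdf_fun := cumulativeBounded (0 : R) (1 : R).

Definition quantile (tau : R) (F : cdf_fun) : R := inf [set x | tau <= F x].

(* Derivatives are taken relatively to I: they are one-sided at the endpoints
   of I and do not depend on the values of g outside I. *)
Definition diff_quot I g x : set_system R :=
  (g y - g x) / (y - x) @[y --> within I x^'].

Definition derivable_in I g x := cvg (diff_quot I g x).

Definition derive_in I g : R -> R := fun x => lim (diff_quot I g x).

Definition derive_in_n I k g : R -> R := iter k (derive_in I) g.

(* Largest integer strictly smaller than a, for a > 0 *)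
Definition strict_floor (a : R) : nat := `|Num.ceil a - 1|%N.

Definition holder_norm I (a : R) g : \bar R :=
  let k := strict_floor a in
  (\sum_(j < k.+1) 'N[mu]_+oo [(EFin \o derive_in_n I j g) \_ I] +
   ereal_sup [set (`|derive_in_n I k g z.1 - derive_in_n I k g z.2| /
                   `|z.1 - z.2| `^ (a - k%:R))%:E |
              z in [set z : R * R | [/\ I z.1, I z.2 & z.1 != z.2]]])%E.

Definition holder_ball I (a K : R) : set (R -> R) := [set g : R -> R |
  [/\ {within I, continuous g},
      [bounded g x | x in I],
      forall k x, (k < strict_floor a)%N -> I x ->
        derivable_in I (derive_in_n I k g) x &
      (holder_norm I a g <= K%:E)%E]].

Definition has_density_on I (F : cdf_fun) f :=
  forall A, measurable A -> A `<=` I ->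
    lebesgue_stieltjes_measure F A = (\int[mu]_(x in A) (f x)%:E)%E.

(* a is the Hoelder exponent of the density, so F has smoothness a + 1. *)
Definition cdf_class (a K r : R) I : set cdf_fun := [set F |
  exists f, [/\ has_density_on I F f, holder_ball I a K f &
                forall x, I x -> r <= f x]].

Definition quantile_cdf_class (tau a K r zeta : R) : set cdf_fun := [set F |
  cdf_class a K r `[quantile tau F - zeta, quantile tau F + zeta] F].

Definition fourier g (u : R) : R[i] :=
  Complex (\int[mu]_x (cos (u * x) * g x)) (\int[mu]_x (sin (u * x) * g x)).

Definition derivable_complex (phi : R -> R[i]) u :=
  derivable (fun v => complex.Re (phi v)) u 1 /\
  derivable (fun v => complex.Im (phi v)) u 1.

Definition derive_complex (phi : R -> R[i]) (u : R) : R[i] :=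
  Complex (derive1 (fun v => complex.Re (phi v)) u)
          (derive1 (fun v => complex.Im (phi v)) u).

Definition error_class (b K gamma : R) : set (density R) := [set f : density R |
  [/\ forall u, K^-1 * (1 + `|u|) `^ (- b) <= normc (fourier f u) /\
                normc (fourier f u) <= K * (1 + `|u|) `^ (- b),
      forall u, derivable_complex (fourier f) u /\
        normc (derive_complex (fourier f) u) <= K * (1 + `|u|) `^ (- 1 - b) &
      (\int[mu]_x (`|x| `^ gamma * f x)%:E <= K%:E)%E]].

End classes.

Section model.
Context (R : realType).
(* The Borel structure on which the library defines Lebesgue and
   Lebesgue-Stieltjes measures *)
Local Notation RB := (measurableTypeR R).

Definition cdf_law (F : cdf_fun R) : probability RB R :=
  lebesgue_stieltjes_measure F.

Definition error_law (f : density R) : probability RB R := density_prob f.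

(* The coordinates are (X_j, eps_j) for j < n and eps*_k for k < m. Under the
   product measure model_prob they are all independent, so that the Y_j and the
   eps*_k are. *)
Definition sample n m := (n.-tuple (RB * RB) * m.-tuple RB)%type.

Definition data n m := (n.-tuple RB * m.-tuple RB)%type.

Definition model_prob n m (F : cdf_fun R) (f : density R) :
    probability (sample n m) R :=
  (iid_law (cdf_law F \x error_law f)%E n \x iid_law (error_law f) m)%E.

Definition observations n m (w : sample n m) : data n m :=
  ([tuple ((tnth w.1 j).1 + (tnth w.1 j).2 : R) | j < n], w.2).

Definition estimator n m := {mfun data n m >-> R}.

Definition minimax_deviation n m (C : set (cdf_fun R)) (D : set (density R))
    (theta : cdf_fun R -> R) (s : R) : \bar R :=
  ereal_inf [set
    ereal_sup [set
      ereal_sup [set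
        model_prob n m F f [set w | `|T (observations w) - theta F| > s]
      | f in D]
    | F in C]
  | T in [set: estimator n m]].

End model.

(* Main.v *)
Require Import Defs.
From HB Require Import structures.
From mathcomp Require Import all_boot all_order all_algebra.
From mathcomp Require Import complex ring lra zify.
From mathcomp Require Import all_classical all_reals all_analysis.
From mathcomp Require Import measurable_realfun.
Set Implicit Arguments.
Unset Strict Implicit.
Unset Printing Implicit Defensive.

Import Order.TTheory GRing.Theory Num.Theory.
Import numFieldNormedType.Exports.

Local Open Scope classical_set_scope.
Local Open Scope ring_scope.

(** Two hypotheses are compared by Le Cam's method. Take an error density f of the class,
    cut off so that it has compact support, and a law G made of four atoms and of a uniform
    part around q, which carries a density strictly between r and K. For a nonnegative
    function m of mass less than 1 put mu_m = (1 - int m) delta_0 + m dx. If m0 is a small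
    trapezoid and m1 = m0 + nu with nu (y) = eta / s psi ((y - D) / s), psi a smooth bump of
    mean zero, then the convolutions F_i = G * mu_(m_i) and f_i = f * mu_(m_i) satisfy
    F_0 * f_1 = F_1 * f_0. Hence (F_0, f_0) and (F_1, f_0) are distinguished only by the Y_j,
    (F_1, f_0) and (F_0, f_1) only by the eps*_k, and both chi-square divergences are controlled
    by that of f_0 and f_1.
    As psi has a transform vanishing to a high order at 0, Plancherel gives
    int (f * nu)^2 <= C eta^2 s^(2 beta - 1), whereas F_1 (q) - F_0 (q) is of order eta and the
    Hoelder norm of the perturbation of the density around q, which one of the atoms of G
    shifts to q, is of order eta s^(- 1 - alpha). Choose s with s^(1 + alpha) of order eta if
    2 beta > 1 and s = 1 otherwise, and eta of the order of the rate. *)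

(** * Integrals on the line *)

(** The same law mu_(m_i) smooths both unknowns, so F_0 * f_1 and F_1 * f_0 are both the convolution
    of G, f, mu_(m_0) and mu_(m_1): a change of F can be compensated by a change of the error law,
    which is why a short error sample is an obstacle. Moreover F_1 * f_0 = F_0 * f_1 diverges from
    F_0 * f_0 at most as much as f_1 from f_0, so one estimate serves both samples. A chi-square
    divergence needs a lower bound on the reference density where the perturbation lives, and the
    tails of a general f give none. Hence the cut-off: f * nu then has compact support, m_0 is flat
    on a larger interval, and the divergence is at most the energy divided by the height of m_0.
    Truncating and mixing enlarge the constant of the class; an error law with a constant K' < K
    leaves room for this. Symmetry of m_0 and of the two inner atoms makes F_0 (q) equal to tau
    exactly. The two outer atoms lie out of reach of m_0 and m_1 and only balance the masses. *)

Section real_integrals.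
Context (R : realType).
Local Notation mu := (@lebesgue_measure R).
Implicit Types (f g h : R -> R).

Definition intble f : Prop := mu.-integrable setT (EFin \o f).

Lemma intble_measurable f : intble f -> measurable_fun setT f.
Proof. by move=> /integrableP[/measurable_EFinP]. Qed.

Lemma intbleP f : measurable_fun setT f -> (\int[mu]_x `|f x|%:E < +oo)%E ->
  intble f.
Proof. by move=> mf fi; apply/integrableP; split; [exact/measurable_EFinP|]. Qed.

Lemma intble_le f g : measurable_fun setT f -> intble g ->
  (forall x, `|f x| <= g x) -> intble f.
Proof.
move=> mf ig fg; apply: (le_integrable _ _ _ ig) => //.
  exact/measurable_EFinP.
by move=> x _ /=; rewrite lee_fin (le_trans (fg x))// ler_norm.
Qed.

Lemma intbleD f g : intble f -> intble g -> intble (fun x => f x + g x).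
Proof. exact: (@integrableD _ _ _ mu setT measurableT (EFin \o f) (EFin \o g)). Qed.

Lemma intbleZ (c : R) f : intble f -> intble (fun x => c * f x).
Proof. by move=> ?; exact: (@integrableZl _ _ _ mu setT measurableT c (EFin \o f)). Qed.

Lemma intbleN f : intble f -> intble (fun x => - f x).
Proof.
move=> /(intbleZ (-1)); rewrite /intble; congr integrable.
by apply/funext => x /=; rewrite mulN1r.
Qed.

Lemma intbleB f g : intble f -> intble g -> intble (fun x => f x - g x).
Proof. by move=> ? ?; apply: intbleD => //; exact: intbleN. Qed.

Lemma intble_norm f : intble f -> intble (fun x => `|f x|).
Proof. by move=> ?; exact: integrable_norm. Qed.

Lemma intbleM (C : R) f g : intble f -> measurable_fun setT g ->
  (forall x, `|g x| <= C) -> intble (fun x => g x * f x).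
Proof.
move=> fi mg gC; apply: (@intble_le _ (fun x => C * `|f x|)).
- by apply: measurable_funM => //; exact: intble_measurable.
- exact/intbleZ/intble_norm.
- by move=> x; rewrite normrM ler_wpM2r.
Qed.

Lemma intble_supp (B C : R) f : measurable_fun setT f ->
  (forall x, `|f x| <= C) -> (forall x, B < `|x| -> f x = 0) ->
  intble f /\ `|\int[mu]_x f x| <= C * (2 * `|B|).
Proof.
move=> mf fC f0.
have C0 : 0 <= C by apply: le_trans (fC 0).
have mB : mu `[- `|B|, `|B|] = (2 * `|B|)%:E.
  rewrite lebesgue_measure_itv/= lte_fin; case: ifPn.
    by move=> _; congr EFin; lra.
  rewrite -leNgt => B0; have B1 := normr_ge0 B.
  have -> : `|B| = 0 by lra.
  by rewrite mulr0.
have fE x : f x = (f \_ `[- `|B|, `|B|]) x.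
  rewrite patchE; case: ifPn => //; rewrite notin_setE/= in_itv/= => /negP.
  rewrite -ler_norml -ltNge => h; apply/f0/(le_lt_trans (ler_norm B) h).
have iB : mu.-integrable `[- `|B|, `|B|] (EFin \o f).
  apply: measurable_bounded_integrable => //=.
  - by rewrite mB ltry.
  - exact: measurable_funTS.
  - exists C; split; first exact: num_real.
    by move=> y Cy x _; exact: le_trans (fC x) (ltW Cy).
have fi : intble f.
  have -> : f = f \_ `[- `|B|, `|B|] by apply/funext => x; exact: fE.
  rewrite /intble -restrict_EFin.
  by apply/integrable_restrict => //; rewrite setTI.
split=> //.
have -> : \int[mu]_x f x = \int[mu]_(x in `[- `|B|, `|B|]) f x.
  by rewrite [RHS]Rintegral_mkcond; apply: eq_Rintegral => x _; rewrite fE.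
apply: le_trans (le_normr_Rintegral _ iB) _ => //.
have -> : C * (2 * `|B|) = \int[mu]_(x in `[- `|B|, `|B|]) C.
  by rewrite Rintegral_cst//= mB.
apply: le_Rintegral => //.
- exact: integrable_norm iB.
- apply: measurable_bounded_integrable => //=.
  + by rewrite mB ltry.
  + exact: bounded_cst.
Qed.

(** The image of Lebesgue measure under x -> a x + b, multiplied by |a|, gives every half-open
    interval its length, so it is Lebesgue measure. *)
Lemma ge0_integral_affine (a b : R) (f : R -> \bar R) : a != 0 ->
  measurable_fun setT f -> (forall x, 0 <= f x)%E ->
  (\int[mu]_x f x = `|a|%:E * \int[mu]_x f (a * x + b)%R)%E.
Proof.
move=> a0 mf f0.
have mT : measurable_fun setT (fun x : measurableTypeR R => a * x + b : measurableTypeR R).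
  by apply: measurable_funD => //; apply: measurable_funM.
pose pm := measure_function_pushforward__canonical__measure_function_Measure mu mT.
pose c := NngNum (normr_ge0 a).
pose m' : {measure set (measurableTypeR R) -> \bar R} := mscale c pm.
have muE : forall A, measurable A -> mu A = m' A.
  apply: lebesgue_measure_unique => X -[[u v] /= uv <-].
  rewrite /m' /mscale /= /pushforward.
  have [agt0|] := ltrP 0 a; last rewrite le_eqVlt (negbTE a0)/= => alt0.
    have -> : (fun x => a * x + b) @^-1` `]u, v] =
        `](u - b) / a, (v - b) / a]%classic.
      by apply/seteqP; split=> x /=; rewrite !in_itv/= ltr_pdivrMr// ler_pdivlMr//
        => /andP[? ?]; apply/andP; split; lra.
    rewrite !lebesgue_measure_itv/= !lte_fin ltr_pM2r ?invr_gt0// ltrD2r gtr0_norm//.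
    case: ifPn => _; last by rewrite mule0.
    by rewrite -!EFinD -EFinM; congr EFin; field.
  (* A negative slope exchanges the open and the closed end; the length is not affected. *)
  have -> : (fun x => a * x + b) @^-1` `]u, v] =
      `[(v - b) / a, (u - b) / a[%classic.
    by apply/seteqP; split=> x /=; rewrite !in_itv/= ltr_ndivlMr// ler_ndivrMr//
      => /andP[? ?]; apply/andP; split; lra.
  rewrite !lebesgue_measure_itv/= !lte_fin ltr_nM2r ?invr_lt0// ltrD2r ltr0_norm//.
  case: ifPn => _; last by rewrite mule0.
  by rewrite -!EFinD -EFinM; congr EFin; field.
transitivity (\int[m']_x f x)%E.
  by apply: eq_measure_integral => A mA _; exact: muE.
rewrite ge0_integral_mscale//= ge0_integral_pushforward//.
Qed.

Lemma Rintegral_affine (a b : R) f : a != 0 -> intble f ->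
  intble (fun x => f (a * x + b)) /\
  \int[mu]_x f x = `|a| * \int[mu]_x f (a * x + b).
Proof.
move=> a0 fi.
have mf := intble_measurable fi.
have mg : measurable_fun setT (fun x => f (a * x + b)).
  apply: (measurableT_comp mf).
  by apply: measurable_funD => //; apply: measurable_funM.
have ap : 0 < `|a| by rewrite normr_gt0.
have gi : intble (fun x => f (a * x + b)).
  apply: intbleP => //.
  have /integrableP[_] := fi.
  rewrite (@ge0_integral_affine a b (fun x => `|(f x)%:E|%E))//; last first.
    by apply: measurableT_comp => //; exact/measurable_EFinP.
  rewrite ltey => /eqP h; rewrite ltey; apply/eqP => h'; apply: h.
  by rewrite (_ : (\int[mu]_x _)%E = +oo%E)// mulry gtr0_sg// mul1e.
split=> //.
rewrite /Rintegral.
have -> : `|a| = fine `|a|%:E by [].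
rewrite -fineM//; last exact: integrable_fin_num.
have mE : measurable_fun setT (EFin \o f) by exact/measurable_EFinP.
congr fine; rewrite [LHS]integralE [in RHS]integralE muleBr//; last first.
  exact: (integrable_add_def measurableT gi).
congr (_ - _)%E.
  rewrite [LHS](@ge0_integral_affine a b _ a0 _ _)//.
    by congr (_ * _)%E; apply: eq_integral => x _; rewrite !funeposE.
  exact: measurable_funepos.
rewrite [LHS](@ge0_integral_affine a b _ a0 _ _)//.
  by congr (_ * _)%E; apply: eq_integral => x _; rewrite !funenegE.
exact: measurable_funeneg.
Qed.

End real_integrals.

(** * Fubini's theorem and the cosine transform with a phase *)

Section fubini_and_cosine_transform.
Context (R : realType).
Local Notation mu := (@lebesgue_measure R).
Local Notation RB := (measurableTypeR R).
Implicit Types (f g h : R -> R).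

Lemma EFin_Rintegral f : intble f -> (\int[mu]_x (f x)%:E = (\int[mu]_x f x)%:E)%E.
Proof. by move=> fi; rewrite /Rintegral fineK//; exact: integrable_fin_num. Qed.

Lemma RintZ (c : R) f : intble f -> \int[mu]_x (c * f x) = c * \int[mu]_x f x.
Proof. exact: RintegralZl. Qed.

Lemma RintD f g : intble f -> intble g ->
  \int[mu]_x (f x + g x) = \int[mu]_x f x + \int[mu]_x g x.
Proof. exact: RintegralD. Qed.

Lemma RintB f g : intble f -> intble g ->
  \int[mu]_x (f x - g x) = \int[mu]_x f x - \int[mu]_x g x.
Proof. exact: RintegralB. Qed.

Lemma Rint_le f g : intble f -> intble g -> (forall x, f x <= g x) ->
  \int[mu]_x f x <= \int[mu]_x g x.
Proof. by move=> fi gi fg; exact: (le_Rintegral measurableT fi gi). Qed.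

Lemma Rint_norm f : intble f -> `|\int[mu]_x f x| <= \int[mu]_x `|f x|.
Proof. by move=> fi; exact: (le_normr_Rintegral measurableT fi). Qed.

Lemma Rint_norm_le f g : intble f -> intble g -> (forall x, `|f x| <= g x) ->
  `|\int[mu]_x f x| <= \int[mu]_x g x.
Proof.
by move=> fi gi fg; apply: le_trans (Rint_norm fi) (Rint_le (intble_norm fi) gi fg).
Qed.

Lemma eq_intble f g : (forall x, f x = g x) -> intble f -> intble g.
Proof. by move=> /funext ->. Qed.

(** The product bound makes every section integrable, so both iterated integrals are meaningful at
    each point and not only almost everywhere. *)
Lemma Rfubini (F : RB * RB -> R) g h : measurable_fun setT F ->
  intble g -> intble h -> (forall x y, `|F (x, y)| <= g x * h y) ->
  [/\ intble (fun x => \int[mu]_y F (x, y)),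
      intble (fun y => \int[mu]_x F (x, y)) &
      \int[mu]_x \int[mu]_y F (x, y) = \int[mu]_y \int[mu]_x F (x, y)].
Proof.
move=> mF gi hi Fgh.
have mF1 x : measurable_fun setT (fun y : RB => F (x, y)).
  by apply: measurableT_comp mF _ => //; exact: measurable_pair1.
have mF2 y : measurable_fun setT (fun x : RB => F (x, y)).
  by apply: measurableT_comp mF _ => //; exact: measurable_pair2.
have i1 x : intble (fun y => F (x, y)).
  by apply: (@intble_le _ _ (fun y => g x * h y) _ (intbleZ (g x) hi)) => [|y]; [exact: mF1|exact: Fgh].
have i2 y : intble (fun x => F (x, y)).
  apply: (@intble_le _ _ (fun x => h y * g x) _ (intbleZ (h y) gi)) => [|x]; first exact: mF2.
  by rewrite mulrC; exact: Fgh.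
have e1 x : (\int[mu]_y (F (x, y))%:E = (\int[mu]_y F (x, y))%:E)%E.
  exact: EFin_Rintegral (i1 x).
have e2 y : (\int[mu]_x (F (x, y))%:E = (\int[mu]_x F (x, y))%:E)%E.
  exact: EFin_Rintegral (i2 y).
have iF : (mu \x mu)%E.-integrable setT (EFin \o F).
  have mEF : measurable_fun setT (EFin \o F) by exact/measurable_EFinP.
  apply/(integrable12ltyP mu mu mEF) => /=.
  apply: (@le_lt_trans _ _ (\int[mu]_x (g x * \int[mu]_y h y)%:E)%E).
    apply: ge0_le_integral => //.
    - by move=> x _; exact: integral_ge0.
    - apply: (@measurable_fun_fubini_tonelli_F _ _ RB RB R mu
        (fun z => `|(F z)%:E|%E)) => //.
      by apply: measurableT_comp => //.
    - apply/measurable_EFinP/measurable_funM => //.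
      exact: intble_measurable.
    - move=> x _.
      rewrite -RintegralZl// -EFin_Rintegral; last exact: intbleZ.
      apply: ge0_le_integral => //.
      + by apply/measurable_EFinP; apply: measurableT_comp (mF1 x).
      + by apply/measurable_EFinP/measurable_funM => //; apply: intble_measurable.
      + by move=> y _; rewrite /= lee_fin; exact: Fgh.
  have ighc : intble (fun x => g x * \int[mu]_y h y).
    rewrite /intble (_ : EFin \o _ = EFin \o (fun x => (\int[mu]_y h y) * g x)); last first.
      by apply/funext => x /=; rewrite mulrC.
    exact: intbleZ.
  by rewrite (EFin_Rintegral ighc) ltry.
split.
- rewrite /intble (_ : EFin \o _ = fubini_F mu (EFin \o F)); last first.
    by apply/funext => x /=; rewrite /fubini_F e1.
  exact: integrable_fubini_F.
- apply: (@intble_le _ _ (fun y => (\int[mu]_x g x) * h y)) => [||y].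
  + apply/measurable_EFinP; rewrite (_ : EFin \o _ = fubini_G mu (EFin \o F)).
      exact: (measurable_fubini_G iF).
    by apply/funext => y /=; rewrite /fubini_G e2.
  + exact: intbleZ.
  + apply: le_trans (le_normr_Rintegral _ (i2 y)) _ => //.
    rewrite mulrC -RintegralZl//; apply: le_Rintegral => //.
    * exact: intble_norm (i2 y).
    * exact: intbleZ.
    * by move=> x _; rewrite mulrC; exact: Fgh.
- have := Fubini iF => /=.
  under eq_integral do rewrite e1.
  under [in X in _ = X -> _]eq_integral do rewrite e2.
  by rewrite /Rintegral => ->.
Qed.

(** The real part of e^(i th) times the Fourier transform of [g] at [u]. The phase carries the whole
    complex transform: [th] = 0 gives its real part and [th] = - pi / 2 its imaginary part. *)
Definition cost g (th u : R) : R := \int[mu]_x (cos (th + u * x) * g x).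

Lemma measurable_cos_affine (th u : R) : measurable_fun setT (fun x : R => cos (th + u * x)).
Proof.
apply: measurableT_comp; first by apply: continuous_measurable_fun; exact: continuous_cos.
by apply: measurable_funD => //; apply: measurable_funM.
Qed.

Lemma cos_le1 (x : R) : `|cos x| <= 1.
Proof. by rewrite ler_norml cos_geN1 trigo.cos_le1. Qed.

Lemma intble_cos g (th u : R) : intble g -> intble (fun x => cos (th + u * x) * g x).
Proof. by move=> gi; apply: intbleM gi _ (fun=> cos_le1 _); exact: measurable_cos_affine. Qed.

Lemma cost_le g (th u : R) : intble g -> `|cost g th u| <= \int[mu]_x `|g x|.
Proof.
move=> gi; apply: le_trans (le_normr_Rintegral _ (intble_cos th u gi)) _ => //.
apply: le_Rintegral => //.
- exact/intble_norm/intble_cos.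
- exact: intble_norm.
- by move=> x _; rewrite normrM ler_piMl// cos_le1.
Qed.

Lemma costE g (th u : R) : intble g ->
  cost g th u = cos th * cost g 0 u + sin th * cost g (pi / 2) u.
Proof.
move=> gi; rewrite /cost -!RintegralZl//; [|exact: intble_cos..].
rewrite -RintegralD//; [|exact/intbleZ/intble_cos..].
apply: eq_Rintegral => x _.
by rewrite cosD add0r [cos (pi / 2 + _)]cosD cos_pihalf sin_pihalf; ring.
Qed.

Lemma costD g h (th u : R) : intble g -> intble h ->
  cost (fun x => g x + h x) th u = cost g th u + cost h th u.
Proof.
move=> gi hi; rewrite /cost -RintegralD//; [|exact: intble_cos..].
by apply: eq_Rintegral => x _; rewrite mulrDr.
Qed.

Lemma costZ (c : R) g (th u : R) : intble g ->
  cost (fun x => c * g x) th u = c * cost g th u.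
Proof.
move=> gi; rewrite /cost -RintegralZl//; last exact: intble_cos.
by apply: eq_Rintegral => x _; rewrite mulrCA.
Qed.

Lemma is_derive_cos_affine (th x u : R) :
  is_derive u 1 (fun v : R => cos (th + v * x)) (- sin (th + u * x) * x).
Proof.
have h : is_derive u 1 (fun v : R => th + v * x) x.
  apply: (@is_derive_eq _ _ _ _ _ _ _ _ (is_deriveD (is_derive_cst th u 1)
    (is_deriveM (is_derive_id u 1) (is_derive_cst x u 1)))).
  by rewrite scaler0 !add0r /GRing.scale/= mulr1.
exact: (@is_derive1_comp _ cos (fun v => th + v * x) u _ _ (is_derive_cos _) h).
Qed.

End fubini_and_cosine_transform.

(** * Cosine transforms *)

Section lipschitz_decay.
Context (R : realType).
Local Notation mu := (@lebesgue_measure R).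
Local Notation RB := (measurableTypeR R).
Implicit Types (f g h : R -> R).

Lemma is_derive_Rintegral (F dF : R -> R -> R) (G : R -> R) (a : R) :
  (forall u, intble (F u)) -> intble G ->
  (forall u y : R, is_derive u (1 : R) (F ^~ y) (dF u y)) ->
  (forall u y, `|dF u y| <= G y) ->
  is_derive a 1 (fun u => \int[mu]_y F u y) (\int[mu]_y dF a y).
Proof.
move=> iF iG DF dFG.
have d1E x y : partial1of2 F x y = dF x y.
  by rewrite partial1of2E; have /@derive_val := DF x y.
have G0 y : 0 <= G y by apply: le_trans (normr_ge0 _) (dFG a y).
have Ia : (`]a - 1, a + 1[%classic : set R) a by rewrite /= in_itv/=; apply/andP; split; lra.
have derF x y : (`]a - 1, a + 1[%classic : set R) x -> setT y -> derivable (F ^~ y) x 1.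
  by move=> _ _; have [] := DF x y.
have GF x y : (`]a - 1, a + 1[%classic : set R) x -> setT y -> `|partial1of2 F x y| <= G y.
  by move=> _ _; rewrite d1E.
have iF' x : (`]a - 1, a + 1[%classic : set R) x -> mu.-integrable setT (EFin \o F x).
  by move=> _; exact: iF.
have dd := derivable_under_integral (@measurableT _ _) Ia iF' derF G0 iG GF.
have de := differentiation_under_integral (@measurableT _ _) Ia iF' derF G0 iG GF.
split; first exact: dd.
rewrite -derive1E de; apply: eq_Rintegral => y _.
by rewrite d1E.
Qed.

Lemma is_derive_cost g (th u : R) : intble g -> intble (fun x => x * g x) ->
  is_derive u 1 (cost g th) (cost (fun x => x * g x) (th + pi / 2) u).
Proof.
move=> gi xgi.
have := @is_derive_Rintegral (fun v x => cos (th + v * x) * g x)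
  (fun v x => cos (th + pi / 2 + v * x) * (x * g x))
  (fun x => `|x * g x|) u _ (intble_norm xgi) _ _.
apply.
- by move=> v; exact: intble_cos.
- move=> v x; have := is_derive_cos_affine th x v => h.
  have : is_derive v 1 (fun w => cos (th + w * x) * g x)
      ((cos (th + v * x)) *: 0 + (g x) *: (- sin (th + v * x) * x)).
    exact: (is_deriveM h (is_derive_cst (g x) v 1)).
  move=> /is_derive_eq; apply; rewrite scaler0 add0r /GRing.scale/=.
  by rewrite addrAC [cos (_ + pi / 2)]cosD cos_pihalf sin_pihalf; ring.
- by move=> v x; rewrite normrM ler_piMl// cos_le1.
Qed.

Definition lip (L : R) f := forall x y, `|f x - f y| <= L * `|x - y|.

Definition supp (B : R) f := forall x, B < `|x| -> f x = 0.

Lemma lip_continuous L f : lip L f -> continuous f.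
Proof.
move=> Lf x; apply/cvgrPdist_le => e e0 /=.
have L0 : 0 <= L.
  by have := Lf 1 0; rewrite subr0 normr1 mulr1; exact: le_trans.
have L1 : 0 < L + 1 by lra.
near=> y.
apply: le_trans (Lf x y) _.
apply: (@le_trans _ _ ((L + 1) * `|x - y|)); first by rewrite ler_wpM2r//; lra.
rewrite mulrC -ler_pdivlMr//.
near: y.
have e1 : 0 < e / (L + 1) by rewrite divr_gt0.
by exists (e / (L + 1)) => // z /=; exact: ltW.
Unshelve. all: end_near. Qed.

Lemma lip_measurable L f : lip L f -> measurable_fun setT (f : RB -> RB).
Proof. by move=> /lip_continuous; exact: continuous_measurable_fun. Qed.

Lemma lip_supp_le L B f : 0 <= B -> lip L f -> supp B f ->
  forall x, `|f x| <= L * (2 * B + 1).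
Proof.
move=> B0 Lf sf x.
have L0 : 0 <= L.
  by have := Lf 1 0; rewrite subr0 normr1 mulr1; exact: le_trans.
have [xB|xB] := lerP `|x| B; last by rewrite sf// normr0 mulr_ge0//; lra.
have := Lf x (B + 1); rewrite [f (B + 1)]sf; last by rewrite ger0_norm; lra.
rewrite subr0 => /le_trans; apply; rewrite ler_wpM2l//.
rewrite (le_trans (ler_normB _ _))// [`|B + 1|]ger0_norm; lra.
Qed.

Lemma lip_supp_intble L B f : 0 <= B -> lip L f -> supp B f ->
  intble f /\ \int[mu]_x `|f x| <= L * (2 * B + 1) * (2 * B).
Proof.
move=> B0 Lf sf.
have [i _] := @intble_supp _ B _ f (lip_measurable Lf) (lip_supp_le B0 Lf sf) sf.
split=> //.
have [||x Bx|_] := @intble_supp _ B (L * (2 * B + 1)) (fun x => `|f x|).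
- by apply: measurableT_comp => //; exact: lip_measurable Lf.
- by move=> x; rewrite normr_id; exact: lip_supp_le.
- by rewrite sf// normr0.
- by rewrite [`|B|]ger0_norm// ger0_norm//; exact: Rintegral_ge0.
Qed.

Lemma lip_mulx L B f : 0 <= B -> lip L f -> supp B f ->
  lip (L * (3 * B + 1)) (fun x => x * f x).
Proof.
move=> B0 Lf sf x y.
have L0 : 0 <= L.
  by have := Lf 1 0; rewrite subr0 normr1 mulr1; exact: le_trans.
have Lxy : 0 <= L * `|x - y| by rewrite mulr_ge0.
have BLxy : 0 <= B * (L * `|x - y|) by rewrite mulr_ge0.
have [xB|xB] := lerP `|x| B; last first.
  rewrite (sf x)// mulr0 sub0r normrN normrM.
  have [yB|yB] := lerP `|y| B; last by rewrite sf// normr0 mulr0; nra.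
  have := Lf x y; rewrite (sf x)// sub0r normrN => h.
  by apply: le_trans (ler_pM _ _ yB h) _ => //; nra.
(* The two terms cost B L and L (2 B + 1) per unit of |x - y|, which add up to the constant. *)
have -> : x * f x - y * f y = x * (f x - f y) + (x - y) * f y by ring.
apply: le_trans (ler_normD _ _) _; rewrite !normrM.
have h1 := ler_pM (normr_ge0 x) (normr_ge0 _) xB (Lf x y).
have h2 := ler_wpM2l (normr_ge0 (x - y)) (lip_supp_le B0 Lf sf y).
nra.
Qed.

Lemma supp_mulx B f : supp B f -> supp B (fun x => x * f x).
Proof. by move=> sf x Bx; rewrite sf// mulr0. Qed.

(* Replacing x by x + pi / u flips the sign of the cosine. *)
Lemma cost_lip L B g (th u : R) : 0 <= B -> lip L g -> supp B g ->
  `|cost g th u| <= 32 * (B + 1) ^+ 2 * L / (1 + `|u|).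
Proof.
move=> B0 Lg sg.
have L0 : 0 <= L.
  by have := Lg 1 0; rewrite subr0 normr1 mulr1; exact: le_trans.
have [gi gi1] := lip_supp_intble B0 Lg sg.
have u0 := normr_ge0 u.
have LB : 0 <= L * B by rewrite mulr_ge0.
have LBB : 0 <= L * B * B by rewrite mulr_ge0.
rewrite ler_pdivlMr; last lra.
have [u1|u1] := lerP `|u| 1.
  have h := le_trans (cost_le th u gi) gi1.
  have h2 : `|cost g th u| * (1 + `|u|) <= (L * (2 * B + 1) * (2 * B)) * 2.
    by rewrite ler_pM//; lra.
  apply: le_trans h2 _; nra.
have un0 : u != 0 by rewrite -normr_eq0; lra.
pose h := pi / u.
have hi : `|h| <= 4 / `|u|.
  rewrite normrM normfV ler_wpM2r ?invr_ge0// gtr0_norm ?pi_gt0//.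
  have := @pihalf_lt2 R; lra.
have h4 : `|h| <= 4.
  apply: le_trans hi _; rewrite ler_pdivrMr; lra.
have [ci cE] := Rintegral_affine h (oner_neq0 R) (intble_cos th u gi).
have [gi' _] := Rintegral_affine h (oner_neq0 R) gi.
have ccE : cost g th u = - cost (fun x => g (x + h)) th u.
  rewrite {1}/cost cE normr1 mul1r -mulN1r -RintegralZl//; last first.
    by apply: intble_cos; rewrite /intble; under eq_fun do rewrite -[X in X + h]mul1r.
  apply: eq_Rintegral => x _; rewrite mul1r.
  have -> : th + u * (x + h) = th + u * x + pi by rewrite /h; field.
  by rewrite cosDpi; ring.
have gi'' : intble (fun x => g (x + h)).
  by move: gi'; under eq_fun do rewrite mul1r.
have c2 : 2 * cost g th u = cost (fun x => g x + (-1) * g (x + h)) th u.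
  rewrite costD//; last exact: intbleZ.
  by rewrite costZ// mulN1r -ccE; ring.
have mgh : measurable_fun setT (fun x : RB => g x + -1 * g (x + h)).
  by apply: intble_measurable; apply: intbleD => //; exact: intbleZ.
have [|||_] := @intble_supp _ (B + 4) (L * `|h|)
    (fun x => cos (th + u * x) * (g x + (-1) * g (x + h))).
- by apply: measurable_funM => //; exact: measurable_cos_affine.
- move=> x; rewrite normrM (le_trans (ler_piMl _ (cos_le1 _)))//.
  rewrite mulN1r (le_trans (Lg _ _))// opprD addrA subrr sub0r normrN//.
- move=> x Bx; rewrite sg ?sg; first by rewrite mulr0 addr0 mulr0.
    have := ler_normB (x + h) h; rewrite addrK; lra.
  lra.
rewrite -/(cost (fun x => g x + (-1) * g (x + h)) th u) -c2 normrM (ger0_norm (ler0n _ 2)).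
rewrite (ger0_norm (_ : 0 <= B + 4)); last lra.
move=> hh.
have k1 : 2 * `|cost g th u| <= L * (4 / `|u|) * (2 * (B + 4)).
  apply: le_trans hh _; rewrite ler_wpM2r//; first lra.
  by rewrite ler_wpM2l.
have k2 : `|cost g th u| * `|u| <= 4 * L * (B + 4).
  rewrite -ler_pdivlMr; last lra.
  have -> : 4 * L * (B + 4) / `|u| = L * (4 / `|u|) * (2 * (B + 4)) / 2 by field; lra.
  rewrite ler_pdivlMr//; lra.
have k3 : `|cost g th u| <= `|cost g th u| * `|u|.
  by rewrite ler_peMr//; lra.
nra.
Qed.

End lipschitz_decay.

(** * A smooth bump with an explicit cosine transform *)

Section box_transform.
Context (R : realType).
Local Notation mu := (@lebesgue_measure R).
Local Notation RB := (measurableTypeR R).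
Implicit Types (f g h : R -> R).

Lemma FTC_is_derive (F f : R -> R) (a b : R) : a < b ->
  (forall x : R, is_derive x (1 : R) F (f x)) -> continuous f ->
  \int[mu]_(x in `[a, b]) f x = F b - F a.
Proof.
move=> ab dF cf.
have cF : continuous F.
  by move=> x; apply/differentiable_continuous/derivable1_diffP; have [] := dF x.
rewrite /Rintegral (@continuous_FTC2 _ _ F)//.
- exact: continuous_subspaceT.
- split.
  + by move=> x _; have [] := dF x.
  + by apply: cvg_at_right_filter; exact: cF.
  + by apply: cvg_at_left_filter; exact: cF.
- by move=> x _; rewrite derive1E; apply: derive_val.
Qed.

(** The majorant of all transforms with quadratic decay. On the half-line it has the primitive - (1
    + v)^-1, so each half contributes 1. *)
Lemma intble_inv2 : intble (fun v : R => ((1 + `|v|) ^+ 2)^-1).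
Proof.
have cf : continuous (fun v : R => ((1 + `|v|) ^+ 2)^-1).
  move=> v; apply: cvgV.
    by rewrite expf_neq0// gt_eqF// ltr_pwDl.
  apply: (@continuous_comp _ _ _ (fun v : R => 1 + `|v|) (fun y => y ^+ 2)); last exact: exprn_continuous.
  by apply: cvgD; [exact: cvg_cst | exact: norm_continuous].
have mf := continuous_measurable_fun cf.
have f0 (v : R) : 0 <= ((1 + `|v|) ^+ 2)^-1 by rewrite invr_ge0 sqr_ge0.
apply: intbleP => //.
have dF (x : R) : 0 <= x -> is_derive x 1 (fun v : R => - (1 + v)^-1) ((1 + x) ^+ 2)^-1.
  move=> x0.
  have dd : is_derive x 1 (fun v : R => 1 + v) (0 + 1).
    exact: (is_deriveD (is_derive_cst _ _ _) (is_derive_id _ _)).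
  have x1 : 1 + x != 0 by rewrite gt_eqF//; lra.
  have := is_deriveN (is_deriveV x1 dd).
  move=> /is_derive_eq; apply.
  by rewrite add0r /GRing.scale/= mulr1 opprK.
have h : (\int[mu]_(x in `[0%R, +oo[) (((1 + `|x|) ^+ 2)^-1)%:E = 1%:E)%E.
  have -> : 1%:E = (0%:E - ((fun v : R => - (1 + v)^-1) 0)%:E)%E.
    by rewrite addr0 invr1 -EFinB sub0r opprK.
  apply: (@ge0_continuous_FTC2y _ _ (fun v : R => - (1 + v)^-1) 0 0) => //.
  - exact: continuous_subspaceT.
  - rewrite -[X in _ --> X]oppr0; apply: cvgN; apply/gtr0_cvgV0; last first.
      by apply: cvg_addrl; exact: cvg_id.
    by near=> x; rewrite ltr_pwDl//; near: x; exact: nbhs_pinfty_ge.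
  - by move=> x x0; have [] := dF x (ltW x0).
  - apply: cvg_at_right_filter.
    have [dd _] := dF 0 (lexx _).
    have : {for (0 : R), continuous (fun v : R => - (1 + v)^-1)}.
      exact/differentiable_continuous/derivable1_diffP.
    exact.
  - move=> x /[!in_itv]/= /andP[x0 _]; rewrite derive1E gtr0_norm//.
    by apply: derive_val; exact: dF (ltW x0).
have h' : (\int[mu]_(x in `]-oo, 0%R]) (((1 + `|x|) ^+ 2)^-1)%:E = 1%:E)%E.
  rewrite -h ge0_integration_by_substitution0//.
    by apply: eq_integral => x _; rewrite normrN.
  exact/measurable_EFinP.
have -> : (\int[mu]_x `|((1 + `|x|) ^+ 2)^-1|%:E = 1%:E + 1%:E)%E; last by rewrite ltry.
under eq_integral do rewrite ger0_norm//.
rewrite -{2}h -{1}h' -[in RHS]integral_itv_obnd_cbnd; last first.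
  by apply/measurable_EFinP; exact: measurable_funTS.
rewrite -ge0_integral_setU//=.
- by rewrite -setCitvr setvU.
- by apply/measurable_EFinP; exact: measurable_funTS.
- rewrite disj_set2E; apply/eqP; rewrite -subset0 => x []/= /[!in_itv]/=.
  by rewrite andbT leNgt => /negP.
Unshelve. all: end_near. Qed.

Definition box (x : R) : R := 2^-1 * \1_`[-1, 1]%classic x.

Definition sinc (v : R) := cost box 0 v.

Lemma measurable_box : measurable_fun setT (box : RB -> RB).
Proof. by apply: measurable_funM => //; exact: measurable_indic. Qed.

Lemma box_ge0 x : 0 <= box x.
Proof. by rewrite mulr_ge0. Qed.

Lemma box_le1 x : `|box x| <= 1.
Proof. by rewrite ger0_norm ?box_ge0// /box indicE; case: (_ \in _) => /=; lra. Qed.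

Lemma box_supp : supp 1 box.
Proof.
move=> x x1; rewrite /box indicE memNset ?mulr0//= in_itv/= => /andP[? ?].
by move: x1; rewrite ltNge ler_norml; apply/negP/negPn/andP.
Qed.

Lemma box_intble : intble box.
Proof. by have [] := intble_supp measurable_box box_le1 box_supp. Qed.

Lemma box_even x : box (- x) = box x.
Proof.
rewrite /box !indicE; congr (_ * (_ : bool)%:R); apply/idP/idP; rewrite !inE/= !in_itv/= => ?; apply/andP; split; lra.
Qed.

Lemma sincE v : v != 0 -> sinc v = sin v / v.
Proof.
move=> v0.
have cc : continuous (fun x : R => 2^-1 * cos (v * x)).
  move=> x; apply: cvgM; first exact: cvg_cst.
  apply: (@continuous_comp _ _ _ (fun x => v * x) cos); last exact: continuous_cos.
  by apply: cvgM; [exact: cvg_cst|exact: cvg_id].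
transitivity (\int[mu]_(x in `[-1, 1]) (2^-1 * cos (v * x))).
  rewrite Rintegral_mkcond; apply: eq_Rintegral => x _.
  rewrite patchE /box indicE add0r; case: (_ \in _); first by rewrite mulr1 mulrC.
  by rewrite !mulr0.
have dF (x : R) : is_derive x (1 : R) (fun x => (2 * v)^-1 * sin (v * x)) (2^-1 * cos (v * x)).
  have h : is_derive x 1 (fun x : R => v * x) v.
    apply: (is_derive_eq (is_deriveM (is_derive_cst v x 1) (is_derive_id x 1))).
    by rewrite scaler0 addr0 /GRing.scale/= mulr1.
  have hs : is_derive x 1 (fun x : R => sin (v * x)) (cos (v * x) * v).
    exact: (@is_derive1_comp _ sin (fun x => v * x) x _ _ (is_derive_sin _) h).
  apply: (is_derive_eq (is_deriveM (is_derive_cst (2 * v)^-1 x 1) hs)).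
  by rewrite scaler0 addr0 /GRing.scale/=; field.
have ab : -1 < 1 :> R by lra.
rewrite (FTC_is_derive ab dF cc).
by rewrite mulr1 mulrN1 sinN; field.
Qed.

Lemma sinc_bound v : `|sinc v| <= 2 / (1 + `|v|).
Proof.
have v0 := normr_ge0 v.
have s1 : `|sinc v| <= 1.
  apply: le_trans (cost_le _ _ box_intble) _.
  have b2 x : `| (fun y => `|box y|) x| <= 2^-1.
    by rewrite /= normr_id ger0_norm ?box_ge0// /box indicE; case: (_ \in _) => /=; lra.
  have [|x /box_supp ->|_] := @intble_supp _ 1 2^-1 (fun x => `|box x|) _ b2.
  - by apply: measurableT_comp => //; exact: measurable_box.
  - by rewrite normr0.
  - rewrite normr1 ger0_norm; last by apply: Rintegral_ge0.
    by move=> /le_trans; apply; lra.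
rewrite ler_pdivlMr; last lra.
have [ve|vn0] := eqVneq v 0; first by move: s1; rewrite ve normr0; lra.
(* Added to |sinc v| <= 1 this gives the claim: one bound serves small v, the other large v. *)
have : `|sinc v| * `|v| <= 1.
  rewrite sincE// normrM normfV mulfVK ?normr_eq0// ler_norml sin_geN1 sin_le1//.
by lra.
Qed.

End box_transform.

(** * Inversion of cosine transforms under averages and differences *)

Section inversion.
Context (R : realType).
Local Notation mu := (@lebesgue_measure R).
Local Notation RB := (measurableTypeR R).
Implicit Types (f g h : R -> R).

Lemma cost_continuous g th : intble g -> intble (fun x => x * g x) ->
  continuous (cost g th).
Proof.
move=> gi xgi x; apply/differentiable_continuous/derivable1_diffP.
by have [] := is_derive_cost th x gi xgi.
Qed.

Lemma sinc_continuous : continuous (@sinc R).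
Proof.
apply: cost_continuous; first exact: box_intble.
have [||x x1|//] := @intble_supp R 1 1 (fun x : R => x * box x).
- by apply: measurable_funM => //; exact: measurable_box.
- move=> x; have [x1|x1] := lerP `|x| 1; last by rewrite (box_supp x1) mulr0 normr0.
  rewrite normrM -[X in _ <= X]mulr1 ler_pM//; exact: box_le1.
- by rewrite (box_supp x1) mulr0.
Qed.

Lemma intble_shift f (a : R) : intble f -> intble (fun x => f (x + a)).
Proof.
by move=> /(Rintegral_affine a (oner_neq0 R))[+ _]; under eq_fun do rewrite mul1r.
Qed.

Lemma Rintegral_shift f (a : R) : intble f -> \int[mu]_x f (x + a) = \int[mu]_x f x.
Proof.
move=> /(Rintegral_affine a (oner_neq0 R))[_ ->]; rewrite normr1 mul1r.
by apply: eq_Rintegral => x _; rewrite mul1r.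
Qed.

Lemma Rintegral_opp f : intble f -> \int[mu]_x f (- x) = \int[mu]_x f x.
Proof.
have n1 : (-1 : R) != 0 by rewrite oppr_eq0 oner_neq0.
move=> /(Rintegral_affine 0 n1)[_ ->]; rewrite normrN1 mul1r.
by apply: eq_Rintegral => x _; rewrite mulN1r addr0.
Qed.

Lemma Rintegral_0 f : (forall x, f x = 0) -> \int[mu]_x f x = 0.
Proof.
by move=> f0; rewrite (_ : f = cst 0) ?Rintegral_cst ?mul0r//; exact/funext.
Qed.

Lemma cost_shift g (a th u : R) : intble g ->
  cost (fun x => g (x + a)) th u = cost g (th - u * a) u.
Proof.
move=> gi; rewrite {2}/cost -(Rintegral_shift a); last exact: intble_cos.
by apply: eq_Rintegral => x _; congr (cos _ * _); ring.
Qed.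

Lemma cost_even g th u : intble g -> (forall x, g (- x) = g x) ->
  cost g th u = cos th * cost g 0 u.
Proof.
move=> gi ge; rewrite costE// (_ : cost g (pi / 2) u = 0) ?mulr0 ?addr0//.
have : cost g (pi / 2) u = - cost g (pi / 2) u; last by lra.
rewrite {1}/cost -Rintegral_opp; last exact: intble_cos.
rewrite -mulN1r -RintegralZl//; last exact: intble_cos.
apply: eq_Rintegral => x _; rewrite ge !cosD cos_pihalf sin_pihalf mulrN sinN; ring.
Qed.

Lemma cost_oppv g u : cost g 0 (- u) = cost g 0 u.
Proof. by apply: eq_Rintegral => x _; rewrite !add0r mulNr cosN. Qed.

(** Convolution with [box]; the plus sign is harmless because [box] is even. The transform is
    multiplied by [sinc] and so gains one order of decay. *)
Definition mean h : R -> R := fun x => \int[mu]_t (box t * h (x + t)).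

Definition bsupp (B C : R) h := [/\ 0 <= B, measurable_fun setT (h : RB -> RB),
  forall x, `|h x| <= C & supp B h].

Lemma bsupp_intble B C h : bsupp B C h -> intble h.
Proof. by move=> [B0 mh hC hB]; have [] := intble_supp mh hC hB. Qed.

Lemma lip_bsupp L B h : 0 <= B -> lip L h -> supp B h ->
  bsupp B (L * (2 * B + 1)) h.
Proof. by split=> //; [exact: lip_measurable H0| exact: lip_supp_le]. Qed.

Lemma mean_kernel_fubini B C h (th v : R) : bsupp B C h ->
  let F := fun z : RB * RB => cos (th + v * z.1) * (box z.2 * h (z.1 + z.2)) in
  [/\ intble (fun x => \int[mu]_y F (x, y)),
      intble (fun y => \int[mu]_x F (x, y)) &
      \int[mu]_x \int[mu]_y F (x, y) = \int[mu]_y \int[mu]_x F (x, y)].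
Proof.
move=> [B0 mh hC hB] F.
have C0 : 0 <= C by apply: le_trans (hC 0).
have mF : measurable_fun setT F.
  apply: measurable_funM.
    by apply: (measurableT_comp (measurable_cos_affine th v)); exact: measurable_fst.
  apply: measurable_funM.
    by apply: (measurableT_comp (@measurable_box R)); exact: measurable_snd.
  apply: (measurableT_comp mh); apply: measurable_funD; [exact: measurable_fst|exact: measurable_snd].
pose g x : R := C * \1_`[- (B + 1), B + 1]%classic x.
have g0 x : 0 <= g x by rewrite mulr_ge0.
have gi : intble g.
  have [||x Bx|//] := @intble_supp _ (B + 1) C g.
  - by apply: measurable_funM => //; exact: measurable_indic.
  - by move=> x; rewrite ger0_norm// /g indicE; case: (_ \in _) => /=; rewrite ?mulr1 ?mulr0.
  - rewrite /g indicE memNset ?mulr0//= in_itv/= => /andP[? ?].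
    by move: Bx; rewrite ltNge ler_norml; apply/negP/negPn/andP.
apply: (Rfubini mF gi (box_intble R)) => x y.
rewrite /F /= normrM (le_trans (ler_piMl _ (cos_le1 _)))// normrM (ger0_norm (box_ge0 _)).
rewrite mulrC; have [y1|y1] := lerP `|y| 1; last by rewrite (box_supp y1) !mulr0.
rewrite ler_wpM2r ?box_ge0//.
have [xB|xB] := lerP `|x| (B + 1).
  by rewrite /g indicE mem_set ?mulr1//= in_itv/= -ler_norml.
rewrite hB ?normr0//.
have := ler_normB (x + y) y; rewrite addrK; lra.
Qed.

Lemma cost_mean B C h v : bsupp B C h -> (forall x, h (- x) = h x) ->
  cost (mean h) 0 v = sinc v * cost h 0 v.
Proof.
move=> hb he; have hi := bsupp_intble hb.
have [_ _ E] := mean_kernel_fubini 0 v hb.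
have -> : cost (mean h) 0 v = \int[mu]_x \int[mu]_t (cos (0 + v * x) * (box t * h (x + t))).
  apply: eq_Rintegral => x _; rewrite RintZ//.
  case: hb => B0 mh hC hB.
  have : intble (fun t => h (x + t) * box t).
    apply: (intbleM (box_intble R) _ (fun t => hC (x + t))).
    by apply: (measurableT_comp mh); exact: measurable_funD.
  by apply: eq_intble => t; rewrite mulrC.
rewrite E /= /sinc mulrC [cost (@box R) _ _]/cost -(RintZ _ (intble_cos 0 v (box_intble R))).
apply: eq_Rintegral => t _.
have -> : \int[mu]_x (cos (0 + v * x) * (box t * h (x + t))) =
    box t * cost (fun x => h (x + t)) 0 v.
  rewrite /cost -(RintZ _ (intble_cos 0 v (intble_shift t hi))).
  by apply: eq_Rintegral => x _; ring.
rewrite (cost_shift _ _ _ hi) (cost_even _ _ hi he) sub0r cosN add0r; ring.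
Qed.

(** Inversion is carried as a property of particular functions, with an unspecified constant [c] (in
    fact 2 pi), and is preserved by [mean] and [dif]. Knowing it for [tent] alone thus yields it for
    every function built from [tent] by these two operations. *)
Definition inverts (c : R) h :=
  [/\ exists L, lip L h, exists2 B, 0 <= B & supp B h, forall x, h (- x) = h x,
      intble (cost h 0) & forall x, cost (cost h 0) 0 x = c * h x].

Lemma inverts_intble c h : inverts c h -> intble h.
Proof. by move=> [[L Lh] [B B0 Bh] _ _ _]; have [] := lip_supp_intble B0 Lh Bh. Qed.

Lemma inverts_cost c h th v : inverts c h -> cost h th v = cos th * cost h 0 v.
Proof. by move=> hc; apply: cost_even; [exact: inverts_intble hc| case: hc]. Qed.

Lemma inverts_cost_hat c h th x : inverts c h ->
  cost (cost h 0) th x = c * (cos th * h x).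
Proof.
move=> [_ _ _ ih iE]; rewrite cost_even//; last by move=> y; exact: cost_oppv.
by rewrite iE mulrCA.
Qed.

(** On the transform side cos (x v) sinc v is the average of cos ((x + t) v) over [box]; exchanging
    the integrals turns inversion of [mean h] at x into inversion of [h] at x + t. *)
Lemma inverts_mean c h : inverts c h ->
  inverts c (mean h) /\ forall v, cost (mean h) 0 v = sinc v * cost h 0 v.
Proof.
move=> hc; have hi := inverts_intble hc; have hb := inverts_cost_hat _ _ hc.
case: hc => [[L Lh] [B B0 Bh] he ih iE].
have bh := lip_bsupp B0 Lh Bh.
have [_ mh hC _] := bh.
have cE v := cost_mean v bh he.
have ib x : intble (fun t => box t * h (x + t)).
  have : intble (fun t => h (x + t) * box t).
    apply: (intbleM (box_intble R) _ (fun t => hC (x + t))).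
    by apply: (measurableT_comp mh); exact: measurable_funD.
  by under eq_fun do rewrite mulrC.
split=> //; split.
- exists (L * \int[mu]_t (@box R t)) => x y.
  rewrite /mean -RintegralB//; [|exact: ib..].
  apply: le_trans (le_normr_Rintegral _ (intbleB (ib x) (ib y))) _ => //.
  rewrite mulrAC -RintegralZl//; last exact: box_intble.
  apply: le_Rintegral => //.
  + exact/intble_norm/intbleB.
  + by apply: intbleZ; exact: box_intble.
  + move=> t _; rewrite -mulrBr normrM ger0_norm ?box_ge0// mulrC ler_wpM2r ?box_ge0//.
    by have := Lh (x + t) (y + t); rewrite opprD addrACA subrr addr0.
- exists (B + 1); first lra.
  move=> x Bx; rewrite /mean; apply: Rintegral_0 => t.
  have [t1|t1] := lerP `|t| 1; last by rewrite (box_supp t1) mul0r.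
  rewrite Bh ?mulr0//.
  have := ler_normB (x + t) t; rewrite addrK; lra.
- move=> x; rewrite /mean -Rintegral_opp; last exact: ib.
  apply: eq_Rintegral => t _.
  by rewrite box_even -opprD he.
- rewrite (_ : cost _ _ = fun v => sinc v * cost h 0 v); last exact/funext.
  apply: (@intbleM _ 2) => //.
  + by apply: continuous_measurable_fun; exact: sinc_continuous.
  + move=> v; apply: le_trans (sinc_bound v) _.
    by rewrite ler_pdivrMr; have := normr_ge0 v; lra.
- move=> x; rewrite (_ : cost (mean h) 0 = fun v => sinc v * cost h 0 v); last exact/funext.
  rewrite /mean -RintegralZl//; last exact: ib.
  have mF : measurable_fun setT (fun z : RB * RB => box z.1 *
      (cos (x * z.2 + z.1 * z.2) * cost h 0 z.2)).
    apply: measurable_funM.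
      by apply: (measurableT_comp (@measurable_box R)); exact: measurable_fst.
    apply: measurable_funM.
      apply: measurableT_comp; first by apply: continuous_measurable_fun; exact: continuous_cos.
      have m2 : measurable_fun setT (snd : RB * RB -> RB) by exact: measurable_snd.
      have m1 : measurable_fun setT (fst : RB * RB -> RB) by exact: measurable_fst.
      by apply: measurable_funD; apply: measurable_funM.
    by apply: (measurableT_comp (intble_measurable ih)); exact: measurable_snd.
  have [|_ _ E] := Rfubini mF (box_intble R) (intble_norm ih).
    move=> t v; rewrite normrM ger0_norm ?box_ge0// ler_wpM2l ?box_ge0//.
    by rewrite normrM ler_piMl// cos_le1.
  have -> : \int[mu]_t (c * (box t * h (x + t))) = \int[mu]_t \int[mu]_v
      (box t * (cos (x * v + t * v) * cost h 0 v)).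
    apply: eq_Rintegral => t _; rewrite mulrCA -iE.
    have ii : intble (fun v => cos (x * v + t * v) * cost h 0 v).
      by apply: (eq_intble _ (intble_cos 0 (x + t) ih)) => v; rewrite add0r mulrDl.
    rewrite (RintZ _ ii); congr (_ * _).
    by apply: eq_Rintegral => v _; rewrite add0r mulrDl.
  rewrite E.
  apply: eq_Rintegral => v _ /=.
  have -> : cos (0 + x * v) * (sinc v * cost h 0 v) = cost h 0 v * cost (@box R) (x * v) v.
    by rewrite (cost_even _ _ (box_intble R) (@box_even R)) /sinc add0r; ring.
  rewrite [cost (@box R) _ _]/cost -(RintZ _ (intble_cos (x * v) v (box_intble R))).
  by apply: eq_Rintegral => t _; rewrite [t * v]mulrC; ring.
Qed.

(** A second difference of step 2, with symbol (1 - cos (2 v)) / 2 = (sin v) ^ 2: each application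
    makes the transform vanish to two more orders at 0. *)
Definition dif h : R -> R := fun x => 2^-1 * h x - 4^-1 * h (x + 2) - 4^-1 * h (x - 2).

Lemma inverts_dif c h : inverts c h ->
  inverts c (dif h) /\ forall v, cost (dif h) 0 v = sin v ^+ 2 * cost h 0 v.
Proof.
move=> hc; have hi := inverts_intble hc; have hE := inverts_cost 0 _ hc.
have hh := inverts_cost_hat 0 _ hc; have hct := fun th v => inverts_cost th v hc.
case: hc => [[L Lh] [B B0 Bh] he ih iE].
have s2 (v : R) : sin v ^+ 2 = 2^-1 * (1 - cos (2 * v)).
  by rewrite mulr_natl cos_mulr2n cos2sin2; field.
have dE v : cost (dif h) 0 v = sin v ^+ 2 * cost h 0 v.
  have i1 := intbleZ 2^-1 hi.
  have i2 := intbleZ (- 4^-1) (intble_shift 2 hi).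
  have i3 := intbleZ (- 4^-1) (intble_shift (- 2) hi).
  have -> : dif h = fun x => 2^-1 * h x + - 4^-1 * h (x + 2) + - 4^-1 * h (x - 2).
    by apply/funext => x; rewrite /dif; ring.
  rewrite (costD _ _ (intbleD i1 i2) i3) (costD _ _ i1 i2).
  rewrite (costZ _ _ _ hi) !(costZ _ _ _ (intble_shift _ hi)).
  rewrite !(cost_shift _ _ _ hi) !(hct (0 - _)) !sub0r mulrN opprK !cosN s2 [v * 2]mulrC; lra.
have L0 : 0 <= L by have := Lh 1 0; rewrite subr0 normr1 mulr1; exact: le_trans.
split=> //; split.
- exists L => x y.
  have -> : dif h x - dif h y = 2^-1 * (h x - h y) - 4^-1 * (h (x + 2) - h (y + 2))
    - 4^-1 * (h (x - 2) - h (y - 2)) by rewrite /dif; ring.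
  have h1 := Lh x y; have h2 := Lh (x + 2) (y + 2); have h3 := Lh (x - 2) (y - 2).
  have e2 : x + 2 - (y + 2) = x - y by ring.
  have e3 : x - 2 - (y - 2) = x - y by ring.
  rewrite e2 in h2; rewrite e3 in h3.
  apply: le_trans (ler_normB _ _) _; apply: le_trans (lerD (ler_normB _ _) (lexx _)) _.
  rewrite !normrM !(ger0_norm (_ : 0 <= _^-1)) ?invr_ge0//; lra.
- exists (B + 2); first lra.
  move=> x Bx; rewrite /dif !Bh ?mulr0 ?subr0//; last lra.
    by have := ler_normB x 2; rewrite (ger0_norm (ler0n _ 2)); have := ler_normD (x - 2) 2;
      rewrite subrK (ger0_norm (ler0n _ 2)); lra.
  by have := ler_normB (x + 2) 2; rewrite addrK (ger0_norm (ler0n _ 2)); lra.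
- move=> x; rewrite /dif he.
  have -> : - x + 2 = - (x - 2) by ring.
  have -> : - x - 2 = - (x + 2) by ring.
  by rewrite !he addrAC.
- rewrite (_ : cost _ _ = fun v => sin v ^+ 2 * cost h 0 v); last exact/funext.
  apply: (@intbleM _ 1) => //.
  + by apply: measurable_funX; apply: continuous_measurable_fun; exact: continuous_sin.
  + by move=> v; rewrite normrX expr_le1// ler_norml sin_geN1 sin_le1.
- move=> x; rewrite (_ : cost (dif h) 0 = fun v => sin v ^+ 2 * cost h 0 v); last exact/funext.
  have -> : c * dif h x = 2^-1 * cost (cost h 0) 0 x + - 4^-1 * cost (cost h 0) 0 (x + 2)
      + - 4^-1 * cost (cost h 0) 0 (x - 2) by rewrite !iE /dif; ring.
  have ii y : intble (fun v => cos (0 + y * v) * cost h 0 v) by exact: intble_cos.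
  rewrite ![cost (cost h 0) _ _]/cost -!(RintZ _ (ii _)).
  rewrite -(RintD (intbleZ _ (ii _)) (intbleZ _ (ii _))).
  rewrite -(RintD (intbleD (intbleZ _ (ii _)) (intbleZ _ (ii _))) (intbleZ _ (ii _))).
  rewrite {1}/cost; apply: eq_Rintegral => v _.
  have -> : 0 + (x + 2) * v = x * v + 2 * v by ring.
  have -> : 0 + (x - 2) * v = x * v - 2 * v by ring.
  by rewrite s2 add0r cosD cosB; field.
Qed.

End inversion.

Section tent_inversion.
Context (R : realType).
Local Notation mu := (@lebesgue_measure R).
Local Notation RB := (measurableTypeR R).
Implicit Types (f g h : R -> R).

Lemma Rint_indic (A : set RB) (r : R) : measurable A -> mu A = r%:E ->
  intble \1_A /\ \int[mu]_x (\1_A x : R) = r.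
Proof.
move=> mA Ar.
have E : (\int[mu]_x (\1_A x)%:E = r%:E :> \bar R)%E.
  by rewrite integral_indic// setIT; exact: Ar.
split; last by rewrite /Rintegral E.
apply: intbleP; first exact: measurable_indic.
by under eq_integral do rewrite ger0_norm//; rewrite E ltry.
Qed.

Lemma Rintegral_itv_gt0 f (a : R) (d : R) : 0 < d -> continuous f -> 0 < f a ->
  (forall x, `|x - a| <= d -> 0 <= f x) ->
  0 < \int[mu]_(x in `[a - d, a + d]) f x.
Proof.
move=> d0 cf fa f0.
have : \forall x \near a, f a / 2 < f x.
  have fa2 : f a / 2 < f a by lra.
  exact: (cvgr_gt (f a) (cf a) _ fa2).
move=> [e /= e0 ef].
pose k := Num.min d (e / 2).
have k0 : 0 < k by rewrite /k lt_min d0; lra.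
have kd : k <= d by rewrite /k ge_min lexx.
have ke : k < e by rewrite /k gt_min; apply/orP; right; lra.
have lef x : (f a / 2) * \1_`[a - k, a + k]%classic x <= (f \_ `[a - d, a + d]) x.
  rewrite patchE indicE; case: ifPn.
    rewrite inE/= in_itv/= => /andP[x1 x2].
    have xd : 0 <= f x by apply: f0; rewrite ler_norml; apply/andP; split; lra.
    case: (boolP (x \in _)) => /=; rewrite ?mulr1 ?mulr0//.
    rewrite inE/= in_itv/= => /andP[x3 x4]; apply/ltW/ef => /=.
    by rewrite distrC (le_lt_trans _ ke)// ler_norml; apply/andP; split; lra.
  rewrite notin_setE/= in_itv/= => nx; rewrite memNset/= ?mulr0// in_itv/= => /andP[x1 x2].
  by apply: nx; apply/andP; split; lra.
have mk : mu `[a - k, a + k] = (2 * k)%:E.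
  rewrite lebesgue_measure_itv/= lte_fin ifT; last lra.
  by rewrite -EFinB; congr EFin; lra.
have mI : measurable (`[a - k, a + k]%classic : set RB) by [].
have [i0 e2] := Rint_indic mI mk.
have i1 := intbleZ (f a / 2) i0.
have i2 : intble (f \_ `[a - d, a + d]).
  rewrite /intble -restrict_EFin; apply/integrable_restrict => //; rewrite setTI.
  by apply: continuous_compact_integrable; [exact: segment_compact| exact: continuous_subspaceT].
rewrite Rintegral_mkcond.
have := le_Rintegral (@measurableT _ _) i1 i2 (fun x _ => lef x); apply: lt_le_trans.
by rewrite (RintZ _ i0) e2; nra.
Qed.

Lemma Rintegral_gt0 f (a : R) : continuous f -> intble f -> (forall x, 0 <= f x) ->
  0 < f a -> 0 < \int[mu]_x f x.
Proof.
move=> cf fi f0 fa.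
apply: (lt_le_trans (@Rintegral_itv_gt0 f a 1 ltr01 cf fa (fun x _ => f0 x))).
rewrite Rintegral_mkcond; apply: le_Rintegral => //.
  rewrite -restrict_EFin; apply/integrable_restrict => //; rewrite setTI.
  exact: (integrableS (@measurableT _ _)).
by move=> x _; rewrite patchE; case: ifP.
Qed.

(** The triangle max (0, 2 - |x|) / 4, written as a second difference of the absolute value, which
    is the form in which the inversion formula produces it. *)
Definition tent (x : R) : R := (`|x + 2| + `|x - 2| - 2 * `|x|) / 8.

Lemma sinc0 : sinc 0 = 1 :> R.
Proof.
rewrite /sinc /cost.
transitivity (\int[mu]_x (2^-1 * \1_`[-1, 1]%classic x : R)).
  by apply: eq_Rintegral => x _; rewrite mul0r addr0 cos0 mul1r.
have m11 : mu `[-1, 1] = 2%:E.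
  rewrite lebesgue_measure_itv/= lte_fin ifT; last lra.
  by rewrite -EFinB; congr EFin; lra.
have mI : measurable (`[-1, 1]%classic : set RB) by [].
have [i0 e2] := Rint_indic mI m11.
by rewrite (RintZ _ i0) e2 mulVf.
Qed.

Lemma mean_box : mean (@box R) = tent.
Proof.
apply/funext => x; rewrite /mean.
pose I : interval R := `[Num.max (-1) (-1 - x), Num.min 1 (1 - x)].
transitivity (\int[mu]_t (4^-1 * \1_[set` I] t : R)).
  apply: eq_Rintegral => t _; rewrite /box !indicE /I.
  have -> : (t \in [set` `[Num.max (-1) (-1 - x), Num.min 1 (1 - x)]]) =
      (t \in [set` `[-1, 1]]) && (x + t \in [set` `[-1, 1]]).
    rewrite !mem_setE !in_itv/= ge_max le_min; apply/idP/idP.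
      by move=> /andP[/andP[? ?] /andP[? ?]]; apply/andP; split; apply/andP; split; lra.
    by move=> /andP[/andP[? ?] /andP[? ?]]; apply/andP; split; apply/andP; split; lra.
  by case: (t \in _) => /=; rewrite ?mulr0 ?mul0r// mulr1; case: (x + t \in _) => /=; lra.
have mI : mu [set` I] = (Num.max 0 (2 - `|x|))%:E.
  rewrite lebesgue_measure_itv/= lte_fin.
  have [x0|x0] := lerP 0 x.
    have -> : Num.max (-1) (-1 - x) = -1 by apply/max_idPl; lra.
    have -> : Num.min 1 (1 - x) = 1 - x by apply/min_idPr; lra.
    rewrite (ger0_norm x0); case: ifPn => [x2|]; last by rewrite -leNgt => x2; congr EFin; apply/esym/max_idPl; lra.
    by rewrite -EFinB; congr EFin; rewrite (_ : Num.max 0 _ = 2 - x); [lra|apply/max_idPr; lra].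
  have -> : Num.max (-1) (-1 - x) = -1 - x by apply/max_idPr; lra.
  have -> : Num.min 1 (1 - x) = 1 by apply/min_idPl; lra.
  rewrite (ltr0_norm x0); case: ifPn => [x2|]; last by rewrite -leNgt => x2; congr EFin; apply/esym/max_idPl; lra.
  by rewrite -EFinB; congr EFin; rewrite (_ : Num.max 0 _ = 2 - - x); [lra|apply/max_idPr; lra].
have mI' : measurable ([set` I] : set RB) by [].
have [i0 e2] := Rint_indic mI' mI.
rewrite (RintZ _ i0) e2 /tent.
have [x0|x0] := lerP 0 x; rewrite ?(ger0_norm x0) ?(ltr0_norm x0).
  rewrite (@ger0_norm _ (x + 2)); last lra.
  have [x2|x2] := lerP 0 (x - 2); rewrite ?(ger0_norm x2) ?(ltr0_norm x2).
    by rewrite (_ : Num.max 0 _ = 0); [lra|apply/max_idPl; lra].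
  by rewrite (_ : Num.max 0 _ = 2 - x); [lra|apply/max_idPr; lra].
rewrite (@ltr0_norm _ (x - 2)); last lra.
have [x2|x2] := lerP 0 (x + 2); rewrite ?(ger0_norm x2) ?(ltr0_norm x2).
  by rewrite (_ : Num.max 0 _ = 2 - - x); [lra|apply/max_idPr; lra].
by rewrite (_ : Num.max 0 _ = 0); [lra|apply/max_idPl; lra].
Qed.

Lemma box_bsupp : bsupp 1 1 (@box R).
Proof. by split=> //; [exact: measurable_box|exact: box_le1|exact: box_supp]. Qed.

Lemma cost_tent (v : R) : cost tent 0 v = sinc v ^+ 2.
Proof. by rewrite -mean_box (cost_mean _ box_bsupp (@box_even R)) expr2. Qed.

Lemma intble_sinc2 : intble (fun v : R => sinc v ^+ 2).
Proof.
apply: (intble_le _ (intbleZ 4 (@intble_inv2 R))).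
  by apply: measurable_funX; apply: continuous_measurable_fun; exact: sinc_continuous.
move=> v; rewrite normrX.
have -> : 4 * ((1 + `|v|) ^+ 2)^-1 = (2 / (1 + `|v|)) ^+ 2 by rewrite expr_div_n; lra.
by rewrite ler_sqr ?nnegrE ?sinc_bound// divr_ge0// addr_ge0.
Qed.

(* The integral of (1 - cos (x v)) / v ^ 2 over the line is proportional to |x| by scaling,
   and cos (x v) (sinc v) ^ 2 is a second difference of these integrands in x. *)
Lemma tent_inverts : exists2 c : R, 0 < c & inverts c tent.
Proof.
(* This is (1 - cos (x v)) / v ^ 2 with the singularity at v = 0 removed. *)
pose p (x v : R) := 2^-1 * x ^+ 2 * sinc (x / 2 * v) ^+ 2.
pose G := \int[mu]_v p 1 v.
have half0 : (2^-1 : R) != 0 by rewrite invr_neq0.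
have ps (x : R) : x != 0 -> intble (fun v => sinc (x * v) ^+ 2).
  move=> x0; have [+ _] := Rintegral_affine 0 x0 intble_sinc2.
  by under eq_fun do rewrite addr0.
have pi x : intble (p x).
  have [->|x0] := eqVneq x 0.
    rewrite (_ : p 0 = cst 0); last by apply/funext => v; rewrite /p expr0n/= mulr0 mul0r.
    by have := intbleZ 0 intble_sinc2; under eq_fun do rewrite mul0r.
  by apply: intbleZ; apply: ps; rewrite mulf_neq0.
have pE x : \int[mu]_v p x v = `|x| * G.
  have [->|x0] := eqVneq x 0.
    by rewrite normr0 mul0r; apply: Rintegral_0 => v; rewrite /p expr0n/= mulr0 mul0r.
  have [_ GE] := Rintegral_affine 0 x0 (pi 1).
  rewrite /G GE mulrA -expr2 -normrX ger0_norm ?sqr_ge0// -RintZ; last first.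
    by have [] := Rintegral_affine 0 x0 (pi 1).
  apply: eq_Rintegral => v _; rewrite /p addr0.
  have -> : 1 / 2 * (x * v) = x / 2 * v by ring.
  by ring.
have pv x v : v != 0 -> p x v = (1 - cos (x * v)) / v ^+ 2.
  move=> v0; have [->|x0] := eqVneq x 0.
    by rewrite /p !mul0r cos0 subrr expr0n/= !(mulr0, mul0r).
  rewrite /p sincE ?mulf_neq0//.
  have -> : x * v = (x / 2 * v) *+ 2 by rewrite -mulr_natr; field.
  rewrite cos_mulr2n cos2sin2; field; rewrite v0 x0 //.
have key x v : cos (0 + x * v) * sinc v ^+ 2 = 4^-1 * (p (x + 2) v + p (x - 2) v + (-2) * p x v).
  have [->|v0] := eqVneq v 0.
    by rewrite /p !mulr0 addr0 cos0 sinc0; field.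
  rewrite !pv// sincE// add0r.
  have -> : (x + 2) * v = x * v + 2 * v by ring.
  have -> : (x - 2) * v = x * v - 2 * v by ring.
  have e2 : cos (2 * v) = 1 - 2 * sin v ^+ 2.
    by rewrite mulr_natl cos_mulr2n cos2sin2; ring.
  by rewrite cosD cosB e2; field.
have inv x : cost (cost tent 0) 0 x = 2 * G * tent x.
  have -> : cost tent 0 = fun v => sinc v ^+ 2 by apply/funext => v; exact: cost_tent.
  rewrite /cost (_ : \int[mu]_v _ = \int[mu]_v (4^-1 * (p (x + 2) v + p (x - 2) v + (-2) * p x v))); last first.
    by apply: eq_Rintegral => v _; exact: key.
  have i1 := intbleD (pi (x + 2)) (pi (x - 2)).
  have i2 := intbleZ (-2) (pi x).
  rewrite (RintZ _ (intbleD i1 i2)) (RintD i1 i2) (RintD (pi _) (pi _)) (RintZ _ (pi x)).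
  by rewrite !pE /tent; field.
(* At x = 0 the formula says that 2 G times [tent 0] = 1 / 2 is the integral of sinc ^ 2, which is
   positive; hence G > 0. *)
exists (2 * G).
  have := inv 0.
  have -> : cost (cost tent 0) 0 0 = \int[mu]_v (sinc v ^+ 2).
    by apply: eq_Rintegral => v _; rewrite mul0r addr0 cos0 mul1r cost_tent.
  have : 0 < \int[mu]_v (sinc v ^+ 2 : R).
    apply: (@Rintegral_gt0 _ 0); last by rewrite sinc0 expr1n.
    - move=> v; apply: (@continuous_comp _ _ _ (@sinc R) (fun y => y ^+ 2)).
        exact: sinc_continuous.
      exact: exprn_continuous.
    - exact: intble_sinc2.
    - by move=> x; exact: sqr_ge0.
  rewrite /tent add0r sub0r normrN normr0 (ger0_norm (ler0n _ 2)); lra.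
split=> //.
- exists 1 => x y; rewrite /tent mul1r.
  have h1 := ler_dist_dist (x + 2) (y + 2); have h2 := ler_dist_dist (x - 2) (y - 2).
  have h3 := ler_dist_dist x y.
  have e1 : x + 2 - (y + 2) = x - y by ring.
  have e2 : x - 2 - (y - 2) = x - y by ring.
  rewrite e1 in h1; rewrite e2 in h2; move: h1 h2 h3; rewrite !ler_norml.
  by move=> /andP[? ?] /andP[? ?] /andP[? ?]; apply/andP; split; lra.
- exists 2 => // x; rewrite /tent.
  have [x0|x0] := lerP 0 x; rewrite ?(ger0_norm x0) ?(ltr0_norm x0) => x2.
    by rewrite (@ger0_norm _ (x + 2)) ?(@ger0_norm _ (x - 2)); lra.
  by rewrite (@ler0_norm _ (x + 2)) ?(@ler0_norm _ (x - 2)); lra.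
- move=> x; rewrite /tent.
  have -> : - x + 2 = - (x - 2) by ring.
  have -> : - x - 2 = - (x + 2) by ring.
  by rewrite !normrN; lra.
- rewrite (_ : cost tent 0 = fun v => sinc v ^+ 2); first exact: intble_sinc2.
  by apply/funext => v; exact: cost_tent.
Qed.

End tent_inversion.

(** * Cutoff and bump from box splines *)

Section splines.
Context (R : realType).
Local Notation mu := (@lebesgue_measure R).
Local Notation RB := (measurableTypeR R).
Implicit Types (f g h : R -> R).

(** The averages make the transform decay and the differences make it vanish at 0: it is (sin v) ^
    (2 N) (sinc v) ^ (n + 2). *)
Definition spline (N n : nat) : R -> R := iter N (@dif R) (iter n (@mean R) (@tent R)).

Lemma spline_inverts : exists2 c : R, 0 < c & forall N n,
  inverts c (spline N n) /\
  forall v, cost (spline N n) 0 v = sin v ^+ N.*2 * sinc v ^+ n.+2.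
Proof.
have [c c0 ct] := tent_inverts R; exists c => // N n.
elim: N => [|N [IH1 IH2]]; last first.
  have [h1 h2] := inverts_dif IH1; split=> // v.
  by rewrite [LHS]h2 IH2 doubleS !exprS; ring.
rewrite /spline /=.
elim: n => [|n [IH1 IH2]]; last first.
  have [h1 h2] := inverts_mean IH1; split=> // v.
  by rewrite [LHS]h2 IH2 !exprS; ring.
by split=> // v; rewrite cost_tent expr0 mul1r.
Qed.

Lemma mean_ge0 h : (forall x, 0 <= h x) -> forall x, 0 <= mean h x.
Proof. by move=> h0 x; apply: Rintegral_ge0 => t _; rewrite mulr_ge0 ?box_ge0. Qed.

Lemma tent_ge0 (x : R) : 0 <= tent x.
Proof. by rewrite -mean_box; apply: mean_ge0; exact: box_ge0. Qed.

Lemma cost_cost0 (k : R -> R) : cost k 0 0 = \int[mu]_v k v.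
Proof. by apply: eq_Rintegral => v _; rewrite mul0r addr0 cos0 mul1r. Qed.

Lemma sinc_exp_bound (n : nat) (v : R) :
  `|sinc v ^+ n| <= 2 ^+ n / (1 + `|v|) ^+ n.
Proof.
by rewrite normrX -expr_div_n; apply: lerXn2r; rewrite ?nnegrE ?sinc_bound ?divr_ge0 ?addr_ge0.
Qed.

(** A Fejer-type kernel: [k] is the normalised transform of a spline, so by inversion the transform
    of [k] is a multiple of that spline, nonnegative and of compact support. Multiplying a density
    by this transform truncates it, and acts on its Fourier transform as an average against [k]. *)
Lemma cutoff_exists (n : nat) : exists (k : R -> R) (C B : R),
  [/\ 0 < C, 0 < B, intble k, (forall v, 0 <= k v) & (forall v, k (- v) = k v)] /\
  [/\ (forall v, k v <= C / (1 + `|v|) ^+ n), (forall x, 0 <= cost k 0 x),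
      supp B (cost k 0) & \int[mu]_v k v = 1].
Proof.
have [c c0 H] := spline_inverts.
(* The exponent 2 n + 2 of sinc is even, which makes the kernel nonnegative. *)
have [hi hE] := H 0%N n.*2.
pose h := spline 0 n.*2; rewrite -/h in hi hE.
have h0 x : 0 <= h x.
  by rewrite /h /spline /=; elim: (n.*2) x => [|m IH] x /=; [exact: tent_ge0| exact: mean_ge0].
have kE v : cost h 0 v = sinc v ^+ n.*2.+2 by rewrite hE expr0 mul1r.
have k0 v : 0 <= cost h 0 v by rewrite kE -doubleS -mul2n exprM exprn_ge0// sqr_ge0.
have lb : 0 < \int[mu]_v (cost h 0 v).
  case: hi => _ _ _ ih _.
  have -> : \int[mu]_v (cost h 0 v) = \int[mu]_v (sinc v ^+ n.*2.+2).
    by apply: eq_Rintegral => v _; exact: kE.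
  apply: (@Rintegral_gt0 _ _ 0); last by rewrite sinc0 expr1n.
  - move=> v; apply: (@continuous_comp _ _ _ (@sinc R) (fun y => y ^+ n.*2.+2)).
      exact: sinc_continuous.
    exact: exprn_continuous.
  - exact: eq_intble kE ih.
  - by move=> x; rewrite -kE.
pose I := \int[mu]_v (cost h 0 v); rewrite -/I in lb.
have I0 : 0 < I^-1 by rewrite invr_gt0.
case: hi => _ [B B0 sB] he ih iE.
pose k v := I^-1 * cost h 0 v.
have ck x : cost k 0 x = I^-1 * (c * h x) by rewrite (costZ _ _ _ ih) iE.
exists k, (I^-1 * 2 ^+ n.*2.+2), (B + 1); split; split.
- by rewrite mulr_gt0// exprn_gt0.
- lra.
- exact: intbleZ.
- by move=> v; rewrite mulr_ge0// ltW.
- by move=> v; rewrite /k cost_oppv.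
- move=> v; rewrite /k -mulrA ler_pM2l// kE.
  apply: le_trans (ler_norm _) _; apply: le_trans (sinc_exp_bound _ _) _.
  rewrite ler_pM2l ?exprn_gt0// lef_pV2 ?posrE ?exprn_gt0 ?ltr_pwDl//.
  by apply: ler_weXn2l; [rewrite lerDl| lia].
- move=> x; rewrite ck; apply: mulr_ge0; first exact: ltW.
  by apply: mulr_ge0; [exact: ltW|exact: h0].
- by move=> x Bx; rewrite ck sB ?mulr0//; lra.
- by rewrite (RintZ _ ih) mulVf ?gt_eqF.
Qed.

Lemma intble_pow (k : R -> R) (C : R) (n j : nat) : measurable_fun setT (k : RB -> RB) ->
  (forall v, `|k v| <= C / (1 + `|v|) ^+ n.+2) -> (j <= n)%N ->
  intble (fun v => v ^+ j * k v).
Proof.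
move=> mk kC jn.
apply: (intble_le _ (intbleZ C (@intble_inv2 R))).
  by apply: measurable_funM => //; exact: measurable_funX.
move=> v; rewrite normrM normrX.
have v1 : 0 < 1 + `|v| by rewrite ltr_pwDl.
have C0 : 0 <= C.
  have := le_trans (normr_ge0 _) (kC v); rewrite pmulr_lge0// invr_gt0 exprn_gt0//.
apply: le_trans (ler_wpM2l _ (kC v)) _; first exact: exprn_ge0.
rewrite mulrCA ler_wpM2l// -[n.+2]addn2 exprD invfM mulrA.
have a2 : 0 <= ((1 + `|v|) ^+ 2)^-1 by rewrite invr_ge0 exprn_ge0// ltW.
suff a1 : `|v| ^+ j * ((1 + `|v|) ^+ n)^-1 <= 1 by have := ler_wpM2r a2 a1; rewrite mul1r.
rewrite ler_pdivrMr ?exprn_gt0// mul1r.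
apply: (@le_trans _ _ ((1 + `|v|) ^+ j)).
  by apply: lerXn2r; rewrite ?nnegrE; have := normr_ge0 v; lra.
by apply: ler_weXn2l => //; rewrite lerDl.
Qed.

(* The bump and its derivatives are read off from the inversion formula: the j-th derivative
   is the transform of the j-th moment. *)
Lemma bump_exists (N n : nat) : (0 < N)%N -> exists (psi k : R -> R) (D : nat -> R -> R) (c L B M : R),
  [/\ 0 < c, 0 < L, 0 < B & 0 < M] /\
  [/\ lip L psi, supp B psi, \int[mu]_x psi x = 0 &
      exists x0, \int[mu]_(t in `]-oo, x0]) psi t != 0] /\
  [/\ intble k,
      (forall th v, cost psi th v = cos th * k v),
      (forall th x, cost k th x = c * (cos th * psi x)) &
      (forall v, `|k v| <= sin v ^+ N.*2 * (4 / (1 + `|v|) ^+ 2))] /\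
  [/\ D 0%N = psi,
      (forall j x, (j < n)%N -> is_derive x (1 : R) (D j) (D j.+1 x)) &
      (forall j x, (j <= n)%N -> `|D j x| <= M)].
Proof.
move=> N0.
have [c c0 H] := spline_inverts.
have [hi kE] := H N n.
pose h := spline N n; rewrite -/h in hi kE.
have hint := inverts_intble hi.
have hc th v := inverts_cost th v hi.
have kc th x := inverts_cost_hat th x hi.
pose k := cost h 0.
case: hi => [[L Lh] [B B0 sB] he ih iE].
have s0 v : 0 <= sin v ^+ N.*2 :> R by rewrite -mul2n exprM exprn_ge0// sqr_ge0.
have s1 v : sin v ^+ N.*2 <= 1 :> R.
  rewrite -mul2n exprM; apply: exprn_ile1; first exact: sqr_ge0.
  by rewrite sin2cos2 gerBl sqr_ge0.
have mk : measurable_fun setT (k : RB -> RB) by exact: intble_measurable ih.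
have kb v : `|k v| <= 2 ^+ n.+2 / (1 + `|v|) ^+ n.+2.
  rewrite /k kE normrM (ger0_norm (s0 v)).
  by apply: le_trans (sinc_exp_bound _ _); rewrite ler_piMl.
have ki j : (j <= n)%N -> intble (fun v => v ^+ j * k v) by exact: intble_pow mk kb.
pose D (j : nat) x := c^-1 * cost (fun v => v ^+ j * k v) (j%:R * (pi / 2)) x.
(* Summing over the orders gives a single bound for all derivatives up to [n]. *)
pose M := \sum_(j < n.+1) c^-1 * \int[mu]_v `|v ^+ j * k v|.
have M0 (j : 'I_n.+1) : 0 <= c^-1 * \int[mu]_v `|v ^+ j * k v|.
  by rewrite mulr_ge0 ?invr_ge0 ?(ltW c0)//; exact: Rintegral_ge0.
have D0 : D 0%N = h.
  apply/funext => x; rewrite /D mul0r.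
  have -> : (fun v => v ^+ 0 * k v) = cost h 0 by apply/funext => v; rewrite expr0 mul1r.
  by rewrite kc cos0 mul1r mulKf// gt_eqF.
(* The spline is not identically 0, since its transform at 1 is a product of powers of sin 1. *)
have h1 : exists z, h z != 0.
  apply: contrapT => /forallNP hz.
  have hz0 x : h x = 0 by apply/eqP; apply: contrapT; move: (hz x) => + /negP.
  have : cost h 0 1 = 0 by apply: Rintegral_0 => x; rewrite hz0 mulr0.
  have si : sin 1 != 0 :> R.
    by rewrite gt_eqF// sin_gt0_pi// ltr01/=; have := @pi_ge2 R; lra.
  rewrite kE sincE ?oner_neq0// divr1 => /eqP.
  by rewrite mulf_eq0 !expf_eq0 (negbTE si) !andbF.
have cont := lip_continuous Lh.
(* If all these primitives vanished, so would the integral over every bounded interval, which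
   contradicts continuity at a point where the spline is not 0. *)
have lebx : exists x0, \int[mu]_(t in `]-oo, x0]) h t != 0.
  apply: contrapT => /forallNP hz.
  have hz0 x : \int[mu]_(t in `]-oo, x]) h t = 0.
    by apply/eqP; apply: contrapT; move: (hz x) => + /negP.
  have [z zn0] := h1.
  have gen g : continuous g -> intble g -> (forall x, \int[mu]_(t in `]-oo, x]) g t = 0) ->
      0 < g z -> False.
    move=> cg ig gz gz0.
    have : \forall x \near z, 0 < g x by exact: (cvgr_gt (g z) (cg z) _ gz0).
    move=> [e /= e0 eg].
    have e2 : 0 < e / 2 by lra.
    have : 0 < \int[mu]_(x in `[z - e / 2, z + e / 2]) g x.
      apply: Rintegral_itv_gt0 => // x xe; apply/ltW/eg => /=.
      by rewrite distrC; lra.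
    have igS A : measurable A -> mu.-integrable A (EFin \o g).
      by move=> mA; exact: (integrableS measurableT mA).
    have hB := @Rintegral_itvB _ g -oo%O (BRight (z + e / 2)) (z - e / 2) (igS _ (measurable_itv _)).
    rewrite -Rintegral_itv_obnd_cbnd; last by apply: igS; exact: measurable_itv.
    rewrite -hB//; first by rewrite !gz subrr ltxx.
    by rewrite bnd_simp; lra.
  have [hz1|hz1] := ltrP 0 (h z); first exact: (gen h).
  apply: (gen (fun x => - h x)).
  - by move=> x; apply: cvgN; exact: cont.
  - exact: intbleN.
  - move=> x; transitivity (\int[mu]_(t in `]-oo, x]) (-1 * h t)).
      by apply: eq_Rintegral => t _; rewrite mulN1r.
    rewrite RintegralZl ?hz0 ?mulr0//; exact: (integrableS measurableT _ _ hint).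
  - by rewrite oppr_gt0 lt_neqAle zn0.
exists h, k, D, c, (`|L| + 1), (B + 1), (M + 1).
have MM0 : 0 <= M by apply: sumr_ge0 => i _; exact: M0.
have LL := ler_norm L; have LL0 := normr_ge0 L.
split; first by split=> //; lra.
split; first split=> //.
- by move=> x y; apply: le_trans (Lh x y) _; rewrite ler_wpM2r//; lra.
- by move=> x Bx; apply: sB; lra.
- have := kE 0; rewrite cost_cost0 => ->; rewrite sin0 expr0n.
  have -> : (N.*2 == 0)%N = false by lia.
  by rewrite mul0r.
split; first split=> //.
- move=> v; rewrite /k kE normrM (ger0_norm (s0 v)) ler_wpM2l//.
  apply: le_trans (_ : `|sinc v ^+ 2| <= _); last first.
    by apply: le_trans (sinc_exp_bound _ _) _; rewrite -natrX.
  rewrite -[n.+2]addn2 exprD normrM ler_piMl// normrX exprn_ile1//.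
  apply: le_trans (cost_le _ _ (@box_intble R)) _.
  have -> : \int[mu]_x `|@box R x| = sinc 0.
    rewrite /sinc cost_cost0; apply: eq_Rintegral => x _; rewrite ger0_norm// box_ge0//.
  by rewrite sinc0.
split=> //.
- move=> j x jn; rewrite /D.
  have i1 := ki j (ltnW jn).
  have i2 : intble (fun v => v * (v ^+ j * k v)).
    by apply: eq_intble (ki j.+1 jn) => v; rewrite exprS mulrA.
  have := is_derive_cost (j%:R * (pi / 2)) x i1 i2.
  move=> /(is_deriveM (is_derive_cst c^-1 x 1)) /is_derive_eq; apply.
  rewrite scaler0 addr0 /GRing.scale/=; congr (_ * _).
  rewrite (_ : (fun v => v * _) = (fun v => v ^+ j.+1 * k v)); last first.
    by apply/funext => v; rewrite exprS mulrA.
  by congr cost; rewrite -natr1; ring.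
- move=> j x jn; apply: (@le_trans _ _ M); last lra.
  rewrite /M (bigD1 (Ordinal (jn : (j < n.+1)%N)))//=.
  apply: (@le_trans _ _ (c^-1 * \int[mu]_v `|v ^+ j * k v|)); last first.
    by rewrite lerDl; apply: sumr_ge0 => i _; exact: M0.
  rewrite /D normrM gtr0_norm ?invr_gt0// ler_pM2l ?invr_gt0//.
  exact: cost_le (ki j jn).
Qed.

End splines.

(** * The class of error densities *)

Section error_class_cost.
Context (R : realType).
Local Notation mu := (@lebesgue_measure R).
Local Notation normc := ComplexField.Normc.normc.
Implicit Types (f g : R -> R) (a b : R).

(** The quantity inside the absolute value is the real part of e^(i th) (a + i b). *)
Lemma normc_upper a b th : `|cos th * a - sin th * b| <= Num.sqrt (a ^+ 2 + b ^+ 2).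
Proof.
rewrite -sqrtr_sqr ler_wsqrtr//.
have e : cos th ^+ 2 + sin th ^+ 2 = 1 by exact: cos2Dsin2.
have -> : a ^+ 2 + b ^+ 2 = (cos th * a - sin th * b) ^+ 2 + (sin th * a + cos th * b) ^+ 2.
  rewrite -[LHS]mul1r -e; ring.
by rewrite lerDl sqr_ge0.
Qed.

(** Rotate a + i b onto the positive half-line: the angle is acos (a / r) up to sign, the sign being
    opposite to that of b. *)
Lemma normc_attained a b : exists th, cos th * a - sin th * b = Num.sqrt (a ^+ 2 + b ^+ 2).
Proof.
set r := Num.sqrt _.
have r2 : r ^+ 2 = a ^+ 2 + b ^+ 2 by rewrite sqr_sqrtr// addr_ge0 ?sqr_ge0.
have r0 : 0 <= r by exact: sqrtr_ge0.
have [rz|rn] := eqVneq r 0.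
  have sa := sqr_ge0 a; have sb := sqr_ge0 b; rewrite rz expr0n /= in r2.
  have a0 : a ^+ 2 = 0 by lra.
  have b0 : b ^+ 2 = 0 by lra.
  exists 0; rewrite rz; move: a0 b0 => /eqP; rewrite sqrf_eq0 => /eqP -> /eqP.
  by rewrite sqrf_eq0 => /eqP ->; rewrite !mulr0 subrr.
have rp : 0 < r by rewrite lt_neqAle eq_sym rn.
have x1 : -1 <= a / r <= 1.
  rewrite -ler_norml normrM normfV (ger0_norm r0) ler_pdivrMr// mul1r.
  by rewrite /r -sqrtr_sqr ler_wsqrtr// lerDl sqr_ge0.
have sE : sin (acos (a / r)) = `|b| / r.
  rewrite sin_acos//.
  have -> : 1 - (a / r) ^+ 2 = (`|b| / r) ^+ 2.
    rewrite !expr_div_n real_normK ?num_real//.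
    have -> : b ^+ 2 = r ^+ 2 - a ^+ 2 by rewrite r2; ring.
    by field.
  by rewrite sqrtr_sqr ger0_norm// divr_ge0.
have cE : cos (acos (a / r)) = a / r by exact: acosK.
have [b0|b0] := lerP b 0.
  exists (acos (a / r)); rewrite sE cE (ler0_norm b0).
  have : r * r = a * a + b * b by rewrite -!expr2.
  by move=> h; apply: (mulfI rn); rewrite h; field.
exists (- acos (a / r)); rewrite cosN sinN sE cE (gtr0_norm b0).
have : r * r = a * a + b * b by rewrite -!expr2.
by move=> h; apply: (mulfI rn); rewrite h; field.
Qed.

Lemma density_intble (f : density R) : intble f.
Proof.
apply: intbleP; first exact: density_measurable.
by under eq_integral do rewrite ger0_norm ?density_ge0//; rewrite density_int1 ltry.
Qed.

Lemma fourier_re f u : complex.Re (fourier f u) = cost f 0 u.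
Proof. by apply: eq_Rintegral => x _; rewrite add0r. Qed.

Lemma fourier_im f u : complex.Im (fourier f u) = cost f (- (pi / 2)) u.
Proof. by apply: eq_Rintegral => x _; rewrite addrC cosBpihalf. Qed.

Lemma normc_fourier f u :
  normc (fourier f u) = Num.sqrt (cost f 0 u ^+ 2 + cost f (- (pi / 2)) u ^+ 2).
Proof. by rewrite -fourier_re -fourier_im. Qed.

Lemma cost_fourier f th u : intble f ->
  cost f th u = cos th * cost f 0 u - sin th * cost f (- (pi / 2)) u.
Proof.
move=> fi; rewrite costE// [cost f (- (pi / 2)) u]costE// cosN sinN cos_pihalf sin_pihalf; ring.
Qed.

(** The class of error densities without its moment condition and without complex numbers. A modulus
    is the maximum of the real part over all rotations, so upper bounds are asked for every phase
    and the lower bound for some phase. *)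
Definition cost_class (b K : R) f :=
  [/\ forall th u, `|cost f th u| <= K * (1 + `|u|) `^ (- b),
      forall u, exists th, K^-1 * (1 + `|u|) `^ (- b) <= cost f th u &
      forall th u, exists2 d, is_derive u (1 : R) (cost f th) d &
        `|d| <= K * (1 + `|u|) `^ (- 1 - b)].

Lemma error_classE (b K gamma : R) (f : density R) : error_class b K gamma f <->
  cost_class b K f /\ (\int[mu]_x (`|x| `^ gamma * f x)%:E <= K%:E)%E.
Proof.
have fi := density_intble f.
have reE : (fun v => complex.Re (fourier f v)) = cost f 0.
  by apply/funext => v; exact: fourier_re.
have imE : (fun v => complex.Im (fourier f v)) = cost f (- (pi / 2)).
  by apply/funext => v; exact: fourier_im.
split=> [[h1 h2 h3]|[[h1 h2 h3] h4]].
- split=> //; split.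
  + move=> th u; rewrite cost_fourier//; apply: le_trans (normc_upper _ _ _) _.
    by rewrite -normc_fourier; have [] := h1 u.
  + move=> u; have [th thE] := normc_attained (cost f 0 u) (cost f (- (pi / 2)) u).
    by exists th; rewrite cost_fourier// thE -normc_fourier; have [] := h1 u.
  + move=> th u; have [[d1 d2]] := h2 u.
    rewrite /derive_complex /ComplexField.Normc.normc /= reE imE => dn.
    exists (cos th * derive1 (cost f 0) u - sin th * derive1 (cost f (- (pi / 2))) u); last first.
      exact: le_trans (normc_upper _ _ _) dn.
    rewrite reE in d1; rewrite imE in d2.
    have -> : cost f th = fun v => cos th * cost f 0 v - sin th * cost f (- (pi / 2)) v.
      by apply/funext => v; exact: cost_fourier.
    have D1 : is_derive u (1 : R) (cost f 0) (derive1 (cost f 0) u).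
      by apply: DeriveDef; [exact: d1|rewrite derive1E].
    have D2 : is_derive u (1 : R) (cost f (- (pi / 2))) (derive1 (cost f (- (pi / 2))) u).
      by apply: DeriveDef; [exact: d2|rewrite derive1E].
    have D3 := is_deriveM (is_derive_cst (cos th) u 1) D1.
    have D4 := is_deriveM (is_derive_cst (sin th) u 1) D2.
    have := is_deriveB D3 D4; move=> /is_derive_eq; apply.
    by rewrite !scaler0 !addr0.
- split=> //.
  + move=> u; rewrite normc_fourier; split.
      have [th hth] := h2 u; apply: le_trans hth _.
      rewrite cost_fourier//; exact: le_trans (ler_norm _) (normc_upper _ _ _).
    have [th <-] := normc_attained (cost f 0 u) (cost f (- (pi / 2)) u).
    by rewrite -cost_fourier//; exact: le_trans (ler_norm _) (h1 _ _).
  + move=> u; have [d1 D1 _] := h3 0 u; have [d2 D2 _] := h3 (- (pi / 2)) u.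
    split; first by rewrite /derivable_complex reE imE; split; [case: D1|case: D2].
    rewrite /derive_complex /ComplexField.Normc.normc /= reE imE !derive1E !derive_val.
    (* The rotation is adapted to the derivative: at this phase the derivative of [cost f th] is the
       full modulus. *)
    have [th <-] := normc_attained d1 d2.
    have [d D dn] := h3 th u; apply: le_trans dn; apply: le_trans (ler_norm d); rewrite le_eqVlt; apply/orP; left; apply/eqP.
    have D3 := is_deriveM (is_derive_cst (cos th) u 1) D1.
    have D4 := is_deriveM (is_derive_cst (sin th) u 1) D2.
    have D5 := is_deriveB D3 D4.
    have E : cost f th = fun v => cos th * cost f 0 v - sin th * cost f (- (pi / 2)) v.
      by apply/funext => v; exact: cost_fourier.
    rewrite -(@derive_val _ _ _ _ _ _ _ D) E.
    rewrite [RHS](@derive_val _ _ _ _ _ _ _ D5).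
    rewrite !scaler0 !addr0 /GRing.scale /=; reflexivity.
Qed.

End error_class_cost.

(** * Truncation of an error density to compact support *)

Section truncation_tools.
Context (R : realType).
Local Notation mu := (@lebesgue_measure R).
Local Notation RB := (measurableTypeR R).
Implicit Types (F d : R -> R).

(** Peetre's inequality, from 1 + |u| <= (1 + |x|) (1 + |x - u|). It moves a polynomial weight from
    one frequency to another at the price of a power of 1 plus their distance. *)
Lemma peetre (s x u : R) : 0 <= s ->
  (1 + `|x|) `^ (- s) <= (1 + `|u|) `^ (- s) * (1 + `|x - u|) `^ s.
Proof.
move=> s0; rewrite !powRN.
have x1 : 0 < 1 + `|x| by rewrite ltr_pwDl.
have u1 : 0 < 1 + `|u| by rewrite ltr_pwDl.
have xu1 : 0 < 1 + `|x - u| by rewrite ltr_pwDl.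
rewrite mulrC ler_pdivlMr ?powR_gt0// mulrC ler_pdivrMr ?powR_gt0//.
rewrite -powRM; [|exact: ltW..].
apply: ge0_ler_powR; rewrite ?nnegrE; [lra|lra|apply: mulr_ge0; lra|].
have h1 : `|u| <= `|x - u| + `|x|.
  have := ler_normB x (x - u); have -> : x - (x - u) = u by ring.
  by move=> h; lra.
have h2 := mulr_ge0 (normr_ge0 x) (normr_ge0 (x - u)). nra.
Qed.

Lemma weight_le1 (s x : R) : 0 <= s -> (1 + `|x|) `^ (- s) <= 1.
Proof.
move=> s0; rewrite powRN invf_le1 ?powR_gt0 ?ltr_pwDl//.
by rewrite -[X in X <= _](powRr0 (1 + `|x|)) ler_powR// lerDl.
Qed.

Lemma derive_bound F d (x h M : R) : (forall y, is_derive y (1 : R) F (d y)) ->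
  (forall y, `|y - x| <= `|h| -> `|d y| <= M) ->
  `|F (x + h) - F x| <= M * `|h|.
Proof.
move=> dF dM.
have cF : continuous F.
  by move=> y; apply/differentiable_continuous/derivable1_diffP; have [] := dF y.
have [h0|h0] := lerP 0 h.
  have xh : x <= x + h by lra.
  have [c] := @MVT_segment _ F d x (x + h) xh (fun y _ => dF y) (continuous_subspaceT cF).
  rewrite in_itv/= => /andP[c1 c2] ->.
  have -> : x + h - x = h by ring.
  rewrite normrM ler_wpM2r// dM// (ger0_norm h0) ger0_norm; lra.
have xh : x + h <= x by lra.
have [c] := @MVT_segment _ F d (x + h) x xh (fun y _ => dF y) (continuous_subspaceT cF).
rewrite in_itv/= => /andP[c1 c2]; rewrite distrC => ->.
have -> : x - (x + h) = - h by ring.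
rewrite normrM normrN ler_wpM2r// dM// (ltr0_norm h0) ler0_norm; lra.
Qed.

(** The derivative is the pointwise limit of the difference quotients with increments 1 / (n + 1).
    Measurability has to be shown because the derivative of a transform, which need not be
    continuous, is averaged below. *)
Lemma derive_measurable F d : (forall y, is_derive y (1 : R) F (d y)) ->
  measurable_fun setT (d : RB -> RB).
Proof.
move=> dF.
have cF : continuous F.
  by move=> y; apply/differentiable_continuous/derivable1_diffP; have [] := dF y.
have mF := continuous_measurable_fun cF.
pose q (n : nat) (y : RB) : RB := n.+1%:R * (F (y + n.+1%:R^-1) - F y).
have mq n : measurable_fun setT (q n).
  apply: measurable_funM => //; apply: measurable_funB => //.
  by apply: (measurableT_comp mF); apply: measurable_funD.
suff qd y : setT y -> q x y @[x --> \oo] --> d y by exact: (measurable_fun_cvg mq qd).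
move=> _.
have [dd dv] := dF y.
have : h^-1 *: (F (h *: 1 + y) - F y) @[h --> 0^'] --> d y by rewrite -dv; exact: dd.
move=> /cvgr_dnbhsP /(_ (fun n => n.+1%:R^-1)) h.
have : (fun n => (n.+1%:R^-1)^-1 *: (F (n.+1%:R^-1 *: 1 + y) - F y)) n @[n --> \oo] --> d y.
  apply: h; split; first by move=> n; rewrite invr_neq0// pnatr_eq0.
  exact: cvg_harmonic.
apply: cvg_trans; apply: near_eq_cvg; apply: nearW => n.
by rewrite invrK /q /GRing.scale/= mulr1 [y + _]addrC.
Qed.

(** Convexity in [t]: the power lies below its chord between t = 0 and t = 1. The bound is 1 plus a
    term linear in [t], hence close to 1 for a mild truncation. *)
Lemma convex_pow (t y : R) (p : nat) : 0 <= t <= 1 -> 0 <= y ->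
  (1 + t * y) ^+ p <= 1 - t + t * (1 + y) ^+ p.
Proof.
move=> /andP[t0 t1] y0; elim: p => [|p IH]; first by rewrite !expr0; lra.
have A1 : 1 <= (1 + y) ^+ p by rewrite exprn_ege1// lerDl.
rewrite !exprS.
have ty : 0 <= t * y by rewrite mulr_ge0.
apply: le_trans (ler_wpM2l _ IH) _; first lra.
have h : 0 <= t * y * ((1 - t) * ((1 + y) ^+ p - 1)) by rewrite !mulr_ge0//; lra.
nra.
Qed.

End truncation_tools.

Section truncation.
Context (R : realType).
Local Notation mu := (@lebesgue_measure R).
Local Notation RB := (measurableTypeR R).

Lemma cost_class_derive (b K th : R) (f : R -> R) : cost_class b K f ->
  exists d : R -> R, (forall u, is_derive u (1 : R) (cost f th) (d u)) /\
    forall u, `|d u| <= K * (1 + `|u|) `^ (- (1 + b)).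
Proof.
move=> [_ _ H].
have /choice[d dP] : forall u, exists d : R, is_derive u (1 : R) (cost f th) d /\
    `|d| <= K * (1 + `|u|) `^ (- (1 + b)).
  by move=> u; have [d d1 d2] := H th u; exists d; split=> //; rewrite opprD.
by exists d; split=> u; have [] := dP u.
Qed.

Section smoothing.
Context (k : R -> R) (t : R) (f : density R).
Hypotheses (k0 : forall v, 0 <= k v) (ke : forall v, k (- v) = k v) (ki : intble k)
  (k1 : \int[mu]_v k v = 1) (t0 : 0 < t).

Let fi := density_intble f.

(** The truncated density before normalisation. The cutoff is dilated by 1 / t, so a small [t] means
    a wide support. *)
Let g0 x := cost k 0 (t * x) * f x.

Lemma smoothing_intble (G : R -> R) (C : R) : measurable_fun setT (G : RB -> RB) ->
  (forall x, `|G x| <= C) -> intble (fun v => k v * G v).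
Proof. by move=> mG GC; apply: eq_intble (intbleM ki mG GC) => v; rewrite mulrC. Qed.

Lemma cutoff_le1 x : `|cost k 0 x| <= 1.
Proof.
rewrite -k1; apply: le_trans (cost_le _ _ ki) _; rewrite le_eqVlt; apply/orP; left; apply/eqP.
by apply: eq_Rintegral => v _; rewrite ger0_norm.
Qed.

Lemma cost_fubini_smoothing (th u : R) :
  [/\ intble (fun x => cos (th + u * x) * g0 x),
      intble (fun v => \int[mu]_x (cos (th + u * x) * (cos (t * v * x) * (k v * f x)))) &
      cost g0 th u = \int[mu]_v \int[mu]_x (cos (th + u * x) * (cos (t * v * x) * (k v * f x)))].
Proof.
pose F (z : RB * RB) := cos (th + u * z.1) * (cos (t * z.2 * z.1) * (k z.2 * f z.1)).
have m2 : measurable_fun setT (snd : RB * RB -> RB) by exact: measurable_snd.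
have m1 : measurable_fun setT (fst : RB * RB -> RB) by exact: measurable_fst.
have mc : measurable_fun setT (@cos R : RB -> RB).
  by apply: continuous_measurable_fun; exact: continuous_cos.
have mF : measurable_fun setT F.
  apply: measurable_funM.
    by apply: (measurableT_comp (measurable_cos_affine th u)).
  apply: measurable_funM.
    apply: (measurableT_comp mc); apply: measurable_funM => //.
    by apply: measurable_funM.
  apply: measurable_funM.
    exact: (measurableT_comp (intble_measurable ki)).
  exact: (measurableT_comp (intble_measurable fi)).
have Fb x y : `|F (x, y)| <= f x * k y.
  rewrite /F /= normrM (le_trans (ler_piMl _ (cos_le1 _)))//.
  rewrite normrM (le_trans (ler_piMl _ (cos_le1 _)))//.
  by rewrite normrM (ger0_norm (k0 _)) (ger0_norm (density_ge0 _ _)) mulrC.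
have [h1 h2 h3] := Rfubini mF fi ki Fb.
have e x : \int[mu]_y F (x, y) = cos (th + u * x) * g0 x.
  rewrite /F /=.
  have ic : intble (fun v => cos (0 + t * x * v) * k v) by exact: intble_cos.
  have -> : cos (th + u * x) * g0 x =
      \int[mu]_v (cos (th + u * x) * f x * (cos (0 + t * x * v) * k v)).
    by rewrite (RintZ _ ic) /g0 -/(cost k 0 (t * x)) -mulrA [f x * _]mulrC.
  by apply: eq_Rintegral => v _; rewrite add0r [t * v * x]mulrAC; ring.
split; [exact: eq_intble e h1|exact: h2|].
by rewrite -h3; apply: eq_Rintegral => x _; rewrite e.
Qed.

(** The cutoff is itself a cosine transform, so its product with cos (th + u x) splits into the
    frequencies u + t v and u - t v; evenness of [k] merges the two halves into one average. *)
Lemma cost_smoothing (b K th u : R) : 0 <= b -> cost_class b K f ->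
  (forall G : R -> R, (forall v, G v = cost f th (u + t * v)) -> intble (fun v => k v * G v)) /\
  cost g0 th u = \int[mu]_v (k v * cost f th (u + t * v)).
Proof.
move=> b0 fC; have [d [dd dB]] := cost_class_derive th fC.
case: fC => fU _ _.
have cf : continuous (cost f th).
  by move=> y; apply/differentiable_continuous/derivable1_diffP; have [] := dd y.
have ip (s : R) : intble (fun v => k v * cost f th (u + s * v)).
  apply: (@smoothing_intble _ K).
    apply: (measurableT_comp (continuous_measurable_fun cf)).
    by apply: measurable_funD => //; exact: measurable_funM.
  move=> v; apply: le_trans (fU _ _) _.
  have K0 : 0 <= K by have := le_trans (normr_ge0 _) (fU 0 0); rewrite pmulr_lge0// powR_gt0// ltr_pwDl.
  by rewrite ler_piMr// weight_le1.
split; first by move=> G GE; apply: eq_intble (ip t) => v; rewrite GE.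
have [_ _ ->] := cost_fubini_smoothing th u.
have half : (2^-1 : R) + 2^-1 = 1 by lra.
transitivity (\int[mu]_v (2^-1 * (k v * cost f th (u + t * v)) +
    2^-1 * (k v * cost f th (u + (- t) * v)))).
  apply: eq_Rintegral => v _.
  rewrite -mulrDr -mulrDr mulrCA /cost.
  have i1 := intble_cos th (u + t * v) fi.
  have i2 := intble_cos th (u + - t * v) fi.
  rewrite -(RintD i1 i2) -(RintZ _ (intbleD i1 i2)) -(RintZ _ (intbleZ _ (intbleD i1 i2))).
  apply: eq_Rintegral => x _.
  have -> : th + (u + t * v) * x = (th + u * x) + t * v * x by ring.
  have -> : th + (u + - t * v) * x = (th + u * x) - t * v * x by ring.
  by move: (th + u * x) => A; rewrite /= cosD cosB; field.
rewrite (RintD (intbleZ _ (ip t)) (intbleZ _ (ip (- t)))) (RintZ _ (ip t)) (RintZ _ (ip (- t))).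
have -> : \int[mu]_v (k v * cost f th (u + (- t) * v)) = \int[mu]_v (k v * cost f th (u + t * v)).
  rewrite -(Rintegral_opp (ip t)); apply: eq_Rintegral => v _.
  by rewrite ke mulrN mulNr.
by rewrite -mulrDl half mul1r.
Qed.

(** Moving u to u + t v changes the transform by at most t |v| times the derivative in between.
    [peetre] brings the weight back to u for a factor (1 + t |v|) ^ p, and the moment [I] of [k]
    pays for the average. For the derivative, where no increment supplies a factor t, [convex_pow]
    extracts one. *)
Lemma smoothing_deviation (b K : R) (p : nat) : 0 <= b -> 1 + b <= p%:R -> t <= 1 ->
  intble (fun v => k v * (1 + `|v|) ^+ p.+1) ->
  cost_class b K f ->
  let I := \int[mu]_v (k v * (1 + `|v|) ^+ p.+1) in
  (forall th u, `|cost g0 th u - cost f th u| <= K * t * I * (1 + `|u|) `^ (- (1 + b))) /\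
  (forall th u, exists2 d, is_derive u (1 : R) (cost g0 th) d &
    `|d| <= K * (1 + t * I) * (1 + `|u|) `^ (- (1 + b))).
Proof.
move=> b0 bp t1 kp fC I.
have K0 : 0 <= K.
  by have [fU _ _] := fC; have := le_trans (normr_ge0 _) (fU 0 0); rewrite pmulr_lge0// powR_gt0// ltr_pwDl.
have b1 : 0 <= 1 + b by lra.
have powp (v : R) : (1 + `|t * v|) `^ (1 + b) <= (1 + t * `|v|) ^+ p.
  rewrite normrM (gtr0_norm t0) -powR_mulrn; last by rewrite addr_ge0// mulr_ge0// ltW.
  by rewrite ler_powR// lerDl mulr_ge0// ltW.
have tv (v : R) : 0 <= t * `|v| by rewrite mulr_ge0// ltW.
split=> th u; have [d [dd dB]] := cost_class_derive th fC;
  have [ip E] := cost_smoothing th u b0 fC; set w := (1 + `|u|) `^ _;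
  have w0 : 0 <= w by exact: powR_ge0.
- have {}ip := ip _ (fun v => erefl).
  have -> : cost f th u = \int[mu]_v (cost f th u * k v) by rewrite (RintZ _ ki) k1 mulr1.
  rewrite E -(RintB ip (intbleZ _ ki)).
  have -> : K * t * I * w = \int[mu]_v (w * (K * t * (k v * (1 + `|v|) ^+ p.+1))).
    by rewrite (RintZ _ (intbleZ _ kp)) (RintZ _ kp) -/I; ring.
  apply: Rint_norm_le.
  + by apply: intbleB => //; exact: intbleZ.
  + by do 2! apply: intbleZ.
  move=> v; rewrite [cost f th u * _]mulrC -mulrBr normrM (ger0_norm (k0 v)).
  have h := @derive_bound _ (cost f th) d u (t * v) (K * (w * (1 + t * `|v|) ^+ p)) dd.
  have {}h : `|cost f th (u + t * v) - cost f th u| <= (K * (w * (1 + t * `|v|) ^+ p)) * `|t * v|.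
    apply: h => y yu; apply: le_trans (dB y) _; rewrite ler_wpM2l//.
    apply: le_trans (peetre y u b1) _; rewrite ler_wpM2l//.
    apply: le_trans (powp v); apply: ge0_ler_powR => //; rewrite ?nnegrE ?addr_ge0//.
    by rewrite lerD2l.
  apply: le_trans (ler_wpM2l (k0 v) h) _.
  have -> : w * (K * t * (k v * (1 + `|v|) ^+ p.+1)) =
      k v * ((K * (w * (1 + `|v|) ^+ p)) * (t * (1 + `|v|))) by rewrite exprS; ring.
  rewrite ler_wpM2l// ler_pM//.
  + by rewrite mulr_ge0// mulr_ge0// exprn_ge0// addr_ge0.
  + rewrite ler_wpM2l// ler_wpM2l//; apply: lerXn2r; rewrite ?nnegrE ?addr_ge0//.
    by rewrite lerD2l ler_piMl.
  + by rewrite normrM (gtr0_norm t0) ler_pM2l// lerDr.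
- have KwB y : `|d y| <= K by apply: le_trans (dB y) _; rewrite ler_piMr// weight_le1.
  have md := derive_measurable dd.
  have id' (y : R) : intble (fun v => k v * d (y + t * v)).
    apply: (@smoothing_intble _ K) => //.
    apply: (measurableT_comp md).
    by apply: measurable_funD => //; exact: measurable_funM.
  exists (\int[mu]_v (k v * d (u + t * v))).
    rewrite (_ : cost g0 th = fun u => \int[mu]_v (k v * cost f th (u + t * v))); last first.
      by apply/funext => y; have [_] := cost_smoothing th y b0 fC.
    apply: (@is_derive_Rintegral _ (fun u v => k v * cost f th (u + t * v))
      (fun u v => k v * d (u + t * v)) (fun v => K * k v)).
    + by move=> y; have [h _] := cost_smoothing th y b0 fC; exact: h.
    + exact: intbleZ.
    + move=> y v.
      have h : is_derive y (1 : R) (fun y : R => y + t * v) (1 + 0).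
        exact: (is_deriveD (is_derive_id _ _) (is_derive_cst _ _ _)).
      have h1 := @is_derive1_comp _ (cost f th) (fun y => y + t * v) y _ _ (dd (y + t * v)) h.
      have := is_deriveM (is_derive_cst (k v) y 1) h1.
      by move=> /is_derive_eq; apply; rewrite scaler0 addr0 addr0 mulr1.
    + by move=> y v; rewrite normrM (ger0_norm (k0 v)) mulrC ler_wpM2r.
  have iA : intble (fun v => k v + t * (k v * (1 + `|v|) ^+ p.+1)).
    by apply: intbleD => //; exact: intbleZ.
  have -> : K * (1 + t * I) * w = \int[mu]_v (K * w * (k v + t * (k v * (1 + `|v|) ^+ p.+1))).
    rewrite (RintZ _ iA) (RintD ki (intbleZ _ kp)) (RintZ _ kp) k1 -/I; ring.
  apply: Rint_norm_le; [exact: id'|exact: intbleZ|] => v.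
  rewrite normrM (ger0_norm (k0 v)).
  have : `|d (u + t * v)| <= K * (w * (1 + t * `|v|) ^+ p).
    apply: le_trans (dB _) _; rewrite ler_wpM2l//.
    apply: le_trans (peetre _ u b1) _; rewrite ler_wpM2l//.
    by have -> : u + t * v - u = t * v by ring.
  move=> /(ler_wpM2l (k0 v)) /le_trans; apply.
  have -> : K * w * (k v + t * (k v * (1 + `|v|) ^+ p.+1)) =
    k v * (K * (w * (1 + t * (1 + `|v|) ^+ p.+1))) by ring.
  rewrite ler_wpM2l// ler_wpM2l// ler_wpM2l//.
  have tt : 0 <= t <= 1 by rewrite (ltW t0).
  apply: le_trans (convex_pow p tt (normr_ge0 v)) _.
  have : t * (1 + `|v|) ^+ p <= t * (1 + `|v|) ^+ p.+1.
    by rewrite ler_pM2l// ler_weXn2l ?lerDl.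
  lra.
Qed.

End smoothing.

End truncation.

Section truncation_class.
Context (R : realType).
Local Notation mu := (@lebesgue_measure R).
Local Notation RB := (measurableTypeR R).

Lemma density_exists (g : R -> R) : measurable_fun setT (g : RB -> RB) ->
  (forall x, 0 <= g x) -> intble g -> \int[mu]_x g x = 1 ->
  exists f : density R, density_fun f = g.
Proof.
move=> mg g0 gi g1.
have g1' : (\int[mu]_x (g x)%:E = 1)%E by rewrite (EFin_Rintegral gi) g1.
by exists (Density mg g0 g1').
Qed.

(** The mass Z of the truncated density lies in [1 - e, 1 + e]. The conditions say that after
    division by Z the upper bound K + e, the lower bound K^-1 - e and the pointwise comparison with
    the original density fit the constant K'. *)
Lemma truncation_scale (K K' I : R) : 0 < K -> K < K' -> 0 <= I ->
  exists2 t : R, 0 < t <= 1 & let e := K * t * I in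
    [/\ e < 1, K + e <= K' * (1 - e), K'^-1 * (1 + e) <= K^-1 - e & K <= K' * (1 - e)].
Proof.
move=> K0 KK I0.
(* With this choice e (1 + K') (1 + K) = t A, and all conditions follow once this is at most K' -
   K. *)
pose A := K * I * (1 + K') * (1 + K).
have A0 : 0 <= A by rewrite !mulr_ge0//; lra.
pose t := Num.min 1 ((K' - K) / (A + 1)).
have q0 : 0 < (K' - K) / (A + 1) by rewrite divr_gt0//; lra.
have t0 : 0 < t by rewrite /t lt_min ltr01.
have t1 : t <= 1 by rewrite /t ge_min lexx.
have tA : t * (A + 1) <= K' - K by rewrite -ler_pdivlMr; [rewrite /t ge_min lexx orbT|lra].
exists t; first by rewrite t0.
move=> e.
have e0 : 0 <= e by rewrite !mulr_ge0//; lra.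
have eA : e * (1 + K') * (1 + K) <= K' - K.
  have -> : e * (1 + K') * (1 + K) = t * A by rewrite /e /A; ring.
  by apply: le_trans tA; rewrite ler_pM2l//; lra.
have eK : 0 <= e * K by rewrite mulr_ge0//; lra.
have eK' : 0 <= e * K' by rewrite mulr_ge0//; lra.
have eKK' : 0 <= e * K * K' by rewrite mulr_ge0//; lra.
have h1 : e + e * K' + e * K + e * K * K' <= K' - K by apply: le_trans eA; lra.
split.
- have K'0 : 0 < K' by lra.
  have : e * K' < 1 * K' by lra.
  by rewrite ltr_pM2r.
- lra.
- rewrite mulrC ler_pdivrMr; last lra.
  have -> : (K^-1 - e) * K' = (K' - e * K * K') / K by field; lra.
  rewrite ler_pdivlMr//; lra.
- lra.
Qed.

(** Multiplication by a dilated cutoff followed by normalisation. The pointwise comparison is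
    recorded because it carries moment bounds over. *)
Lemma cost_class_truncate (b K K' : R) (f : density R) : 0 <= b -> 0 < K -> K < K' ->
  cost_class b K f ->
  exists (g : density R) (L : R), [/\ 0 < L, supp L g, cost_class b K' g &
    forall x, g x <= K' / K * f x].
Proof.
move=> b0 K0 KK fC.
have [p bp] : exists p : nat, 1 + b <= p%:R.
  by exists (Num.bound (1 + b)); apply/ltW/archi_boundP; lra.
(* Decay of order p + 3 leaves quadratic decay in the moment of order p + 1. *)
have [k [C [B [[C0 B0 ki k0 ke] [kC chi0 chiB k1]]]]] := cutoff_exists R p.+3.
have fi := density_intble f.
pose I := \int[mu]_v (k v * (1 + `|v|) ^+ p.+1).
have kp : intble (fun v => k v * (1 + `|v|) ^+ p.+1).
  apply: (intble_le _ (intbleZ C (@intble_inv2 R))).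
    apply: measurable_funM; first exact: intble_measurable.
    have mv : measurable_fun setT (fun v : RB => 1 + `|v| : RB).
      by apply: measurable_funD => //; exact: measurableT_comp.
    exact: (measurable_funX _ mv).
  move=> v; rewrite ger0_norm; last by rewrite mulr_ge0// exprn_ge0// addr_ge0.
  have v1 : 0 < 1 + `|v| by rewrite ltr_pwDl.
  apply: le_trans (ler_wpM2r _ (kC v)) _; first by rewrite exprn_ge0// ltW.
  have -> : p.+3 = (p.+1 + 2)%N by rewrite addn2.
  have vn : 1 + `|v| != 0 by rewrite gt_eqF.
  rewrite exprD le_eqVlt; apply/orP; left; apply/eqP; rewrite invfM.
  by rewrite -mulrA mulrAC mulVf ?mul1r// expf_neq0.
have I0 : 0 <= I by apply: Rintegral_ge0 => v _; rewrite mulr_ge0// exprn_ge0// addr_ge0.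
have [t /andP[t0 t1] [e1 h1 h2 h3]] := truncation_scale K0 KK I0.
pose e := K * t * I; rewrite -/e in e1 h1 h2 h3.
have e0 : 0 <= e by rewrite !mulr_ge0// ltW.
have [dev dder] := smoothing_deviation k0 ke ki k1 t0 b0 bp t1 kp fC.
pose g0 x := cost k 0 (t * x) * f x.
have g0i : intble g0.
  have [h _ _] := cost_fubini_smoothing t f k0 ki 0 0.
  by apply: eq_intble h => x; rewrite mul0r addr0 cos0 mul1r.
have g00 x : 0 <= g0 x by rewrite mulr_ge0// density_ge0.
pose Z := \int[mu]_x g0 x.
have Z1 : `|Z - 1| <= e.
  have := dev 0 0; rewrite !cost_cost0 -/Z normr0 addr0 powR1 mulr1.
  have -> // : \int[mu]_x f x = 1.
  by rewrite /Rintegral density_int1.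
have [Zl Zu] : 1 - e <= Z /\ Z <= 1 + e.
  by move: Z1; rewrite ler_norml => /andP[? ?]; split; lra.
have Z0 : 0 < Z by lra.
have K'0 : 0 < K' by lra.
have [g gE] : exists g : density R, density_fun g = fun x => Z^-1 * g0 x.
  apply: density_exists.
  - by apply: measurable_funM => //; exact: intble_measurable.
  - by move=> x; rewrite mulr_ge0// invr_ge0 ltW.
  - exact: intbleZ.
  - by rewrite (RintZ _ g0i) mulVf// gt_eqF.
have cE th u : cost g th u = Z^-1 * cost g0 th u by rewrite gE (costZ _ _ _ g0i).
have w1w (u : R) : (1 + `|u|) `^ (- (1 + b)) <= (1 + `|u|) `^ (- b).
  by rewrite ler_powR ?lerDl//; lra.
have Zi : 0 < Z^-1 by rewrite invr_gt0.
exists g, (B / t); split.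
- by rewrite divr_gt0.
- move=> x Bx; rewrite gE /g0 chiB ?mul0r ?mulr0//.
  by rewrite normrM (gtr0_norm t0) mulrC -ltr_pdivrMr.
- split.
  + move=> th u; rewrite cE normrM gtr0_norm//.
    set w := (1 + `|u|) `^ _; have w0 : 0 <= w by exact: powR_ge0.
    have [fU _ _] := fC.
    have : `|cost g0 th u| <= (K + e) * w.
      have := ler_normD (cost g0 th u - cost f th u) (cost f th u); rewrite subrK.
      have h4 := fU th u; have h5 := dev th u; rewrite -/e in h5.
      have h6 := ler_wpM2l e0 (w1w u); rewrite -/w in h4 h6.
      move=> h7; rewrite mulrDl; lra.
    rewrite ler_pdivrMl// => /le_trans; apply.
    rewrite mulrA ler_wpM2r//; apply: le_trans h1 _.
    by rewrite mulrC ler_pM2r.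
  + move=> u; have [_ fL _] := fC; have [th hth] := fL u; exists th; rewrite cE.
    set w := (1 + `|u|) `^ _ in hth *; have w0 : 0 <= w by exact: powR_ge0.
    rewrite ler_pdivlMl//.
    have : cost f th u - e * w <= cost g0 th u.
      have := dev th u; rewrite -/e ler_norml => /andP[+ _].
      have := ler_wpM2l e0 (w1w u); rewrite -/w; lra.
    apply: le_trans; apply: (@le_trans _ _ ((K^-1 - e) * w)); last by rewrite mulrBl lerB.
    rewrite mulrA ler_wpM2r//; apply: le_trans h2.
    by rewrite mulrC ler_wpM2l// invr_ge0 ltW.
  + move=> th u; have [d dd dB] := dder th u.
    exists (Z^-1 * d).
      have -> : cost g th = fun v => Z^-1 * cost g0 th v by apply/funext => v; exact: cE.
      have := is_deriveM (is_derive_cst Z^-1 u 1) dd.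
      by move=> /is_derive_eq; apply; rewrite scaler0 addr0.
    rewrite normrM gtr0_norm// ler_pdivrMl//.
    have -> : - 1 - b = - (1 + b) by ring.
    apply: le_trans dB _; rewrite mulrA ler_wpM2r ?powR_ge0//.
    have -> : K * (1 + t * I) = K + e by rewrite /e; ring.
    by apply: le_trans h1 _; rewrite mulrC ler_pM2r.
- move=> x; rewrite gE /g0.
  have chi1 := le_trans (ler_norm _) (cutoff_le1 k0 ki k1 (t * x)).
  rewrite mulrA ler_wpM2r ?density_ge0// ler_pdivlMr//.
  have : cost k 0 (t * x) * K <= K by rewrite ler_piMl// ltW.
  move=> hh; rewrite -mulrA ler_pdivrMl//; apply: le_trans hh _; apply: le_trans h3 _.
  by rewrite mulrC ler_pM2r.
Qed.

End truncation_class.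

(** * Mixing an error density with a small smooth part *)

Section convolution.
Context (R : realType).
Local Notation mu := (@lebesgue_measure R).
Local Notation RB := (measurableTypeR R).
Implicit Types (m : R -> R) (f : density R).

Definition cv m (f : R -> R) : R -> R := fun x => \int[mu]_t (m (x - t) * f t).

Lemma density_Rint1 f : \int[mu]_x f x = 1.
Proof. by rewrite /Rintegral density_int1. Qed.

Lemma cv_intble B C m f (x : R) : bsupp B C m -> intble (fun t => m (x - t) * f t).
Proof.
move=> [_ mm mC _]; apply: (intbleM (density_intble f) _ (fun t => mC _)).
by apply: (measurableT_comp mm); exact: measurable_funB.
Qed.

Lemma cv_lip B L m f : 0 <= B -> lip L m -> supp B m -> lip L (cv m f).
Proof.
move=> B0 Lm sm x y; have bm := lip_bsupp B0 Lm sm.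
rewrite /cv -(RintB (cv_intble f x bm) (cv_intble f y bm)).
rewrite -[X in _ <= X]mulr1 -(density_Rint1 f) -(RintZ _ (density_intble f)).
apply: Rint_norm_le.
- by apply: intbleB; exact: cv_intble bm.
- by apply: intbleZ; exact: density_intble.
- move=> t; rewrite -mulrBl normrM (ger0_norm (density_ge0 f t)) ler_wpM2r ?density_ge0//.
  by have := Lm (x - t) (y - t); have -> : x - t - (y - t) = x - y by ring.
Qed.

Lemma cv_supp B L m f : supp B m -> supp L f -> supp (B + L) (cv m f).
Proof.
move=> sm sf x xBL; apply: Rintegral_0 => t.
have [tL|tL] := lerP `|t| L; last by rewrite sf ?mulr0.
rewrite sm ?mul0r//; have := ler_normD (x - t) t; rewrite subrK; lra.
Qed.

Lemma cv_ge0 m f : (forall x, 0 <= m x) -> forall x, 0 <= cv m f x.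
Proof. by move=> m0 x; apply: Rintegral_ge0 => t _; rewrite mulr_ge0 ?density_ge0. Qed.

(** Transforms of convolutions multiply; this is Re (z w) = Re z Re w - Im z Im w, where the phase
    th - pi / 2 gives Im z for the rotated transform of [f], and the phase pi / 2 gives - Im w for
    [m]. *)
Lemma cost_cv B C L m f (th u : R) : bsupp B C m -> supp L f ->
  cost (cv m f) th u =
  cost f th u * cost m 0 u + cost f (th - pi / 2) u * cost m (pi / 2) u.
Proof.
move=> bm sf; have mi := bsupp_intble bm; have fi := density_intble f.
have iv x := cv_intble f x bm.
case: bm => [B0 mm mC sB].
have C0 : 0 <= C by apply: le_trans (mC 0).
pose F (z : RB * RB) := cos (th + u * z.1) * (m (z.1 - z.2) * f z.2).
have m2 : measurable_fun setT (snd : RB * RB -> RB) by exact: measurable_snd.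
have m1 : measurable_fun setT (fst : RB * RB -> RB) by exact: measurable_fst.
have mF : measurable_fun setT F.
  apply: measurable_funM; first exact: (measurableT_comp (measurable_cos_affine th u)).
  apply: measurable_funM.
    by apply: (measurableT_comp mm); exact: measurable_funB.
  exact: (measurableT_comp (intble_measurable fi)).
pose D := `|B| + `|L|.
pose g x : R := C * \1_`[- D, D]%classic x.
have gi : intble g.
  apply: intbleZ; have mD : mu `[- D, D] = (2 * D)%:E.
    have D0 : 0 <= D by rewrite addr_ge0.
    rewrite lebesgue_measure_itv/= lte_fin; case: ifPn => [_|].
      by rewrite -EFinB; congr EFin; lra.
    by rewrite -leNgt => h; congr EFin; lra.
  have mI : measurable (`[- D, D]%classic : set RB) by [].
  by have [] := Rint_indic mI mD.
have Fb x y : `|F (x, y)| <= g x * f y.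
  rewrite /F /= normrM (le_trans (ler_piMl _ (cos_le1 _)))//.
  rewrite normrM (ger0_norm (density_ge0 _ _)).
  have [yL|yL] := lerP `|y| L; last by rewrite sf// !mulr0.
  rewrite ler_wpM2r ?density_ge0//.
  have [xD|xD] := lerP `|x| D.
    by rewrite /g indicE mem_set ?mulr1//= in_itv/= -ler_norml.
  rewrite sB ?normr0 ?mulr_ge0//.
  have := ler_normD (x - y) y; have := ler_norm B; have := ler_norm L.
  by rewrite subrK /D in xD *; lra.
have [_ _ E] := Rfubini mF gi fi Fb.
have -> : cost (cv m f) th u = \int[mu]_x \int[mu]_y F (x, y).
  by apply: eq_Rintegral => x _; rewrite /F /= (RintZ _ (iv x)).
rewrite E.
have shE t : cost (fun x => m (x - t)) th u = cost m (th + u * t) u.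
  by rewrite (cost_shift _ _ _ mi) mulrN opprK.
have -> : \int[mu]_y \int[mu]_x F (x, y) =
    \int[mu]_y (cost m 0 u * (cos (th + u * y) * f y) +
       cost m (pi / 2) u * (cos (th - pi / 2 + u * y) * f y)).
  apply: eq_Rintegral => y _; rewrite /F /=.
  transitivity (f y * cost m (th + u * y) u).
    rewrite -shE /cost -(RintZ _ (intble_cos th u (intble_shift (- y) mi))).
    by apply: eq_Rintegral => x _; ring.
  rewrite (costE _ _ mi).
  have -> : th - pi / 2 + u * y = th + u * y - pi / 2 by ring.
  by rewrite [cos (_ - pi / 2)]cosBpihalf; ring.
have i1 := intble_cos th u fi.
have i2 := intble_cos (th - pi / 2) u fi.
by rewrite (RintD (intbleZ _ i1) (intbleZ _ i2)) (RintZ _ i1) (RintZ _ i2) mulrC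
  [cost m (pi / 2) u * _]mulrC.
Qed.

End convolution.

Section mixture_class.
Context (R : realType).
Local Notation mu := (@lebesgue_measure R).
Local Notation RB := (measurableTypeR R).

(** [rho] is the smaller gap D divided by a sum S that dominates every coefficient, so each
    constraint consumes at most D; the summand 2 D of S makes rho < 1. *)
Lemma mixture_scale (K K' A : R) : 0 < K -> K < K' -> 0 <= A -> exists2 rho : R, 0 < rho &
  [/\ rho < 1, (1 + 4 * rho) * K <= K', K'^-1 <= K^-1 - rho * (K^-1 + 2 * K) &
    K + A * rho <= K'].
Proof.
move=> K0 KK A0.
have K'0 : 0 < K' by lra.
have Ki : 0 < K^-1 by rewrite invr_gt0.
have Kd : 0 < K^-1 - K'^-1 by rewrite subr_gt0 ltf_pV2 ?posrE.
pose D := Num.min (K' - K) (K^-1 - K'^-1).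
have D0 : 0 < D by rewrite lt_min Kd andbT; lra.
have D1 : D <= K' - K by rewrite ge_min lexx.
have D2 : D <= K^-1 - K'^-1 by rewrite ge_min lexx orbT.
pose S := 2 * D + 4 * K + (K^-1 + 2 * K) + A.
have S0 : 0 < S by rewrite /S; lra.
have q0 : 0 < D / S by rewrite divr_gt0.
have q : forall x, 0 <= x -> x <= S -> D / S * x <= D.
  by move=> x x0 xS; rewrite mulrAC ler_pdivrMr// ler_pM2l.
exists (D / S) => //; split.
- rewrite ltr_pdivrMr// mul1r /S; lra.
- have := q (4 * K); rewrite /S => h; have {}h : D / S * (4 * K) <= D by apply: h; lra.
  lra.
- have := q (K^-1 + 2 * K); rewrite /S => h.
  have {}h : D / S * (K^-1 + 2 * K) <= D by apply: h; lra.
  lra.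
- have := q A; rewrite /S => h.
  have {}h : D / S * A <= D by apply: h; lra.
  lra.
Qed.

(** The density of the convolution of [f] with mu_m. *)
Definition mix (m f : R -> R) x := (1 - \int[mu]_y m y) * f x + cv m f x.

Lemma powR_pred (b x : R) : 0 < x -> x `^ (- 1 - b) = x `^ (- b) / x.
Proof.
move=> x0; have -> : - 1 - b = - b + - 1 by ring.
rewrite powRD; last by rewrite [x == 0]gt_eqF ?implybT.
by rewrite [x `^ (-1)]powRN powRr1// ltW.
Qed.

(** The transform of f is multiplied by 1 - m^(0) + m^(u), a factor close to 1. In the derivative
    the product of f^ with the derivative of m^ must match the weight (1 + |u|) ^ (- 1 - b), which
    is why the transform of y m (y) is asked to decay like 1 / (1 + |u|). [rho] depends on [m] only
    through the radius of its support, so it can be fixed before the bump is scaled. *)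
Lemma error_class_mix (b gamma K K' B L : R) (f : density R) :
  0 < K -> K < K' -> 0 <= B -> 0 <= gamma -> 0 < L -> supp L f -> cost_class b K f ->
  (\int[mu]_x (`|x| `^ gamma * f x)%:E <= K%:E)%E ->
  exists2 rho : R, 0 < rho & forall m e, lip e m -> supp B m -> (forall x, 0 <= m x) ->
    (forall th u, `|cost m th u| <= rho / (1 + `|u|)) ->
    (forall th u, `|cost (fun y => y * m y) th u| <= rho / (1 + `|u|)) ->
    \int[mu]_y m y < 1 /\
    exists g : density R, density_fun g = mix m f /\ error_class b K' gamma g.
Proof.
move=> K0 KK B0 gam0 L0 sf fC fM.
have A0 : 0 <= (B + L) `^ gamma by exact: powR_ge0.
have [rho rho0 [r1 rU rL rM]] := mixture_scale K0 KK A0.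
exists rho => // m e lm sm m0 a1 a2.
have [mi _] := lip_supp_intble B0 lm sm.
have bm := lip_bsupp B0 lm sm.
have lxm := lip_mulx B0 lm sm.
have [xmi _] := lip_supp_intble B0 lxm (supp_mulx sm).
have fi := density_intble f.
pose ka := \int[mu]_y m y.
have ka0 : 0 <= ka by exact: Rintegral_ge0.
have ka1 : ka <= rho.
  have := a1 0 0; rewrite cost_cost0 normr0 addr0 divr1; exact: le_trans (ler_norm _).
have ka2 : ka < 1 by lra.
have kn : 0 <= 1 - \int[mu]_y m y by rewrite -/ka; lra.
have kn1 : 1 - \int[mu]_y m y <= 1 by rewrite -/ka; lra.
split=> //.
have cvL := cv_lip f B0 lm sm.
have cvs := cv_supp sm sf.
have BL0 : 0 <= B + L by lra.
have [cvi _] := lip_supp_intble BL0 cvL cvs.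
have cv0 := cv_ge0 f m0.
have cvE th u := cost_cv th u bm sf.
have mixi : intble (mix m f) by apply: intbleD => //; exact: intbleZ.
have cE th u : cost (mix m f) th u = (1 - ka) * cost f th u +
    (cost f th u * cost m 0 u + cost f (th - pi / 2) u * cost m (pi / 2) u).
  by rewrite /mix (costD _ _ (intbleZ _ fi) cvi) (costZ _ _ _ fi) cvE.
have cvI : \int[mu]_x cv m f x = ka.
  rewrite -cost_cost0 cvE !cost_cost0 density_Rint1 mul1r.
  rewrite [cost m (pi / 2) 0](_ : _ = 0) ?mulr0 ?addr0//; apply: Rintegral_0 => x.
  by rewrite mul0r addr0 cos_pihalf mul0r.
have [g gE] : exists g : density R, density_fun g = mix m f.
  apply: density_exists => //.
  - exact: intble_measurable.
  - by move=> x; rewrite addr_ge0// mulr_ge0 ?density_ge0.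
  - by rewrite /mix (RintD (intbleZ _ fi) cvi) (RintZ _ fi) cvI density_Rint1 -/ka; ring.
exists g; split=> //; apply/error_classE; rewrite gE; split; last first.
  have pm : measurable_fun setT (fun x : RB => `|x| `^ gamma : RB).
    by apply: (measurableT_comp (measurable_powR gamma)); apply: continuous_measurable_fun; exact: norm_continuous.
  under eq_integral do rewrite /mix mulrDr EFinD.
  rewrite ge0_integralD//=; last 4 first.
  - by move=> x _; rewrite lee_fin mulr_ge0 ?powR_ge0// mulr_ge0 ?density_ge0.
  - apply/measurable_EFinP; apply: measurable_funM => //; apply: measurable_funM => //.
    exact: density_measurable.
  - by move=> x _; rewrite lee_fin mulr_ge0 ?powR_ge0.
  - by apply/measurable_EFinP; apply: measurable_funM => //; exact: intble_measurable.
  (* The smooth part lives in [- (B + L), B + L], where |x| ^ gamma is at most (B + L) ^ gamma. *)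
  apply: (@le_trans _ _ (K%:E + ((B + L) `^ gamma * ka)%:E)%E).
    apply: leeD.
      apply: le_trans fM; apply: ge0_le_integral => //.
      - by move=> x _; rewrite lee_fin mulr_ge0 ?powR_ge0// mulr_ge0 ?density_ge0.
      - apply/measurable_EFinP; apply: measurable_funM => //; apply: measurable_funM => //.
        exact: density_measurable.
      - by apply/measurable_EFinP; apply: measurable_funM => //; exact: density_measurable.
      - by move=> x _; rewrite lee_fin ler_wpM2l ?powR_ge0// ler_piMl ?density_ge0.
    have -> : ((B + L) `^ gamma * ka)%:E = (\int[mu]_x ((B + L) `^ gamma * cv m f x)%:E)%E.
      by rewrite (EFin_Rintegral (intbleZ _ cvi)) (RintZ _ cvi) cvI.
    apply: ge0_le_integral => //.
    - by move=> x _; rewrite lee_fin mulr_ge0 ?powR_ge0.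
    - by apply/measurable_EFinP; apply: measurable_funM => //; exact: intble_measurable.
    - by apply/measurable_EFinP; apply: measurable_funM => //; exact: intble_measurable.
    - move=> x _; rewrite lee_fin.
      have [xB|xB] := lerP `|x| (B + L); last by rewrite cvs// !mulr0.
      by rewrite ler_wpM2r// ge0_ler_powR ?nnegrE.
  rewrite -EFinD lee_fin; apply: le_trans rM; rewrite lerD2l ler_wpM2l//.
have u1 (u : R) : 0 < 1 + `|u| by rewrite ltr_pwDl.
have rhou (u : R) : rho / (1 + `|u|) <= rho.
  by rewrite ler_pdivrMr// ler_peMr ?lerDl// ltW.
have pert (th u : R) : `|cost f th u * cost m 0 u + cost f (th - pi / 2) u * cost m (pi / 2) u|
    <= 2 * rho * K * (1 + `|u|) `^ (- b).
  have [fU _ _] := fC.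
  have h1 := ler_pM (normr_ge0 _) (normr_ge0 _) (fU th u) (le_trans (a1 0 u) (rhou u)).
  have h2 := ler_pM (normr_ge0 _) (normr_ge0 _) (fU (th - pi / 2) u) (le_trans (a1 (pi / 2) u) (rhou u)).
  by apply: le_trans (ler_normD _ _) _; rewrite !normrM; lra.
split.
- move=> th u; rewrite cE; have [fU _ _] := fC.
  set w := (1 + `|u|) `^ _; have w0 : 0 <= w by exact: powR_ge0.
  apply: le_trans (ler_normD _ _) _.
  have h1 := pert th u; rewrite -/w in h1.
  have h2 : `|(1 - ka) * cost f th u| <= K * w.
    by rewrite normrM ger0_norm; [apply: le_trans (fU th u); rewrite ler_piMl//; lra|lra].
  have := ler_wpM2r w0 rU; have : 0 <= rho * K * w by rewrite !mulr_ge0// ltW.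
  lra.
- move=> u; have [_ fL _] := fC; have [th hth] := fL u; exists th; rewrite cE.
  set w := (1 + `|u|) `^ _ in hth *; have w0 : 0 <= w by exact: powR_ge0.
  have := pert th u; rewrite -/w ler_norml => /andP[h1 _].
  have h2 : (1 - ka) * (K^-1 * w) <= (1 - ka) * cost f th u by rewrite ler_wpM2l//; lra.
  have h3 := ler_wpM2r w0 rL.
  have h4 : ka * (K^-1 * w) <= rho * (K^-1 * w).
    by rewrite ler_wpM2r// mulr_ge0// invr_ge0 ltW.
  lra.
- move=> th u.
  have [fU _ fD] := fC.
  have [d1 D1 B1] := fD th u; have [d2 D2 B2] := fD (th - pi / 2) u.
  have E1 := is_derive_cost 0 u mi xmi.
  have E2 := is_derive_cost (pi / 2) u mi xmi.
  have P1 := is_deriveM (is_derive_cst (1 - ka) u 1) D1.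
  have P2 := is_deriveM D1 E1.
  have P3 := is_deriveM D2 E2.
  have P := is_deriveD P1 (is_deriveD P2 P3).
  rewrite (_ : cost (mix m f) th = fun u => (1 - ka) * cost f th u +
    (cost f th u * cost m 0 u + cost f (th - pi / 2) u * cost m (pi / 2) u)); last first.
    by apply/funext => v; exact: cE.
  eexists; first exact: P.
  rewrite scaler0 addr0 /GRing.scale/=.
  rewrite powR_pred// in B1 B2 *.
  set w := (1 + `|u|) `^ _ in B1 B2 *; have w0 : 0 <= w by exact: powR_ge0.
  set v := w / (1 + `|u|); rewrite -/v in B1 B2.
  have v0 : 0 <= v by rewrite divr_ge0// ltW.
  have h0 : `|(1 - ka) * d1| <= K * v.
    by rewrite normrM ger0_norm; [apply: le_trans B1; rewrite ler_piMl//; lra|lra].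
  have k1 th' th'' : `|cost f th' u * cost (fun x => x * m x) th'' u| <= rho * K * v.
    rewrite normrM; have := ler_pM (normr_ge0 _) (normr_ge0 _) (fU th' u) (a2 th'' u).
    move=> /le_trans; apply; rewrite -/w /v; rewrite le_eqVlt; apply/orP; left; apply/eqP.
    by ring.
  have k2 d th' : `|d| <= K * v -> `|cost m th' u * d| <= rho * K * v.
    move=> hd; rewrite normrM.
    have := ler_pM (normr_ge0 _) (normr_ge0 _) (le_trans (a1 th' u) (rhou u)) hd.
    by rewrite mulrA.
  have b1 := k1 th (0 + pi / 2); have b2 := k1 (th - pi / 2) (pi / 2 + pi / 2).
  have b3 := k2 d1 0 B1; have b4 := k2 d2 (pi / 2) B2.
  have rUv := ler_wpM2r v0 rU.
  apply: le_trans (ler_normD _ _) _.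
  apply: le_trans (lerD (lexx _) (le_trans (ler_normD _ _) (lerD (ler_normD _ _) (ler_normD _ _)))) _.
  lra.
Qed.

End mixture_class.

(** * Energy of a perturbation *)

Section energy.
Context (R : realType).
Local Notation mu := (@lebesgue_measure R).
Local Notation RB := (measurableTypeR R).
Implicit Types (h k : R -> R) (f : density R).

Lemma cost_le1 f (th u : R) : `|cost f th u| <= 1.
Proof.
apply: le_trans (cost_le _ _ (density_intble f)) _.
rewrite -(density_Rint1 f) le_eqVlt; apply/orP; left; apply/eqP.
by apply: eq_Rintegral => x _; rewrite ger0_norm// density_ge0.
Qed.

(** Inversion of [h] represents h * f as an integral of [k] against phases of the transform of f;
    multiplying by h * f and exchanging the integrals gives its energy. The two squared cosine
    transforms add up to the squared modulus of the Fourier transform of f. *)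
Lemma cv_plancherel (c B L M : R) h k f : 0 <= B -> lip M h -> supp B h -> supp L f -> intble k ->
  (forall th v, cost h th v = cos th * k v) ->
  (forall th x, cost k th x = c * (cos th * h x)) ->
  intble (fun v => k v ^+ 2 * (cost f 0 v ^+ 2 + cost f (pi / 2) v ^+ 2)) /\
  c * \int[mu]_x (cv h f x) ^+ 2 =
    \int[mu]_v (k v ^+ 2 * (cost f 0 v ^+ 2 + cost f (pi / 2) v ^+ 2)).
Proof.
move=> B0 Mh sh sf ki hk kh.
have bh := lip_bsupp B0 Mh sh.
have fi := density_intble f.
pose g := cv h f.
have gM := cv_lip f B0 Mh sh; have gs := cv_supp sh sf.
(* Otherwise [f] would vanish everywhere, against its total mass 1. *)
have L0 : 0 <= L.
  rewrite leNgt; apply/negP => Ln.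
  have := density_Rint1 f; rewrite Rintegral_0 => [/esym/eqP|x]; first by rewrite oner_eq0.
  by apply: sf; apply: lt_le_trans Ln _.
have BL0 : 0 <= B + L by lra.
have [gi _] := lip_supp_intble BL0 gM gs.
have gC := lip_supp_le BL0 gM gs.
have mc : measurable_fun setT (@cos R : RB -> RB).
  by apply: continuous_measurable_fun; exact: continuous_cos.
have m2 : measurable_fun setT (snd : RB * RB -> RB) by exact: measurable_snd.
have m1 : measurable_fun setT (fst : RB * RB -> RB) by exact: measurable_fst.
have gE x : c * g x = \int[mu]_v (k v * cost f (- (v * x)) v).
  pose F (z : RB * RB) := cos (z.2 * (z.1 - x)) * (f z.1 * k z.2).
  have mF : measurable_fun setT F.
    apply: measurable_funM.
      by apply: (measurableT_comp mc); apply: measurable_funM => //; exact: measurable_funB.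
    apply: measurable_funM; first exact: (measurableT_comp (intble_measurable fi)).
    exact: (measurableT_comp (intble_measurable ki)).
  have Fb y z : `|F (y, z)| <= f y * `|k z|.
    rewrite /F /= normrM (le_trans (ler_piMl _ (cos_le1 _)))//.
    by rewrite normrM (ger0_norm (density_ge0 _ _)).
  have [_ _ E] := Rfubini mF fi (intble_norm ki) Fb.
  rewrite /g /cv -(RintZ _ (cv_intble f x bh)).
  transitivity (\int[mu]_t \int[mu]_v F (t, v)).
    apply: eq_Rintegral => t _; rewrite mulrA.
    have := kh 0 (x - t); rewrite cos0 mul1r => <-.
    rewrite mulrC /cost -(RintZ _ (intble_cos 0 (x - t) ki)).
    apply: eq_Rintegral => v _; rewrite /F /= add0r.
    have -> : v * (t - x) = - ((x - t) * v) by ring.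
    by rewrite cosN; ring.
  rewrite E; apply: eq_Rintegral => v _.
  rewrite /F /= /cost -(RintZ _ (intble_cos (- (v * x)) v fi)).
  apply: eq_Rintegral => t _.
  have -> : - (v * x) + v * t = v * (t - x) by ring.
  by ring.
have cA th : measurable_fun setT (cost f th : RB -> RB).
  apply: continuous_measurable_fun; apply: cost_continuous => //.
  apply: (@intble_le _ _ (fun x => L * f x)).
  - by apply: measurable_funM => //; exact: intble_measurable.
  - exact: intbleZ.
  - move=> x; rewrite normrM (ger0_norm (density_ge0 _ _)).
    have [xL|xL] := lerP `|x| L; first by rewrite ler_wpM2r ?density_ge0.
    by rewrite sf// !mulr0.
pose F (z : RB * RB) := g z.1 * (k z.2 * cost f (- (z.2 * z.1)) z.2).
have F' z : F z = g z.1 * (k z.2 * (cos (z.2 * z.1) * cost f 0 z.2 -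
     sin (z.2 * z.1) * cost f (pi / 2) z.2)).
  by rewrite /F (costE _ _ fi) cosN sinN mulNr.
have ms : measurable_fun setT (@sin R : RB -> RB).
  by apply: continuous_measurable_fun; exact: continuous_sin.
have mF : measurable_fun setT F.
  rewrite (_ : F = fun z => g z.1 * (k z.2 * (cos (z.2 * z.1) * cost f 0 z.2 -
     sin (z.2 * z.1) * cost f (pi / 2) z.2))); last exact/funext.
  apply: measurable_funM; first exact: (measurableT_comp (intble_measurable gi)).
  apply: measurable_funM; first exact: (measurableT_comp (intble_measurable ki)).
  apply: measurable_funB; apply: measurable_funM.
  - by apply: (measurableT_comp mc); exact: measurable_funM.
  - exact: (measurableT_comp (cA 0)).
  - by apply: (measurableT_comp ms); exact: measurable_funM.
  - exact: (measurableT_comp (cA (pi / 2))).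
have Fb x v : `|F (x, v)| <= `|g x| * `|k v|.
  by rewrite /F /= !normrM ler_wpM2l// ler_piMr// cost_le1.
have [_ i2 E] := Rfubini mF (intble_norm gi) (intble_norm ki) Fb.
have gc th v : cost g th v = cost f th v * k v.
  rewrite (cost_cv _ _ bh sf) !hk cos0 cos_pihalf mul1r mul0r mulr0 addr0//.
have E2 v : \int[mu]_x F (x, v) = k v ^+ 2 * (cost f 0 v ^+ 2 + cost f (pi / 2) v ^+ 2).
  transitivity (\int[mu]_x ((k v * cost f 0 v) * (cos (0 + v * x) * g x) +
      (k v * cost f (pi / 2) v) * (cos (pi / 2 + v * x) * g x))).
    apply: eq_Rintegral => x _; rewrite F' /= add0r.
    by rewrite [cos (pi / 2 + _)]cosD cos_pihalf sin_pihalf; ring.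
  have j1 := intble_cos 0 v gi; have j2 := intble_cos (pi / 2) v gi.
  rewrite (RintD (intbleZ _ j1) (intbleZ _ j2)) (RintZ _ j1) (RintZ _ j2) -/(cost g 0 v)
    -/(cost g (pi / 2) v) !gc.
  by ring.
split; first exact: eq_intble E2 i2.
have <- : \int[mu]_v \int[mu]_x F (x, v) =
    \int[mu]_v (k v ^+ 2 * (cost f 0 v ^+ 2 + cost f (pi / 2) v ^+ 2)).
  by apply: eq_Rintegral => v _; exact: E2.
rewrite -E.
have ig2 : intble (fun x => cv h f x ^+ 2).
  apply: (@eq_intble _ (fun x => g x * g x)) => [x|]; first by rewrite -expr2.
  apply: (intbleM gi (intble_measurable gi)); exact: gC.
rewrite -(RintZ _ ig2); apply: eq_Rintegral => x _.
rewrite -/(g x) expr2 mulrCA gE /F /=.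
have ik : intble (fun v => k v * cost f (- (v * x)) v).
  apply: (@intble_le _ _ (fun v => `|k v|)).
  - apply: (@eq_measurable_fun _ _ _ _ _ (fun v : RB => k v * (cos (v * x) * cost f 0 v -
        sin (v * x) * cost f (pi / 2) v))).
      by move=> v _; rewrite [cost f (- _) _](costE _ _ fi) cosN sinN mulNr.
    apply: measurable_funM; first exact: intble_measurable.
    apply: measurable_funB; apply: measurable_funM.
    + by apply: (measurableT_comp mc); exact: measurable_funM.
    + exact: (cA 0).
    + by apply: (measurableT_comp ms); exact: measurable_funM.
    + exact: (cA (pi / 2)).
  - exact: intble_norm.
  - move=> v; rewrite normrM; apply: ler_piMr; [exact: normr_ge0|exact: cost_le1].
rewrite -(RintZ _ ik); exact: erefl.
Qed.

Lemma sin_le_abs (w : R) : `|sin w| <= `|w|.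
Proof.
have := @derive_bound _ (@sin R) (@cos R) 0 w 1 (fun y => is_derive_sin y) (fun y _ => cos_le1 y).
by rewrite add0r sin0 subr0 mul1r.
Qed.

(** Here the zero of order 2 N at the origin is spent: |sin w| ^ (2 N) <= |w| ^ b because b <= 2 N,
    and (1 + |u|) ^ (- b) <= |u| ^ (- b). With w = s u the powers of |u| cancel and s ^ b remains,
    uniformly in [u]. *)
Lemma sin_weight (N : nat) (b s u : R) : (0 < N)%N -> 0 <= b <= N.*2%:R -> 0 < s <= 1 ->
  sin (s * u) ^+ N.*2 * (1 + `|u|) `^ (- b) <= s `^ b.
Proof.
move=> N0 /andP[b0 bN] /andP[s0 s1].
have [->|u0] := eqVneq u 0.
  rewrite mulr0 sin0 expr0n (_ : (N.*2 == 0)%N = false) ?mul0r ?powR_ge0//; lia.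
have au : 0 < `|u| by rewrite normr_gt0.
have aw : 0 < `|s * u| by rewrite normr_gt0 mulf_neq0// gt_eqF.
have h1 : (1 + `|u|) `^ (- b) <= `|u| `^ (- b).
  have a1 : 0 < 1 + `|u| by lra.
  rewrite !powRN lef_pV2; [|by rewrite posrE powR_gt0..].
  by rewrite ge0_ler_powR ?nnegrE ?addr_ge0// lerDr.
have E : `|s * u| `^ b * `|u| `^ (- b) = s `^ b.
  rewrite normrM (gtr0_norm s0) powRM ?ltW// powRN mulfK// gt_eqF// powR_gt0//.
have S0 : 0 <= sin (s * u) ^+ N.*2 by rewrite -mul2n exprM exprn_ge0// sqr_ge0.
have S1 : sin (s * u) ^+ N.*2 <= `|s * u| `^ b.
  have -> : sin (s * u) ^+ N.*2 = `|sin (s * u)| ^+ N.*2.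
    by rewrite -mul2n !exprM real_normK// num_real.
  have [w1|w1] := lerP 1 `|s * u|.
    apply: (@le_trans _ _ 1).
      by rewrite exprn_ile1// ler_norml sin_geN1 sin_le1.
    by rewrite -[X in X <= _](powRr0 `|s * u|) ler_powR.
  apply: (@le_trans _ _ (`|s * u| ^+ N.*2)).
    by apply: lerXn2r; rewrite ?nnegrE// sin_le_abs.
  rewrite -powR_mulrn//.
  by rewrite ger_powR// aw ltW.
rewrite -E; apply: ler_pM => //; exact: powR_ge0.
Qed.

(** Centred at 0, the rescaled bump has transform eta k (s v) up to the phase. By [sin_weight] its
    product with the transform of f is of order eta s ^ b / (1 + |s v|) ^ 2; squaring gives s ^ (2
    b), and integrating in v costs a factor 1 / s. The centre D only translates the convolution. *)
Lemma energy_bound (b K c B L M : R) (N : nat) (h k : R -> R) : (0 < N)%N -> 0 <= b <= N.*2%:R ->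
  0 < c -> 0 <= B -> lip M h -> supp B h -> intble k ->
  (forall th v, cost h th v = cos th * k v) ->
  (forall th x, cost k th x = c * (cos th * h x)) ->
  (forall v, `|k v| <= sin v ^+ N.*2 * (4 / (1 + `|v|) ^+ 2)) ->
  exists2 C : R, 0 < C & forall f, cost_class b K f -> supp L f ->
    forall eta s D : R, 0 < s <= 1 ->
    \int[mu]_x (cv (fun y => eta / s * h ((y - D) / s)) f x) ^+ 2 <= C * eta ^+ 2 * s `^ (2 * b - 1).
Proof.
move=> N0 bN c0 B0 Mh sh ki hk kh kb.
have b0 : 0 <= b by case/andP: bN.
pose I2 := \int[mu]_v ((1 + `|v| : R) ^+ 2)^-1.
have I20 : 0 <= I2 by apply: Rintegral_ge0 => v _; rewrite invr_ge0 sqr_ge0.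
(* 32 is the square of the 4 in the bound on [k], times 2 for the two phases; [c] is the inversion
   constant. *)
pose C := 32 * K ^+ 2 * I2 / c.
have C0 : 0 <= C.
  by apply: divr_ge0; [|exact: ltW]; apply: mulr_ge0 => //; apply: mulr_ge0 => //; exact: sqr_ge0.
exists (C + 1); first lra.
move=> f fC sf eta s D /andP[s0 s1].
have sn : s^-1 != 0 by rewrite invr_neq0// gt_eqF.
have si0 : 0 < s^-1 by rewrite invr_gt0.
pose h0 y := eta / s * h (s^-1 * y + 0).
pose k0 v := eta * k (s * v + 0).
have hi := (lip_supp_intble B0 Mh sh).1.
have sn' : s != 0 by rewrite gt_eqF.
have [hsi _] := Rintegral_affine 0 sn hi.
have [ksi _] := Rintegral_affine 0 sn' ki.
have h0k th v : cost h0 th v = cos th * k0 v.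
  rewrite /h0 (costZ _ _ _ hsi).
  have -> : cost (fun y => h (s^-1 * y + 0)) th v = s * cost h th (s * v).
    have [_] := Rintegral_affine 0 sn (intble_cos th (s * v) hi).
    rewrite [cost h _ _]/cost => ->; rewrite gtr0_norm// mulrA mulfV// mul1r.
    by apply: eq_Rintegral => x _; congr (cos _ * _); field.
  by rewrite hk /k0 addr0; field.
have k0h th x : cost k0 th x = c * (cos th * h0 x).
  rewrite /k0 (costZ _ _ _ ksi).
  have -> : cost (fun y => k (s * y + 0)) th x = s^-1 * cost k th (s^-1 * x).
    have [_] := Rintegral_affine 0 sn' (intble_cos th (s^-1 * x) ki).
    rewrite [cost k _ _]/cost => ->; rewrite gtr0_norm// mulrA mulVf// mul1r.
    by apply: eq_Rintegral => y _; congr (cos _ * _); field.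
  by rewrite kh /h0 addr0; field.
have M0 : 0 <= M by have := Mh 1 0; rewrite subr0 normr1 mulr1; exact: le_trans.
have Mh0 : lip (`|eta / s| * (M / s)) h0.
  move=> x y; rewrite /h0 -mulrBr normrM -mulrA ler_wpM2l// !addr0.
  apply: le_trans (Mh _ _) _; rewrite -mulrBr normrM gtr0_norm//; lra.
have sh0 : supp (B * s) h0.
  move=> x Bx; rewrite /h0 sh ?mulr0// addr0 normrM gtr0_norm//.
  by rewrite mulrC ltr_pdivlMr.
have Bs0 : 0 <= B * s by rewrite mulr_ge0// ltW.
have k0i : intble k0 by exact: intbleZ.
have [iP P] := cv_plancherel Bs0 Mh0 sh0 sf k0i h0k k0h.
have cvE x : cv (fun y => eta / s * h ((y - D) / s)) f (x + D) = cv h0 f x.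
  apply: eq_Rintegral => t _; rewrite /h0; congr (_ * h _ * _); rewrite addr0 mulrC; congr (_ * _).
  by ring.
have ig2 : intble (fun x => cv h0 f x ^+ 2).
  have bh0 := lip_bsupp Bs0 Mh0 sh0.
  have gM := cv_lip f Bs0 Mh0 sh0; have gs := cv_supp sh0 sf.
  have gs' : supp `|B * s + L| (cv h0 f).
    by move=> x Bx; apply: gs; apply: le_lt_trans Bx; exact: ler_norm.
  have [gi _] := lip_supp_intble (normr_ge0 _) gM gs'.
  apply: (@eq_intble _ (fun x => cv h0 f x * cv h0 f x)) => [x|]; first by rewrite -expr2.
  apply: (intbleM gi (intble_measurable gi)); exact: (lip_supp_le (normr_ge0 _) gM gs').
have -> : \int[mu]_x (cv (fun y => eta / s * h ((y - D) / s)) f x) ^+ 2 =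
    \int[mu]_x (cv h0 f x) ^+ 2.
  rewrite -[LHS](Rintegral_shift D); last first.
    have := intble_shift (- D) ig2; apply: eq_intble => x.
    by rewrite -cvE subrK.
  by apply: eq_Rintegral => x _; rewrite cvE.
have [ii iE] := Rintegral_affine 0 sn' (@intble_inv2 R).
have sb : 0 <= s `^ b by exact: powR_ge0.
have step : c * \int[mu]_x (cv h0 f x) ^+ 2 <= 32 * K ^+ 2 * eta ^+ 2 * (s `^ b) ^+ 2 * (s^-1 * I2).
  rewrite P; have -> : s^-1 * I2 = \int[mu]_v ((1 + `|s * v + 0|) ^+ 2)^-1.
    by rewrite /I2 iE gtr0_norm// mulrA mulVf// mul1r.
  rewrite -(RintZ _ ii); apply: Rint_le => //; first exact: intbleZ.
  move=> v; rewrite /k0 addr0.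
  have [fU _ _] := fC.
  set w := (1 + `|v|) `^ (- b) in fU *.
  have w0 : 0 <= (1 + `|v|) `^ (- b) by exact: powR_ge0.
  have sq (x y : R) : `|x| <= y -> x ^+ 2 <= y ^+ 2.
    by move=> xy; rewrite -(real_normK (num_real x)); apply: lerXn2r; rewrite ?nnegrE ?(le_trans _ xy).
  have A2 := sq _ _ (fU 0 v); have B2 := sq _ _ (fU (pi / 2) v).
  set a := cost f 0 v in A2 *; set a' := cost f (pi / 2) v in B2 *.
  have q0 : 0 <= 4 / (1 + `|s * v|) ^+ 2 by rewrite divr_ge0 ?sqr_ge0.
  have kw : `|k (s * v) * (1 + `|v|) `^ (- b)| <= s `^ b * (4 / (1 + `|s * v|) ^+ 2).
    rewrite normrM (ger0_norm w0).
    apply: le_trans (ler_wpM2r w0 (kb _)) _; rewrite mulrAC ler_wpM2r//.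
    by apply: sin_weight; rewrite ?s0.
  have KW := sq _ _ kw.
  apply: (@le_trans _ _ ((eta * k (s * v)) ^+ 2 * (2 * (K * (1 + `|v|) `^ (- b)) ^+ 2))).
    by rewrite ler_wpM2l ?sqr_ge0//; lra.
  have -> : (eta * k (s * v)) ^+ 2 * (2 * (K * (1 + `|v|) `^ (- b)) ^+ 2) =
    2 * eta ^+ 2 * K ^+ 2 * (k (s * v) * (1 + `|v|) `^ (- b)) ^+ 2 by ring.
  have E0 : 0 <= 2 * eta ^+ 2 * K ^+ 2 by apply: mulr_ge0; [apply: mulr_ge0 => //|]; exact: sqr_ge0.
  apply: le_trans (ler_wpM2l E0 KW) _.
  have z1 : 1 <= (1 + `|s * v|) ^+ 2 by rewrite exprn_ege1// lerDl.
  set z := (1 + `|s * v|) ^+ 2 in z1 *.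
  have -> : 2 * eta ^+ 2 * K ^+ 2 * (s `^ b * (4 / z)) ^+ 2 =
     (32 * K ^+ 2 * eta ^+ 2 * (s `^ b) ^+ 2) * (z^-1 * z^-1) by field; lra.
  apply: ler_wpM2l.
    apply: mulr_ge0; last exact: sqr_ge0.
    by apply: mulr_ge0; [apply: mulr_ge0 => //|]; exact: sqr_ge0.
  have z0 : 0 < z := lt_le_trans ltr01 z1.
  by apply: ler_piMl; [rewrite invr_ge0 ltW|rewrite invf_le1].
have sE : (s `^ b) ^+ 2 * s^-1 = s `^ (2 * b - 1).
  rewrite powRD; last by rewrite [s == 0]gt_eqF ?implybT.
  rewrite [s `^ (-1)]powRN powRr1 ?ltW//; congr (_ * _).
  by rewrite -powR_mulrn// -powRrM mulrC.
have st : \int[mu]_x (cv h0 f x) ^+ 2 <= C * eta ^+ 2 * s `^ (2 * b - 1).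
  rewrite -sE /C -(ler_pM2l c0); apply: le_trans step _.
  by rewrite le_eqVlt; apply/orP; left; apply/eqP; field; apply/andP; split; rewrite gt_eqF.
apply: le_trans st _; rewrite ler_wpM2r ?powR_ge0// ler_wpM2r ?sqr_ge0//; lra.
Qed.

End energy.

(** * Chi-square comparison of experiments *)

Section chi_square_bound.
Context (R : realType).
Local Open Scope ereal_scope.

(* The functional form of 1 + chi^2 (Q o g^-1 | P o g^-1) <= c *)
Definition chi2_map d d' (T : measurableType d) (T' : measurableType d') (g : T -> T')
    (c : R) (P Q : probability T R) := forall phi : T' -> \bar R,
  measurable_fun setT phi -> (forall x, 0 <= phi x) ->
  (\int[Q]_x phi (g x)) * (\int[Q]_x phi (g x)) <=
    c%:E * \int[P]_x (phi (g x) * phi (g x)).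

Lemma measurable_sqre d (T : measurableType d) (phi : T -> \bar R) :
  measurable_fun setT phi -> measurable_fun setT (fun x => phi x * phi x).
Proof. by move=> mphi; exact: emeasurable_funM. Qed.

Section tensor.
Context d1 d2 d1' d2' (T1 : measurableType d1) (T2 : measurableType d2)
  (T1' : measurableType d1') (T2' : measurableType d2').
Variables (g1 : T1 -> T1') (g2 : T2 -> T2').
Hypotheses (mg1 : measurable_fun setT g1) (mg2 : measurable_fun setT g2).

(** Integrate out the second coordinate, apply the first bound to the resulting function of the
    first coordinate, then the second bound inside each section. *)
Lemma chi2_map_prod (c1 c2 : R) (P1 Q1 : probability T1 R) (P2 Q2 : probability T2 R) :
  (0 <= c1)%R -> (0 <= c2)%R -> chi2_map g1 c1 P1 Q1 -> chi2_map g2 c2 P2 Q2 ->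
  chi2_map (fun z => (g1 z.1, g2 z.2)) (c1 * c2) (P1 \x P2) (Q1 \x Q2).
Proof.
move=> c10 c20 h1 h2 phi mphi phi0.
have mG : measurable_fun setT (fun z : T1 * T2 => (g1 z.1, g2 z.2)).
  apply/measurable_fun_pairP; split => /=.
    exact: (measurableT_comp mg1 measurable_fst).
  exact: (measurableT_comp mg2 measurable_snd).
have mphiG := measurableT_comp mphi mG.
have mH : measurable_fun setT (fun z : T1' * T2 => (z.1, g2 z.2)).
  apply/measurable_fun_pairP; split => /=; first exact: measurable_fst.
  exact: (measurableT_comp mg2 measurable_snd).
have mphiH := measurableT_comp mphi mH.
rewrite (fubini_tonelli1 _ mphiG); last by move=> z; exact: phi0.
pose sq z := phi (g1 z.1, g2 z.2) * phi (g1 z.1, g2 z.2).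
have msq : measurable_fun setT sq by exact: (measurable_sqre mphiG).
rewrite [X in _ <= _ * X](_ : _ = \int[P1]_x \int[P2]_y sq (x, y)); last first.
  by apply: (fubini_tonelli1 sq msq) => z; exact: mule_ge0.
pose Phi a := \int[Q2]_y phi (a, g2 y).
have mPhi : measurable_fun setT Phi.
  apply: (@measurable_fun_fubini_tonelli_F _ _ T1' T2 R Q2
    (phi \o (fun z : T1' * T2 => (z.1, g2 z.2)))); first exact: mphiH.
  by move=> z; exact: phi0.
have Phi0 a : 0 <= Phi a by exact: integral_ge0.
apply: le_trans (h1 Phi mPhi Phi0) _.
rewrite EFinM -muleA; apply: lee_wpmul2l; first by rewrite lee_fin.
have mPsi : measurable_fun setT (fubini_F P2 (fun z => (phi \o (fun z : T1' * T2 => (z.1, g2 z.2))) z *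
    (phi \o (fun z : T1' * T2 => (z.1, g2 z.2))) z)).
  apply: measurable_fun_fubini_tonelli_F; first exact: measurable_sqre.
  by move=> z /=; apply: mule_ge0; exact: phi0.
have mPsig := measurableT_comp mPsi mg1.
rewrite -ge0_integralZl//; last first.
  by move=> x _; apply: integral_ge0 => y _ /=; apply: mule_ge0; exact: phi0.
apply: ge0_le_integral => //.
- by move=> x _ /=; apply: mule_ge0; exact: Phi0.
- by apply: (measurableT_comp (measurable_sqre mPhi)).
- exact: measurable_funeM.
- move=> x _; apply: (h2 (fun b => phi (g1 x, b))) => //.
  exact: (measurableT_comp mphi (measurable_pair1 _)).
Qed.

End tensor.

Definition tuple_map (T T' : Type) (g : T -> T') n (t : n.-tuple T) : n.-tuple T' :=
  [tuple g (tnth t j) | j < n].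

Section iid.
Context d d' (T : measurableType d) (T' : measurableType d').
Variables (g : T -> T').
Hypotheses (mg : measurable_fun setT g).

Lemma tuple_map_cons n (x : T) (t : n.-tuple T) :
  tuple_map g (tuple_cons (x, t)) = tuple_cons (g x, tuple_map g t).
Proof.
apply: eq_from_tnth => j; rewrite tnth_mktuple.
case: (unliftP ord0 j) => [i ->|->]; last by rewrite /tuple_cons.
by rewrite /tuple_cons !tnthS tnth_mktuple.
Qed.

Lemma measurable_tuple_map n : measurable_fun setT (@tuple_map _ _ g n).
Proof.
apply/measurable_fun_tnthP => j.
rewrite (_ : _ \o _ = g \o (@tnth n T ^~ j)); last first.
  by apply/funext => t /=; rewrite tnth_mktuple.
exact: (measurableT_comp mg (measurable_tnth j)).
Qed.

Lemma iid_integralS (P : probability T R) n (phi : n.+1.-tuple T -> \bar R) :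
  measurable_fun setT phi -> (forall t, 0 <= phi t) ->
  \int[iid_law P n.+1]_t phi t = \int[P \x iid_law P n]_z phi (tuple_cons z).
Proof.
move=> mphi phi0; rewrite /= ge0_integral_distribution//.
Qed.

Lemma chi2_map_iid (c : R) (P Q : probability T R) n : (0 <= c)%R -> chi2_map g c P Q ->
  chi2_map (@tuple_map _ _ g n) (c ^+ n) (iid_law P n) (iid_law Q n).
Proof.
move=> c0 h; elim: n => [|n IH] phi mphi phi0.
  have mp : measurable_fun setT (phi \o (@tuple_map _ _ g 0)).
    by apply: measurableT_comp; [exact: mphi|exact: measurable_tuple_map].
  rewrite expr0 mul1e /=.
  rewrite (integral_dirac _ _ mp)// (integral_dirac _ _ (measurable_sqre mp))// !diracT !mul1e//.
have mp : measurable_fun setT (phi \o (@tuple_map _ _ g n.+1)).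
  by apply: measurableT_comp; [exact: mphi|exact: measurable_tuple_map].
rewrite (iid_integralS _ mp); last by move=> t; exact: phi0.
pose sq t := phi (tuple_map g t) * phi (tuple_map g t).
have msq : measurable_fun setT sq by exact: (measurable_sqre mp).
rewrite [X in _ <= _ * X](_ : _ = \int[P \x iid_law P n]_z sq (tuple_cons z)); last first.
  by apply: (iid_integralS _ msq) => t /=; apply: mule_ge0; exact: phi0.
have E z : phi (tuple_map g (tuple_cons z)) =
    (phi \o @tuple_cons _ T' n) ((fun z => (g z.1, tuple_map g z.2)) z).
  by case: z => x t; rewrite tuple_map_cons.
have cn : (0 <= c ^+ n)%R by exact: exprn_ge0.
have mphi' := measurableT_comp mphi (@measurable_tuple_cons _ T' n).
have H : chi2_map (fun z : T * n.-tuple T => (g z.1, tuple_map g z.2)) (c * c ^+ n)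
    (P \x iid_law P n) (Q \x iid_law Q n).
  by apply: chi2_map_prod => //; exact: measurable_tuple_map.
have {}H := H _ mphi' (fun z => phi0 _).
rewrite exprS; move: H; congr (is_true (_ * _ <= _ * _)).
- by apply: eq_integral => z _; rewrite /= E.
- by apply: eq_integral => z _; rewrite /= E.
- by apply: eq_integral => z _; rewrite /sq /= E.
Qed.

End iid.

Lemma chi2_map_set d d' (T : measurableType d) (T' : measurableType d') (g : T -> T')
    (c : R) (P Q : probability T R) (A : set T') : measurable_fun setT g ->
  measurable A -> chi2_map g c P Q -> Q (g @^-1` A) * Q (g @^-1` A) <= c%:E * P (g @^-1` A).
Proof.
move=> mg mA h.
have mi : measurable_fun setT (EFin \o (\1_A : T' -> R)).
  by apply/measurable_EFinP; exact: measurable_indic.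
have mgA : measurable (g @^-1` A) by rewrite -[X in measurable X]setTI; exact: mg.
have E (P' : probability T R) : \int[P']_x (EFin \o \1_A) (g x) = P' (g @^-1` A).
  have := @integral_indic _ _ _ P' setT measurableT (g @^-1` A) mgA.
  by rewrite setIT => <-.
have := h _ mi (fun x => _ : 0 <= (EFin \o \1_A) x).
rewrite E (_ : \int[P]_x _ = P (g @^-1` A)); last first.
  by rewrite -E; apply: eq_integral => x _; rewrite /= -EFinM indicE; case: (_ \in _); rewrite ?mulr1 ?mulr0.
by apply => x; rewrite lee_fin.
Qed.

(** The two error events cover the space because 2 s < |th0 - th1|. If the first has P-probability
    below 1 / (4 c), the square of its Q-probability is below 1 / 4; hence the second has
    Q-probability above 1 / 2, which exceeds 1 / (4 c) since c >= 1. *)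
Lemma le_cam d d' (T : measurableType d) (T' : measurableType d') (g : T -> T')
    (c : R) (P Q : probability T R) (est : T' -> R) (th0 th1 s : R) :
  measurable_fun setT g -> measurable_fun setT est -> (1 <= c)%R -> chi2_map g c P Q ->
  (2 * s < `|th0 - th1|)%R ->
  (4 * c)^-1%:E <= P [set w | `|est (g w) - th0| > s]%R \/
  (4 * c)^-1%:E <= Q [set w | `|est (g w) - th1| > s]%R.
Proof.
move=> mg me c1 h hs.
pose A t := [set y | (`|est y - t| > s)%R].
have mA t : measurable (A t).
  have mf : measurable_fun setT (fun y => `|est y - t|%R).
    by apply: measurableT_comp => //; exact: measurable_funB.
  have -> : A t = (fun y => `|est y - t|%R) @^-1` `]s, +oo[%classic.
    by apply/seteqP; split=> y /=; rewrite in_itv/= andbT.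
  by rewrite -[X in measurable X]setTI; exact: mf.
have mgA t : measurable (g @^-1` A t) by rewrite -[X in measurable X]setTI; exact: mg.
have [|lt] := leP (4 * c)^-1%:E (P (g @^-1` A th0)); first by left.
right; have hA := chi2_map_set mg (mA th0) h.
have cov : setT `<=` (g @^-1` A th0) `|` (g @^-1` A th1).
  move=> w _; have [h1|h1] := ltrP s `|est (g w) - th0|%R; first by left.
  right; rewrite /A /=; have := ler_normB (est (g w) - th1)%R (est (g w) - th0)%R.
  have -> : (est (g w) - th1 - (est (g w) - th0) = th0 - th1)%R by ring.
  by move=> h2; lra.
pose a := fine (Q (g @^-1` A th0)); pose b := fine (Q (g @^-1` A th1)).
pose p := fine (P (g @^-1` A th0)).
have aE : Q (g @^-1` A th0) = a%:E by rewrite /a fineK//; apply: fin_num_measure; exact: mgA.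
have bE : Q (g @^-1` A th1) = b%:E by rewrite /b fineK//; apply: fin_num_measure; exact: mgA.
have pE : P (g @^-1` A th0) = p%:E by rewrite /p fineK//; apply: fin_num_measure; exact: mgA.
have : Q setT <= Q (g @^-1` A th0) + Q (g @^-1` A th1).
  apply: (@le_trans _ _ (Q ((g @^-1` A th0) `|` (g @^-1` A th1)))).
    by apply: le_measure; rewrite ?inE//; exact: measurableU.
  exact: measureU2.
rewrite probability_setT aE bE -EFinD lee_fin => ab.
rewrite pE lte_fin in lt; rewrite aE pE -!EFinM lee_fin in hA.
have c0 : (0 < c)%R by lra.
rewrite lee_fin.
have pc : (p * (4 * c) < 1)%R by rewrite -ltr_pdivlMr ?mul1r//; lra.
have a2 : (a < 2^-1)%R.
  rewrite ltNge; apply/negP => a1.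
  have aa : (2^-1 * 2^-1 <= a * a)%R by apply: ler_pM => //; lra.
  lra.
have c4 : ((4 * c)^-1 <= 4^-1)%R by rewrite lef_pV2 ?posrE; lra.
lra.
Qed.

Lemma minimax_ge n m (C : set (cdf_fun R)) (D : set (density R)) (theta : cdf_fun R -> R)
    (s c : R) (F0 F1 : cdf_fun R) (f0 f1 : density R) :
  C F0 -> C F1 -> D f0 -> D f1 -> (1 <= c)%R ->
  measurable_fun setT (@observations R n m) ->
  chi2_map (@observations R n m) c (model_prob n m F0 f0) (model_prob n m F1 f1) ->
  (2 * s < `|theta F0 - theta F1|)%R ->
  (4 * c)^-1%:E <= minimax_deviation n m C D theta s.
Proof.
move=> CF0 CF1 Df0 Df1 c1 mo h hs; apply: le_ereal_inf_tmp => _ [est _ <-].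
have me : measurable_fun setT est by [].
have [hP|hP] := le_cam mo me c1 h hs.
- apply: le_trans hP _; apply: le_trans (ereal_sup_ubound _) ; last first.
    by exists F0 => //; reflexivity.
  by apply: ereal_sup_ubound; exists f0.
- apply: le_trans hP _; apply: le_trans (ereal_sup_ubound _) ; last first.
    by exists F1 => //; reflexivity.
  by apply: ereal_sup_ubound; exists f1.
Qed.

End chi_square_bound.

(** * Mixtures, densities and convolutions of laws *)

Section laws.
Import HBNNSimple.
Context (R : realType).
Local Notation mu := (@lebesgue_measure R).
Local Notation RB := (measurableTypeR R).
Local Open Scope ereal_scope.

Section mixture.
Context d (T : measurableType d).
Variables (P0 P1 : probability T R) (a b : {nonneg R}).

(** The condition on the weights is an argument so that the instance of probability measure attached
    to this name below can rely on it. *)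
Definition mixture (_ : (a%:num + b%:num = 1)%R) : set T -> \bar R :=
  measure_add (mscale a P0) (mscale b P1).

Hypothesis ab : (a%:num + b%:num = 1)%R.

HB.instance Definition _ := Measure.copy (mixture ab) (measure_add (mscale a P0) (mscale b P1)).

Let mixture_setT : mixture ab setT = 1.
Proof.
transitivity (a%:num%:E * P0 setT + b%:num%:E * P1 setT); first exact: measure_addE.
by rewrite !probability_setT !mule1 -EFinD ab.
Qed.

HB.instance Definition _ := Measure_isProbability.Build _ _ R (mixture ab) mixture_setT.

End mixture.

Lemma mixture_exists d (T : measurableType d) (P0 P1 : probability T R) (a : R) :
  (0 <= a <= 1)%R -> exists P : probability T R, forall phi : T -> \bar R,
    measurable_fun setT phi -> (forall x, 0 <= phi x) ->
    \int[P]_x phi x = a%:E * \int[P0]_x phi x + (1 - a)%:E * \int[P1]_x phi x.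
Proof.
move=> /andP[a0 a1]; have b0 : (0 <= 1 - a)%R by rewrite subr_ge0.
have ab : ((NngNum a0)%:num + (NngNum b0)%:num = 1)%R by rewrite /= addrC subrK.
exists (mixture P0 P1 ab) => phi mphi phi0.
by rewrite [LHS]ge0_integral_measure_add// !ge0_integral_mscale.
Qed.

(** Immediate for indicators from the definition of the law, then linearity for simple functions and
    monotone convergence. *)
Lemma integral_density (f : density R) (phi : RB -> \bar R) :
  measurable_fun setT phi -> (forall x, 0 <= phi x) ->
  \int[error_law f]_x phi x = \int[mu]_x (phi x * (f x)%:E).
Proof.
move=> mphi phi0.
have mf : measurable_fun setT (EFin \o f) by apply/measurable_EFinP; exact: density_measurable.
have f0 x : 0 <= (f x)%:E by rewrite lee_fin density_ge0.
pose f_ := nnsfun_approx measurableT mphi.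
have simple n : \int[error_law f]_x (f_ n x)%:E = \int[mu]_x ((f_ n x)%:E * (f x)%:E).
  move: (f_ n) => h.
  rewrite integralT_nnsfun sintegralE /=.
  transitivity (\sum_(r \in range h) \int[mu]_x (r%:E * (\1_(h @^-1` [set r]) x)%:E * (f x)%:E)).
    apply: eq_fsbigr => r _.
    rewrite /error_law /density_prob/= integral_mkcond.
    have mi : measurable_fun setT (fun x => (\1_(h @^-1` [set r]) x)%:E * (f x)%:E).
      by apply: emeasurable_funM => //; apply/measurable_EFinP; exact: measurable_indic.
    have [r0|r0] := ltrP r 0%R.
      have -> : h @^-1` [set r] = set0 by exact: preimage_nnfun0.
      rewrite (_ : \int[mu]_x _ = 0); last first.
        by apply: integral0_eq => x _; rewrite patchE in_set0.
      by rewrite mule0 integral0_eq// => x _; rewrite indic0 mule0 mul0e.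
    under [RHS]eq_integral do rewrite -muleA.
    rewrite ge0_integralZl//; last first.
      by move=> x _; rewrite mule_ge0// lee_fin.
    congr (_ * _); apply: eq_integral => x _; rewrite patchE indicE.
    by case: (x \in _); rewrite ?mul1e ?mul0e.
  rewrite -ge0_integral_fsum//.
  - apply: eq_integral => x _; rewrite -ge0_mule_fsuml; last first.
      by move=> r; exact: nnfun_muleindic_ge0.
    congr (_ * _); rewrite fsumEFin//.
      by congr EFin; rewrite [RHS]fimfunE.
  - move=> r; apply: emeasurable_funM => //; apply: emeasurable_funM => //.
    by apply/measurable_EFinP; exact: measurable_indic.
  - by move=> r x _; rewrite mule_ge0// nnfun_muleindic_ge0.
transitivity (limn (fun n => \int[error_law f]_x (f_ n x)%:E)).
  rewrite -monotone_convergence//=.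
  - by apply: eq_integral => x _; apply/esym/cvg_lim => //; exact: cvg_nnsfun_approx.
  - by move=> n; exact/measurable_EFinP/measurable_funTS.
  - by move=> n x _; rewrite lee_fin.
  - by move=> x _ m n mn; rewrite lee_fin; exact/lefP/nd_nnsfun_approx.
transitivity (limn (fun n => \int[mu]_x ((f_ n x)%:E * (f x)%:E))).
  by congr (limn _); apply/funext => n; exact: simple.
rewrite -monotone_convergence//=.
- apply: eq_integral => x _; apply/cvg_lim => //; apply: cvgeZr => //.
  exact: cvg_nnsfun_approx.
- move=> n; apply: emeasurable_funM => //.
  exact/measurable_EFinP.
- by move=> n x _; rewrite mule_ge0// lee_fin.
- by move=> x _ m n mn; rewrite lee_wpmul2r// lee_fin; exact/lefP/nd_nnsfun_approx.
Qed.

Definition add_pair (z : RB * RB) : RB := (z.1 + z.2)%R.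

Lemma measurable_add_pair : measurable_fun setT add_pair.
Proof. by apply: measurable_funD; [exact: measurable_fst|exact: measurable_snd]. Qed.

HB.instance Definition _ := isMeasurableFun.Build _ _ _ _ add_pair measurable_add_pair.

Lemma conv_exists (P Q : probability RB R) : exists S : probability RB R,
  forall phi : RB -> \bar R, measurable_fun setT phi -> (forall x, 0 <= phi x) ->
    \int[S]_x phi x = \int[P]_x \int[Q]_y phi (x + y)%R.
Proof.
exists (distribution (P \x Q) add_pair) => phi mphi phi0.
rewrite ge0_integral_distribution//.
have mp := measurableT_comp mphi measurable_add_pair.
by rewrite (fubini_tonelli1 _ mp)// => z; exact: phi0.
Qed.

End laws.

Section cdf_of_law.
Context (R : realType) (P : probability (measurableTypeR R) R).

(** The identity as a random variable under [P]; its distribution function, made real-valued by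
    [fine], is the c.d.f. sought. *)
Let idTR : measurableTypeR R -> R := idfun.

#[local] HB.instance Definition _ :=
  @isMeasurableFun.Build _ _ _ _ idTR (@measurable_id _ _ setT).

Let F r := fine (cdf (idTR : {RV P >-> R}) r).

Let F_nd : nondecreasing F.
Proof. by move=> x y xy; rewrite fine_le ?fin_num_measure// cdf_nondecreasing. Qed.

Let F_rc : right_continuous F.
Proof.
by move=> a; apply: fine_cvg; rewrite fineK ?fin_num_measure//; exact: cdf_right_continuous.
Qed.

#[local] HB.instance Definition _ := isCumulative.Build R _ R F F_nd F_rc.

Let F_Ny0 : (F @ -oo --> (0 : R))%R.
Proof. exact/fine_cvg/cvg_cdfNy0. Qed.

Let F_y1 : (F @ +oo --> (1 : R))%R.
Proof. exact/fine_cvg/cvg_cdfy1. Qed.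

#[local] HB.instance Definition _ := isCumulativeBounded.Build R 0 1 F F_Ny0 F_y1.

Lemma cdf_exists : exists G : cdf_fun R, forall A, measurable A -> cdf_law G A = P A.
Proof. by exists F => A mA; exact: lebesgue_stieltjes_cdf_id. Qed.

End cdf_of_law.

Section chi_square_laws.
Context (R : realType).
Local Notation mu := (@lebesgue_measure R).
Local Notation RB := (measurableTypeR R).
Local Open Scope ereal_scope.

(** The Cauchy-Schwarz inequality recovered from a family of AM-GM inequalities. This form tolerates
    infinite integrals and involves no square root. *)
Lemma sqre_le_of_amgm (I A : \bar R) (c : R) : 0 <= I -> 0 <= A -> (0 < c)%R ->
  (forall t : R, (0 < t)%R -> 2%:E * I <= t%:E * A + (c / t)%:E) -> I * I <= c%:E * A.
Proof.
move=> I0 A0 c0 H.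
case: A A0 H => [a|_ _|//]; last by rewrite mulry gtr0_sg// mul1e leey.
rewrite lee_fin => a0 H.
have := H 1%R ltr01; case: I I0 H => [i|_ _|//]; last first.
  by rewrite mulry gtr0_sg// mul1e -EFinM -EFinD leye_eq.
rewrite lee_fin => i0 H _.
have {}H t : (0 < t)%R -> (2 * i <= t * a + c / t)%R.
  by move=> t0; have := H t t0; rewrite -!EFinM -EFinD lee_fin.
rewrite -!EFinM lee_fin.
have [->|in0] := eqVneq i 0%R; first by rewrite mul0r mulr_ge0// ltW.
have ip : (0 < i)%R by rewrite lt_neqAle eq_sym in0.
have [a1|a1] := ltrP 0 a.
  (* t = i / a turns the bound into 2 i <= i + c a / i, which is the claim. *)
  have := H (i / a)%R (divr_gt0 ip a1).
  rewrite divfK ?gt_eqF// => h.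
  have h2 : (i <= c / (i / a))%R by lra.
  move: h2; rewrite invf_div mulrA ler_pdivlMr//.
have a00 : a = 0%R by lra.
(* For a = 0 the choice t = c / i leaves 2 i <= i, impossible for i > 0. *)
have := H (c / i)%R (divr_gt0 c0 ip); rewrite a00 mulr0 add0r invf_div mulrCA mulfV ?gt_eqF//.
by rewrite mulr1 mulr0; lra.
Qed.

Lemma amgm_e (x : \bar R) (t : R) : 0 <= x -> (0 < t)%R ->
  2%:E * x <= t%:E * (x * x) + (1 / t)%:E.
Proof.
move=> x0 t0; case: x x0 => [x x0|_|//]; last first.
  by rewrite mulyy (mulry t) gtr0_sg// mul1e addye// leey.
rewrite -!EFinM -EFinD lee_fin.
have : (0 <= t * (x - 1 / t) ^+ 2)%R by rewrite mulr_ge0 ?sqr_ge0// ltW.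
have -> : (t * (x - 1 / t) ^+ 2 = t * (x * x) + 1 / t - 2 * x)%R by field; rewrite gt_eqF.
lra.
Qed.

Lemma ge0_integral_mulE d (T : measurableType d) (P : {measure set T -> \bar R}) (c : R)
    (phi : T -> \bar R) : measurable_fun setT phi -> (forall x, 0 <= phi x) -> (0 <= c)%R ->
  c%:E * \int[P]_x phi x = \int[P]_x (c%:E * phi x).
Proof. by move=> mphi phi0 c0; rewrite ge0_integralZl// lee_fin. Qed.

(** A law has divergence 0 from itself; the inequality is Jensen's for the square. *)
Lemma jensen_chi2 d d' (T : measurableType d) (T' : measurableType d') (g : T -> T')
  (P : probability T R) : measurable_fun setT g -> chi2_map g 1 P P.
Proof.
move=> mg phi mphi phi0.
have mp := measurableT_comp mphi mg.
have i0 : 0 <= \int[P]_x phi (g x) by exact: integral_ge0.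
have a0 : 0 <= \int[P]_x (phi (g x) * phi (g x)).
  by apply: integral_ge0 => x _; exact: mule_ge0.
apply: sqre_le_of_amgm => // t t0.
have ms : measurable_fun setT (fun x => phi (g x) * phi (g x)) by exact: emeasurable_funM.
have ms0 x : 0 <= phi (g x) * phi (g x) by exact: mule_ge0.
have -> : 2%:E * \int[P]_x phi (g x) = \int[P]_x (2%:E * phi (g x)).
  by apply: ge0_integral_mulE.
have -> : t%:E * \int[P]_x (phi (g x) * phi (g x)) = \int[P]_x (t%:E * (phi (g x) * phi (g x))).
  by apply: ge0_integral_mulE => //; exact: ltW.
have -> : (1 / t)%:E = \int[P]_x (1 / t)%:E.
  transitivity ((1 / t)%:E * P setT); first by rewrite probability_setT mule1.
  by rewrite -integral_cst.
have mt : measurable_fun setT (fun x => t%:E * (phi (g x) * phi (g x))) by exact: measurable_funeM.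
have mt0 x : setT x -> 0 <= t%:E * (phi (g x) * phi (g x)).
  by move=> _; rewrite mule_ge0// lee_fin ltW.
have ct0 (x : T) : setT x -> 0 <= (1 / t)%:E by rewrite lee_fin divr_ge0// ltW.
rewrite -(ge0_integralD P measurableT mt0 mt ct0)//.
apply: ge0_le_integral => //.
- by move=> x _; rewrite mule_ge0// lee_fin.
- exact: measurable_funeM.
- by apply: emeasurable_funD.
- by move=> x _; exact: amgm_e.
Qed.

(** [w] stands for f1 ^ 2 / f0; the product form of the hypothesis stays meaningful at zeros of f0.
    Pointwise, AM-GM gives 2 phi f1 <= t phi ^ 2 f0 + w / t. *)
Lemma chi2_density (f0 f1 : density R) (w : R -> R) (c : R) :
  intble w -> (\int[mu]_x w x <= c)%R -> (0 < c)%R ->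
  (forall x, 0 <= w x)%R -> (forall x, f1 x * f1 x <= w x * f0 x)%R ->
  chi2_map (@id RB) c (error_law f0) (error_law f1).
Proof.
move=> iw wc c0 w0 fw phi mphi phi0 /=.
have mp2 : measurable_fun setT (fun x => phi x * phi x) by exact: emeasurable_funM.
have pp0 x : 0 <= phi x * phi x by exact: mule_ge0.
have mf (f : density R) : measurable_fun setT (EFin \o f).
  by apply/measurable_EFinP; exact: density_measurable.
have ff0 (f : density R) x : 0 <= (f x)%:E by rewrite lee_fin density_ge0.
rewrite !integral_density//.
have i0 : 0 <= \int[mu]_x (phi x * (f1 x)%:E) by apply: integral_ge0 => x _; exact: mule_ge0.
have a0 : 0 <= \int[mu]_x (phi x * phi x * (f0 x)%:E).
  by apply: integral_ge0 => x _; exact: mule_ge0.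
apply: sqre_le_of_amgm => // t t0.
have m1 : measurable_fun setT (fun x => phi x * (f1 x)%:E) by apply: emeasurable_funM; [exact: mphi|exact: (mf f1)].
have m0 : measurable_fun setT (fun x => phi x * phi x * (f0 x)%:E) by apply: emeasurable_funM; [exact: mp2|exact: (mf f0)].
have mw : measurable_fun setT (fun x => (w x)%:E).
  by apply/measurable_EFinP; exact: intble_measurable.
have t0e : 0 <= t%:E by rewrite lee_fin ltW.
have ti0 : 0 <= t^-1%:E by rewrite lee_fin invr_ge0 ltW.
apply: (@le_trans _ _ (t%:E * \int[mu]_x (phi x * phi x * (f0 x)%:E) +
    t^-1%:E * \int[mu]_x (w x)%:E)); last first.
  rewrite leeD2l// (EFin_Rintegral iw) -EFinM lee_fin mulrC ler_pM2r ?invr_gt0//.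
have p10 x : 0 <= phi x * (f1 x)%:E by exact: mule_ge0.
have p00 x : 0 <= phi x * phi x * (f0 x)%:E by exact: mule_ge0.
have w0e x : 0 <= (w x)%:E by rewrite lee_fin.
have tl : (0 <= t)%R by exact: ltW.
have til : (0 <= t^-1)%R by rewrite invr_ge0.
have -> : 2%:E * \int[mu]_x (phi x * (f1 x)%:E) = \int[mu]_x (2%:E * (phi x * (f1 x)%:E)).
  by apply: ge0_integral_mulE.
have -> : t%:E * \int[mu]_x (phi x * phi x * (f0 x)%:E) =
    \int[mu]_x (t%:E * (phi x * phi x * (f0 x)%:E)) by apply: ge0_integral_mulE.
have -> : t^-1%:E * \int[mu]_x (w x)%:E = \int[mu]_x (t^-1%:E * (w x)%:E).
  by apply: ge0_integral_mulE.
have mA : measurable_fun setT (fun x => t%:E * (phi x * phi x * (f0 x)%:E)) by exact: measurable_funeM.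
have mB : measurable_fun setT (fun x => t^-1%:E * (w x)%:E) by exact: measurable_funeM.
have A0 x : setT x -> 0 <= t%:E * (phi x * phi x * (f0 x)%:E) by move=> _; exact: mule_ge0.
have B0 x : setT x -> 0 <= t^-1%:E * (w x)%:E by move=> _; exact: mule_ge0.
rewrite -(ge0_integralD mu measurableT A0 mA B0 mB).
apply: ge0_le_integral => //.
- by move=> x _; rewrite mule_ge0// lee_fin.
- exact: measurable_funeM.
- exact: emeasurable_funD.
- move=> x _; have := fw x; have := density_ge0 f1 x; have := density_ge0 f0 x; have := w0 x.
  case: (phi x) (phi0 x) => [p p0|_|//] w0x f00 f10 fwx; last first.
    have [->|f1n] := eqVneq (f1 x) 0%R.
      by rewrite mule0 mule0 adde_ge0// ?mule_ge0// ?mule_ge0// ?leey// lee_fin.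
    (* Where phi is infinite and f1 > 0, the comparison forces f0 > 0, so the right-hand side is
       infinite as well. *)
    have f0n : (0 < f0 x)%R.
      rewrite lt_neqAle f00 andbT eq_sym; apply/eqP => fz; move: fwx; rewrite fz mulr0.
      have : (0 < f1 x * f1 x)%R by rewrite -expr2 lt_neqAle eq_sym sqrf_eq0 f1n sqr_ge0.
      lra.
    have -> : +oo * +oo * (f0 x)%:E = +oo :> \bar R by rewrite mulyy mulyr gtr0_sg// mul1e.
    by rewrite (mulry t) gtr0_sg// mul1e addye// leey.
  rewrite -!EFinM -EFinD lee_fin.
  have p0r : (0 <= p)%R by rewrite -lee_fin.
  (* t p^2 f0 + w / t >= 2 p sqrt (w f0) >= 2 p f1 *)
  have h1 : (0 <= (t * (p * p * f0 x) + t^-1 * w x))%R.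
    by rewrite addr_ge0// mulr_ge0 ?invr_ge0 ?(ltW t0)// mulr_ge0// mulr_ge0.
  rewrite -(@ler_pXn2r _ 2)// ?nnegrE//; last by rewrite mulr_ge0// mulr_ge0.
  have h2 : ((2 * (p * f1 x)) ^+ 2 <= 4 * (p * p) * (w x * f0 x))%R.
    have -> : ((2 * (p * f1 x)) ^+ 2 = 4 * (p * p) * (f1 x * f1 x))%R by ring.
    by rewrite ler_wpM2l// mulr_ge0// mulr_ge0.
  apply: le_trans h2 _.
  have h3 := sqr_ge0 (t * (p * p * f0 x) - t^-1 * w x)%R.
  have -> : (4 * (p * p) * (w x * f0 x) = 4 * (t * (p * p * f0 x)) * (t^-1 * w x))%R.
    by field; rewrite gt_eqF.
  move: (t * (p * p * f0 x))%R (t^-1 * w x)%R h3 => X Y h3.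
  have -> : ((X + Y) ^+ 2 = (X - Y) ^+ 2 + 4 * X * Y)%R by ring.
  lra.
Qed.

Lemma perturbation_law_exists (m : R -> R) : measurable_fun setT (m : RB -> RB) ->
  (forall x, 0 <= m x)%R -> intble m -> (0 < \int[mu]_x m x < 1)%R ->
  exists U : probability RB R, forall phi : RB -> \bar R,
    measurable_fun setT phi -> (forall x, 0 <= phi x) ->
    \int[U]_x phi x = (1 - \int[mu]_x m x)%:E * phi 0%R + \int[mu]_x (phi x * (m x)%:E).
Proof.
move=> mm m0 im /andP[k0 k1]; set k := (\int[mu]_x m x)%R in k0 k1 *.
have [f fE] : exists f : density R, density_fun f = (fun x => k^-1 * m x)%R.
  apply: density_exists.
  - exact: measurable_funM.
  - by move=> x; rewrite mulr_ge0// invr_ge0 ltW.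
  - exact: intbleZ.
  - by rewrite (RintZ _ im) mulVf// gt_eqF.
have kk : (0 <= 1 - k <= 1)%R by apply/andP; split; lra.
have [U HU] := mixture_exists (\d_(0%R : RB)) (error_law f) kk.
exists U => phi mphi phi0; rewrite HU// integral_dirac// diracT mul1e; congr (_ + _).
rewrite integral_density// -ge0_integralZl//; first last.
- by rewrite lee_fin opprB addrC subrK ltW.
- by move=> x _; rewrite mule_ge0// lee_fin density_ge0.
- by apply: emeasurable_funM => //; apply/measurable_EFinP; exact: density_measurable.
apply: eq_integral => x _; rewrite fE muleCA -EFinM; congr (_ * _%:E).
by rewrite opprB addrC subrK mulrA mulfV ?mul1r// gt_eqF.
Qed.

(** The atom of mu_m reproduces the multiple of f in [mix]; Tonelli's theorem and the substitution x
    = t + y identify the smooth parts. *)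
Lemma integral_mix (m : R -> R) (f g : density R) (U : probability RB R) :
  measurable_fun setT (m : RB -> RB) -> (forall x, 0 <= m x)%R -> (\int[mu]_x m x <= 1)%R ->
  (forall x, intble (fun t => m (x - t) * f t)%R) -> density_fun g = mix m f ->
  (forall phi : RB -> \bar R, measurable_fun setT phi -> (forall x, 0 <= phi x) ->
    \int[U]_x phi x = (1 - \int[mu]_x m x)%:E * phi 0%R + \int[mu]_x (phi x * (m x)%:E)) ->
  forall phi : RB -> \bar R, measurable_fun setT phi -> (forall x, 0 <= phi x) ->
    \int[error_law g]_x phi x = \int[error_law f]_t \int[U]_y phi (t + y)%R.
Proof.
move=> mm m0 k1 icv gE HU phi mphi phi0.
set k := (\int[mu]_x m x)%R in k1 HU.
have mphi_t (t : R) : measurable_fun setT (fun y : RB => phi (t + y)%R).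
  by apply: (measurableT_comp mphi); exact: measurable_funD.
have m2 : measurable_fun setT (snd : RB * RB -> RB) by exact: measurable_snd.
have m1 : measurable_fun setT (fst : RB * RB -> RB) by exact: measurable_fst.
have mf : measurable_fun setT (EFin \o f) by apply/measurable_EFinP; exact: density_measurable.
have ff0 x : 0 <= (f x)%:E by rewrite lee_fin density_ge0.
have k0 : 0 <= (1 - k)%:E by rewrite lee_fin subr_ge0.
rewrite integral_density//.
have E1 t : \int[U]_y phi (t + y)%R = (1 - k)%:E * phi t + \int[mu]_y (phi (t + y)%R * (m y)%:E).
  by rewrite HU ?addr0.
pose H (z : RB * RB) := phi (z.1 + z.2)%R * (m z.2)%:E.
have mH : measurable_fun setT H.
  apply: emeasurable_funM.
    by apply: (measurableT_comp mphi); exact: measurable_funD.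
  by apply/measurable_EFinP; exact: (measurableT_comp mm).
have H0 z : 0 <= H z by rewrite mule_ge0// lee_fin.
have mHF : measurable_fun setT (fun t : RB => \int[mu]_y H (t, y)).
  exact: (@measurable_fun_fubini_tonelli_F _ _ RB RB R mu H mH H0).
have mInner : measurable_fun setT (fun t : RB => \int[U]_y phi (t + y)%R).
  rewrite (_ : (fun t => _) = (fun t : RB => (1 - k)%:E * phi t + \int[mu]_y H (t, y))); last first.
    by apply/funext => t; rewrite E1.
  by apply: emeasurable_funD => //; exact: measurable_funeM.
rewrite integral_density//; last by move=> t; exact: integral_ge0.
have hH0 (t : RB) : 0 <= \int[mu]_y H (t, y) by apply: integral_ge0 => y _; exact: H0.
have -> : \int[mu]_t ((\int[U]_y phi (t + y)%R) * (f t)%:E) =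
    \int[mu]_t ((1 - k)%:E * phi t * (f t)%:E + (\int[mu]_y H (t, y)) * (f t)%:E).
  apply: eq_integral => t _; rewrite E1 ge0_muleDl//; first exact: mule_ge0.
  exact: (hH0 t).
have mA1 : measurable_fun setT (fun t : RB => (1 - k)%:E * phi t * (f t)%:E).
  by apply: emeasurable_funM; [exact: measurable_funeM|exact: mf].
have mA2 : measurable_fun setT (fun t : RB => (\int[mu]_y H (t, y)) * (f t)%:E).
  by apply: emeasurable_funM; [exact: mHF|exact: mf].
have A10 (t : RB) : setT t -> 0 <= (1 - k)%:E * phi t * (f t)%:E.
  by move=> _; apply: mule_ge0 => //; exact: mule_ge0.
have A20 (t : RB) : setT t -> 0 <= (\int[mu]_y H (t, y)) * (f t)%:E.
  by move=> _; apply: mule_ge0 => //; exact: hH0.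
rewrite (ge0_integralD mu measurableT A10 mA1 A20 mA2).
pose J (z : RB * RB) := phi z.1 * ((m (z.1 - z.2))%:E * (f z.2)%:E).
have mJ : measurable_fun setT J.
  apply: emeasurable_funM; first exact: (measurableT_comp mphi).
  apply: emeasurable_funM.
    by apply/measurable_EFinP; apply: (measurableT_comp mm); exact: measurable_funB.
  exact: (measurableT_comp mf).
have J0 z : 0 <= J z by rewrite mule_ge0// mule_ge0// lee_fin.
have cvE x : phi x * (cv m f x)%:E = \int[mu]_t J (x, t).
  rewrite /cv -(EFin_Rintegral (icv x)) -ge0_integralZl//.
  - by apply/measurable_EFinP; exact: intble_measurable.
  - by move=> t _; rewrite lee_fin mulr_ge0// density_ge0.
have mcv : measurable_fun setT (fun x => phi x * (cv m f x)%:E).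
  rewrite (_ : (fun x => _) = (fun x : RB => \int[mu]_t J (x, t))); last by apply/funext => x; rewrite cvE.
  exact: (@measurable_fun_fubini_tonelli_F _ _ RB RB R mu J mJ J0).
have cv0 x : (0 <= cv m f x)%R by exact: cv_ge0.
transitivity (\int[mu]_x ((1 - k)%:E * phi x * (f x)%:E + phi x * (cv m f x)%:E)).
  apply: eq_integral => x _; rewrite gE /mix -/k EFinD ge0_muleDr.
  - by congr (_ + _); rewrite EFinM muleA (muleC (phi x)).
  - by rewrite lee_fin mulr_ge0 ?density_ge0// subr_ge0.
  - by rewrite lee_fin.
have B20 (x : RB) : setT x -> 0 <= phi x * (cv m f x)%:E.
  by move=> _; apply: mule_ge0 => //; rewrite lee_fin.
rewrite (ge0_integralD mu measurableT A10 mA1 B20 mcv).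
congr (_ + _).
under eq_integral do rewrite cvE.
rewrite (fubini_tonelli J mJ J0).
apply: eq_integral => t _.
have mJt : measurable_fun setT (fun x => J (x, t)).
  by apply: (measurableT_comp mJ); exact: measurable_pair2.
rewrite (@ge0_integral_affine _ 1 t (fun x => J (x, t)))// normr1 mul1e.
have mHt : measurable_fun setT (fun y : RB => H (t, y)).
  by apply: (measurableT_comp mH); exact: measurable_pair1.
rewrite muleC (ge0_integral_mulE mu mHt) ?density_ge0//.
apply: eq_integral => y _; rewrite /J /H /= mul1r addrK [(y + t)%R]addrC.
by rewrite muleA muleC.
Qed.

End chi_square_laws.

(** * Divergence between the laws of the observations *)

Section model_chi_square.
Context (R : realType).
Local Notation RB := (measurableTypeR R).
Local Open Scope ereal_scope.

(** Convolution is specified by its action on nonnegative functions, so that rearranging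
    convolutions reduces to Tonelli's theorem. *)
Definition is_conv (S P Q : probability RB R) := forall phi : RB -> \bar R,
  measurable_fun setT phi -> (forall x, 0 <= phi x) ->
  \int[S]_x phi x = \int[P]_x \int[Q]_y phi (x + y)%R.

Lemma integral_add_pair (P Q : probability RB R) (phi : RB -> \bar R) :
  measurable_fun setT phi -> (forall x, 0 <= phi x) ->
  \int[P \x Q]_z phi (add_pair z) = \int[P]_x \int[Q]_y phi (x + y)%R.
Proof.
move=> mphi phi0.
have mp := measurableT_comp mphi (@measurable_add_pair R).
by rewrite (fubini_tonelli1 _ mp)// => z; exact: phi0.
Qed.

(** Each side convolves [G], [E], [U0] and [U1], in different orders. [K] collects the integral over
    [E], after which [U0] and [U1] are exchanged by Tonelli. *)
Lemma conv_swap (G U0 U1 E S0 S1 T0 T1 : probability RB R) :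
  is_conv S0 G U0 -> is_conv S1 G U1 -> is_conv T0 E U0 -> is_conv T1 E U1 ->
  forall phi : RB -> \bar R, measurable_fun setT phi -> (forall x, 0 <= phi x) ->
    \int[S1 \x T0]_z phi (add_pair z) = \int[S0 \x T1]_z phi (add_pair z).
Proof.
move=> hS0 hS1 hT0 hT1 phi mphi phi0.
have m2 : measurable_fun setT (snd : RB * RB -> RB) by exact: measurable_snd.
have m1 : measurable_fun setT (fst : RB * RB -> RB) by exact: measurable_fst.
have mshift (a : R) (psi : RB -> \bar R) : measurable_fun setT psi ->
    measurable_fun setT (fun y : RB => psi (a + y)%R).
  by move=> mpsi; apply: (measurableT_comp mpsi); exact: measurable_funD.
have mpart (Q : probability RB R) (psi : RB -> \bar R) : measurable_fun setT psi ->
    (forall x, 0 <= psi x) -> measurable_fun setT (fun x : RB => \int[Q]_y psi (x + y)%R).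
  move=> mpsi psi0; pose H (z : RB * RB) := psi (z.1 + z.2)%R.
  have mH : measurable_fun setT H by exact: (measurableT_comp mpsi (@measurable_add_pair R)).
  exact: (@measurable_fun_fubini_tonelli_F _ _ RB RB R Q H mH (fun z => psi0 _)).
rewrite !integral_add_pair//.
rewrite (hS1 (fun x : RB => \int[T0]_y phi (x + y)%R)); [|exact: mpart|by move=> x; exact: integral_ge0].
rewrite (hS0 (fun x : RB => \int[T1]_y phi (x + y)%R)); [|exact: mpart|by move=> x; exact: integral_ge0].
apply: eq_integral => a _.
pose K (s : RB) := \int[E]_t phi (a + (s + t))%R.
have mK : measurable_fun setT K by apply: (mpart E (fun s => phi (a + s)%R)) => //; exact: mshift.
have K0 s : 0 <= K s by exact: integral_ge0.
have red (T U : probability RB R) (y : R) : is_conv T E U ->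
    \int[T]_e phi (a + y + e)%R = \int[U]_z K (y + z)%R.
  move=> hT; rewrite (hT (fun e : RB => phi (a + y + e)%R)); [|exact: mshift|by []].
  pose H (p : RB * RB) := phi (a + (y + p.2 + p.1))%R.
  have mH : measurable_fun setT H.
    apply: (measurableT_comp mphi); apply: measurable_funD => //.
    by apply: measurable_funD => //; apply: measurable_funD.
  have := fubini_tonelli H mH (fun z => phi0 _); rewrite /H /= => hh.
  rewrite /K -hh; apply: eq_integral => t _; apply: eq_integral => z _; congr phi.
  by ring.
under eq_integral do rewrite (red _ _ _ hT0).
under [RHS]eq_integral do rewrite (red _ _ _ hT1).
pose H (p : RB * RB) := K (p.1 + p.2)%R.
have mH : measurable_fun setT H by exact: (measurableT_comp mK (@measurable_add_pair R)).
have := fubini_tonelli H mH (fun z => K0 _); rewrite /H /= => ->.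
by apply: eq_integral => z _; apply: eq_integral => y _; rewrite addrC.
Qed.

Section two_hypotheses.
Variables (G U0 U1 : probability RB R) (f g0 g1 : density R) (F0 F1 : cdf_fun R) (c : R).
Hypotheses (hF0 : is_conv (cdf_law F0) G U0) (hF1 : is_conv (cdf_law F1) G U1)
  (hg0 : is_conv (error_law g0) (error_law f) U0)
  (hg1 : is_conv (error_law g1) (error_law f) U1)
  (c0 : (0 <= c)%R) (hc : chi2_map (@id RB) c (error_law g0) (error_law g1)).

Lemma observations_split n m : @observations R n m =
  (fun w : sample R n m => (tuple_map (@add_pair R) w.1, tuple_map id w.2)).
Proof.
apply/funext => -[x y]; rewrite /observations /tuple_map /=; congr (_, _).
by apply: eq_from_tnth => j; rewrite tnth_mktuple.
Qed.

Lemma measurable_observations n m : measurable_fun setT (@observations R n m).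
Proof.
rewrite observations_split.
have h1 := measurableT_comp (@measurable_tuple_map _ _ _ _ _ (@measurable_add_pair R) n)
  (@measurable_fst _ _ (n.-tuple (RB * RB)) (m.-tuple RB)).
have h2 := measurableT_comp (@measurable_tuple_map _ _ _ _ _ (@measurable_id _ RB setT) m)
  (@measurable_snd _ _ (n.-tuple (RB * RB)) (m.-tuple RB)).
by apply/measurable_fun_pairP; split; [exact: h1|exact: h2].
Qed.

(** By [conv_swap] the law of Y under (F1, g0) is also that under (F0, g1). Compared with (F0, g0)
    only the error then changes, and adding an independent variable with the same law on both sides
    does not increase the divergence. *)
Lemma chi2_sum : chi2_map (@add_pair R) c (cdf_law F0 \x error_law g0) (cdf_law F1 \x error_law g0).
Proof.
move=> phi mphi phi0.
have E := conv_swap hF0 hF1 hg0 hg1 mphi phi0.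
rewrite [X in X * _]E [X in _ * X <= _]E.
have mp := measurableT_comp mphi (@measurable_add_pair R).
have h1 := jensen_chi2 (cdf_law F0) (@measurable_id _ RB setT).
have := chi2_map_prod (@measurable_id _ RB setT) (@measurable_id _ RB setT) ler01 c0 h1 hc mp
  (fun z => phi0 _).
rewrite mul1r; exact.
Qed.

(** The two laws of Y coincide, so the Y_j contribute no divergence. *)
Lemma chi2_sum_swap :
  chi2_map (@add_pair R) 1 (cdf_law F1 \x error_law g0) (cdf_law F0 \x error_law g1).
Proof.
move=> phi mphi phi0.
have E := conv_swap hF0 hF1 hg0 hg1 mphi phi0.
rewrite -[X in X * _]E -[X in _ * X <= _]E.
exact: (jensen_chi2 _ (@measurable_add_pair R)).
Qed.

Lemma chi2_model_n n m : chi2_map (@observations R n m) (c ^+ n)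
  (model_prob n m F0 g0) (model_prob n m F1 g0).
Proof.
rewrite observations_split -[X in chi2_map _ X]mulr1.
apply: chi2_map_prod.
- exact: (measurable_tuple_map (@measurable_add_pair R)).
- exact: (measurable_tuple_map (@measurable_id _ RB setT)).
- exact: exprn_ge0.
- exact: ler01.
- by apply: chi2_map_iid chi2_sum => //; exact: measurable_add_pair.
- by apply: jensen_chi2; exact: (measurable_tuple_map (@measurable_id _ RB setT)).
Qed.

Lemma chi2_model_m n m : chi2_map (@observations R n m) (c ^+ m)
  (model_prob n m F1 g0) (model_prob n m F0 g1).
Proof.
rewrite observations_split -[X in chi2_map _ X]mul1r -[X in chi2_map _ (X * _)](expr1n _ n).
apply: chi2_map_prod.
- exact: (measurable_tuple_map (@measurable_add_pair R)).
- exact: (measurable_tuple_map (@measurable_id _ RB setT)).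
- exact: exprn_ge0.
- exact: exprn_ge0.
- by apply: chi2_map_iid chi2_sum_swap => //; exact: measurable_add_pair.
- by apply: chi2_map_iid hc => //; exact: measurable_id.
Qed.

End two_hypotheses.

End model_chi_square.

(** * The two distribution functions *)

Section base_law.
Context (R : realType).
Local Notation mu := (@lebesgue_measure R).
Local Notation RB := (measurableTypeR R).
Local Open Scope ereal_scope.

(** The inner atoms at distance [D1] have equal weights, so that an even m acts on them
    symmetrically, and the left one brings the bump to q. The outer atoms, with [D] chosen beyond
    the reach of m, only adjust the mass on each side of q. *)
Definition is_base_law (G : probability RB R) (q D D1 z wL wR p g0 : R) :=
  forall phi : RB -> \bar R, measurable_fun setT phi -> (forall x, 0 <= phi x) ->
    \int[G]_x phi x = wL%:E * phi (q - D)%R + wR%:E * phi (q + D)%R +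
      p%:E * phi (q - D1)%R + p%:E * phi (q + D1)%R +
      g0%:E * \int[mu]_(x in `[(q - z)%R, (q + z)%R]) phi x.

Lemma base_law_exists (tau q D D1 z g0 : R) : (0 < z)%R -> (0 < g0)%R ->
  (g0 * z < tau)%R -> (g0 * z < 1 - tau)%R ->
  exists (G : probability RB R) (wL wR p : R),
    [/\ (0 <= wL)%R, (0 <= wR)%R, (0 < p)%R, (wL + p + g0 * z = tau)%R &
        is_base_law G q D D1 z wL wR p g0].
Proof.
move=> z0 g00 h1 h2.
(* a is the mass of the uniform part, half of it on each side of q; u is the share of the atomic
   part that must lie left of q to reach tau. *)
pose a := (2 * (g0 * z))%R.
have a0 : (0 < a)%R by rewrite mulr_gt0// mulr_gt0.
have a1 : (a < 1)%R by rewrite /a; lra.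
pose u := ((tau - a / 2) / (1 - a))%R.
have a1' : (0 < 1 - a)%R by lra.
have u0 : (0 < u)%R by rewrite divr_gt0// /a; lra.
have u1 : (u < 1)%R by rewrite ltr_pdivrMr// /a; lra.
(* b is the share of the inner atoms within the atomic part, small enough for the outer ones to
   complete the left mass: b / 2 + (1 - b) t = u with t in [0, 1]. *)
pose b := Num.min u (1 - u)%R.
have bu : (b <= u)%R by rewrite ge_min lexx.
have bu' : (b <= 1 - u)%R by rewrite ge_min lexx orbT.
have b0 : (0 < b)%R by rewrite lt_min u0; lra.
pose t := ((u - b / 2) / (1 - b))%R.
have b1 : (0 < 1 - b)%R by lra.
have t0 : (0 <= t)%R by rewrite divr_ge0; lra.
have t1 : (t <= 1)%R by rewrite ler_pdivrMr//; lra.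
have qz : (q - z < q + z)%R by lra.
have i2 : (0 <= (2^-1 : R) <= 1)%R by rewrite invr_ge0 ler0n invf_le1// ler1n.
have it : (0 <= t <= 1)%R by rewrite t0.
have ib : (0 <= b <= 1)%R by rewrite (ltW b0) -subr_ge0 ltW.
have ia : (0 <= a <= 1)%R by rewrite !ltW.
have [A HA] := mixture_exists (\d_((q - D1)%R : RB)) (\d_((q + D1)%R : RB)) i2.
have [B HB] := mixture_exists (\d_((q - D)%R : RB)) (\d_((q + D)%R : RB)) it.
have [C HC] := mixture_exists A B ib.
have [G HG] := mixture_exists (uniform_prob qz) C ia.
exists G, ((1 - a) * (1 - b) * t)%R, ((1 - a) * (1 - b) * (1 - t))%R, ((1 - a) * b / 2)%R.
split.
- exact: mulr_ge0 (mulr_ge0 (ltW a1') (ltW b1)) t0.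
- by rewrite mulr_ge0// ?subr_ge0//; exact: mulr_ge0 (ltW a1') (ltW b1).
- by rewrite !mulr_gt0.
- have -> : (g0 * z = a / 2)%R by rewrite /a; field.
  have tb : (t * (1 - b) = u - b / 2)%R by rewrite /t divfK// gt_eqF.
  have ua : (u * (1 - a) = tau - a / 2)%R by rewrite /u divfK// gt_eqF.
  have -> : ((1 - a) * (1 - b) * t = (1 - a) * (t * (1 - b)))%R by ring.
  rewrite tb; have -> : ((1 - a) * (u - b / 2) = u * (1 - a) - (1 - a) * b / 2)%R by ring.
  by rewrite ua; ring.
- move=> phi mphi phi0.
  rewrite HG// HC// HA// HB// !integral_dirac// !diracT !mul1e integral_uniform//.
  have p0 x : 0 <= phi x by exact: phi0.
  have -> : (q + z - (q - z) = 2 * z)%R by ring.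
  rewrite muleA -EFinM (_ : (a * (2 * z)^-1 = g0)%R); last first.
    by rewrite /a; field; rewrite gt_eqF.
  rewrite addeC; congr (_ + _).
  have aux (x y : R) (X Y : \bar R) : (0 <= x)%R -> (0 <= y)%R -> 0 <= X -> 0 <= Y ->
      forall c : R, (0 <= c)%R -> c%:E * (x%:E * X + y%:E * Y) = (c * x)%:E * X + (c * y)%:E * Y.
    move=> x0 y0 X0 Y0 c c0; rewrite ge0_muleDr; [|exact: mule_ge0..].
    by rewrite !muleA -!EFinM.
  have h0 : (0 <= (2^-1 : R))%R by rewrite invr_ge0.
  have h0' : (0 <= 1 - (2^-1 : R))%R by rewrite subr_ge0 invf_le1// ler1n.
  have t1' : (0 <= 1 - t)%R by rewrite subr_ge0.
  have S1 : 0 <= (2^-1)%:E * phi (q - D1)%R + (1 - 2^-1)%:E * phi (q + D1)%R.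
    by apply: adde_ge0; apply: mule_ge0.
  have S2 : 0 <= t%:E * phi (q - D)%R + (1 - t)%:E * phi (q + D)%R.
    by apply: adde_ge0; apply: mule_ge0.
  rewrite (aux b (1 - b)%R _ _ (ltW b0) (ltW b1) S1 S2 _ (ltW a1')).
  rewrite (aux _ _ _ _ h0 h0' (p0 _) (p0 _)); last by rewrite mulr_ge0// ltW.
  rewrite (aux _ _ _ _ t0 t1' (p0 _) (p0 _)); last by rewrite mulr_ge0// ltW.
  rewrite addeC addeA; congr (_ + _ + _ * _ + _ * _); congr EFin; lra.
Qed.

Section perturbed_law.
Variables (G U : probability RB R) (m : R -> R) (q D D1 z wL wR p g0 : R) (F : cdf_fun R).
Hypotheses (HG : is_base_law G q D D1 z wL wR p g0)
  (wL0 : (0 <= wL)%R) (wR0 : (0 <= wR)%R) (p0 : (0 < p)%R) (g00 : (0 < g0)%R) (z0 : (0 < z)%R).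
Hypotheses (mm : measurable_fun setT (m : RB -> RB)) (m0 : forall x, (0 <= m x)%R)
  (im : intble m).
Let k := (\int[mu]_x m x)%R.
Hypotheses (k1 : (k < 1)%R)
  (HU : forall phi : RB -> \bar R, measurable_fun setT phi -> (forall x, 0 <= phi x) ->
    \int[U]_x phi x = (1 - k)%:E * phi 0%R + \int[mu]_x (phi x * (m x)%:E))
  (HF : is_conv (cdf_law F) G U).

Let J : set R := `[(q - z)%R, (q + z)%R]%classic.

(** The mass that mu_m, translated to x, gives to [A]. *)
Definition transported (A : set R) (x : R) : \bar R :=
  (1 - k)%:E * (\1_A x)%:E + \int[mu]_(y in A) (m (y - x))%:E.

Lemma cdf_law_set (A : set RB) : measurable A ->
  cdf_law F A = wL%:E * transported A (q - D)%R + wR%:E * transported A (q + D)%R +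
    p%:E * transported A (q - D1)%R + p%:E * transported A (q + D1)%R +
    g0%:E * \int[mu]_(x in J) transported A x.
Proof.
move=> mA.
have mi : measurable_fun setT (EFin \o (\1_A : RB -> R)).
  by apply/measurable_EFinP; exact: measurable_indic.
have i0 (x : RB) : 0 <= (EFin \o (\1_A : RB -> R)) x by rewrite lee_fin.
have trE (x : RB) : \int[U]_y ((EFin \o (\1_A : RB -> R)) (x + y)%R) = transported A x.
  have ms : measurable_fun setT (fun y : RB => (EFin \o (\1_A : RB -> R)) (x + y)%R).
    by apply: (measurableT_comp mi); exact: measurable_funD.
  rewrite (HU ms (fun y => i0 _)) addr0; congr (_ + _).
  have mmx : measurable_fun setT (fun y : RB => (EFin \o (\1_A : RB -> R)) y * (m (y - x))%:E).
    apply: emeasurable_funM => //; apply/measurable_EFinP.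
    by apply: (measurableT_comp mm); exact: measurable_funB.
  have h (y : RB) : 0 <= (EFin \o (\1_A : RB -> R)) y * (m (y - x))%:E.
    by apply: mule_ge0; [exact: i0|rewrite lee_fin].
  have := @ge0_integral_affine R 1 x _ (oner_neq0 R) mmx h.
  rewrite normr1 mul1e.
  rewrite [X in X = _ -> _](_ : _ = \int[mu]_(y in A) (m (y - x))%:E); last first.
    rewrite [RHS]integral_mkcond; apply: eq_integral => y _.
    by rewrite patchE /= indicE; case: (y \in A); rewrite ?mul1e ?mul0e.
  move=> ->; apply: eq_integral => y _.
  by rewrite mul1r addrK [(x + y)%R]addrC.
have mpart : measurable_fun setT (fun x : RB => \int[U]_y ((EFin \o (\1_A : RB -> R)) (x + y)%R)).
  pose H (w : RB * RB) := (EFin \o (\1_A : RB -> R)) (w.1 + w.2)%R.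
  have mH : measurable_fun setT H by exact: (measurableT_comp mi (@measurable_add_pair R)).
  exact: (@measurable_fun_fubini_tonelli_F _ _ RB RB R U H mH (fun w => i0 _)).
have <- : \int[cdf_law F]_x (EFin \o (\1_A : RB -> R)) x = cdf_law F A.
  by rewrite integral_indic// setIT.
rewrite HF// HG//; last by move=> x; exact: integral_ge0.
rewrite !trE; congr (_ + _ * _).
by apply: eq_integral => x _; rewrite trE.
Qed.

Lemma transported_out (A : set RB) (B x : R) : measurable A -> supp B m ->
  (forall y, A y -> (B < `|y - x|)%R) -> (~ A x) -> transported A x = 0.
Proof.
move=> mA sm Ay Ax; rewrite /transported indicE memNset// mule0 add0e.
by apply: integral0_eq => y /Ay yB; rewrite sm.
Qed.

Lemma transported_flat (A : set RB) (h x : R) : measurable A ->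
  (forall y, A y -> m (y - x) = h) ->
  transported A x = (1 - k)%:E * (\1_A x)%:E + h%:E * mu A.
Proof.
move=> mA Ay; congr (_ + _).
rewrite -integral_cst//; apply: eq_integral => y /[!inE] /Ay ->.
by [].
Qed.

(** On [q - z, q + z] the outer atoms are out of reach, while the right inner atom and the uniform
    part see only values of [m] where it equals h. The one varying term comes from the left inner
    atom, which brings the values of [m] near D1 to q. *)
Lemma perturbed_density (B h : R) : supp B m -> (0 <= B)%R -> (B + z < D)%R -> (z < D1)%R -> (0 <= h)%R ->
  (forall y, - (D1 + z) <= y <= 2 * z -> m y = h)%R ->
  has_density_on J F (fun x => (1 - k) * g0 + 2 * z * g0 * h + p * h + p * m (x - q + D1))%R.
Proof.
move=> sm B0 DB zD1 h0 mh A mA AJ.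
have AJ' y : A y -> (q - z <= y <= q + z)%R by move=> /AJ; rewrite /J/= in_itv.
rewrite (cdf_law_set mA).
have nA x : (x < q - z)%R \/ (q + z < x)%R -> ~ A x.
  by move=> hx /AJ' /andP[? ?]; case: hx; lra.
rewrite (@transported_out A B (q - D)%R)//; first last.
- by apply: nA; left; lra.
- by move=> y /AJ' /andP[? ?]; rewrite ger0_norm; lra.
rewrite (@transported_out A B (q + D)%R)//; first last.
- by apply: nA; right; lra.
- by move=> y /AJ' /andP[? ?]; rewrite ler0_norm; lra.
rewrite !mule0 !add0e.
rewrite (@transported_flat A h (q + D1)%R)//; last first.
  by move=> y /AJ' /andP[? ?]; apply: mh; apply/andP; split; lra.
have n1 : \1_A (q + D1)%R = 0%R :> R by rewrite indicE memNset//; apply: nA; right; lra.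
have n2 : \1_A (q - D1)%R = 0%R :> R by rewrite indicE memNset//; apply: nA; left; lra.
rewrite n1 mule0 add0e /transported n2 mule0 add0e.
have muA : mu A \is a fin_num.
  rewrite ge0_fin_numE//; apply: (@le_lt_trans _ _ (mu J)).
    by apply: le_measure; rewrite ?inE//; exact: measurable_itv.
  by rewrite /J lebesgue_measure_itv/=; case: ifP; rewrite ?ltry// -EFinB ltry.
have mJ : measurable (J : set RB) by exact: measurable_itv.
have flatE : \int[mu]_(x in J) transported A x = (1 - k)%:E * mu A + (2 * z)%:E * (h%:E * mu A).
  transitivity (\int[mu]_(x in J) ((1 - k)%:E * (\1_A x)%:E + h%:E * mu A)).
    apply: eq_integral => x /[!inE]; rewrite /J/= in_itv/= => /andP[? ?].
    apply: transported_flat => // y /AJ' /andP[? ?].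
    by apply: mh; apply/andP; split; lra.
  have k1' : 0 <= (1 - k)%:E by rewrite lee_fin subr_ge0 ltW.
  rewrite ge0_integralD//; first last.
  - by move=> x _; rewrite mule_ge0// lee_fin.
  - apply: measurable_funTS; apply/measurable_EFinP.
    by apply: measurable_funM => //; exact: measurable_indic.
  - by move=> x _; rewrite mule_ge0// lee_fin.
  have e1 : \int[mu]_(x in J) ((1 - k)%:E * (\1_A x)%:E) = (1 - k)%:E * mu A.
    rewrite (@ge0_integralZl _ _ _ mu J mJ (fun x => (\1_A x)%:E))//; first last.
    - by apply: measurable_funTS; apply/measurable_EFinP; exact: measurable_indic.
    by rewrite integral_indic// setIidl.
  rewrite e1; congr (_ + _).
  rewrite integral_cst//= muleC; congr (_ * _).
  have zz : (q - z < q + z)%R by rewrite ltrD2l (lt_trans _ z0)// oppr_lt0.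
  rewrite /J lebesgue_measure_itv/= lte_fin zz -EFinB; congr EFin; ring.
rewrite flatE.
have mmx (x : R) : measurable_fun A (fun y : RB => (m (y - x))%:E).
  apply: measurable_funTS; apply/measurable_EFinP.
  by apply: (measurableT_comp mm); exact: measurable_funB.
have mmx0 (x y : R) : A y -> 0 <= (m (y - x))%:E by rewrite lee_fin.
pose cst0 : R := ((1 - k) * g0 + 2 * z * g0 * h + p * h)%R.
have cst00 : (0 <= cst0)%R.
  have kk : (0 <= 1 - k)%R by rewrite subr_ge0 ltW.
  by rewrite /cst0 !addr_ge0// !mulr_ge0// ltW.
have -> : \int[mu]_(x in A) ((1 - k) * g0 + 2 * z * g0 * h + p * h + p * m (x - q + D1))%:E =
    \int[mu]_(x in A) (cst0%:E + p%:E * (m (x - (q - D1)))%:E).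
  by apply: eq_integral => x _; rewrite -EFinM -EFinD; congr (_ + _ * m _)%:E; ring.
have pe : 0 <= p%:E by rewrite lee_fin ltW.
rewrite [RHS]ge0_integralD//; first last.
- by apply: measurable_funeM; exact: mmx.
- by move=> x Ax; apply: mule_ge0 => //; exact: (mmx0 _ _ Ax).
have cE : \int[mu]_(x in A) cst0%:E = cst0%:E * mu A by exact: integral_cst.
rewrite cE [in RHS]ge0_integralZl; [|exact: mA|exact: mmx|by move=> x Ax; exact: (mmx0 _ _ Ax)|exact: pe].
have muAE : mu A = (fine (mu A))%:E by rewrite fineK.
rewrite [RHS]addeC -addeA; congr (_ + _); rewrite muAE.
move: (fine (mu A)) => c.
rewrite -?(EFinM, EFinD) -?(EFinM, EFinD); congr EFin; rewrite /cst0; ring.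
Qed.

Lemma transported_below (x : R) :
  transported [set` `]-oo, q]] x = ((1 - k) * (x <= q)%R%:R + \int[mu]_(y in `]-oo, (q - x)%R]) m y)%R%:E.
Proof.
rewrite EFinD EFinM; congr (_ + _).
  by rewrite indicE; congr (_ * _%:R%:E); rewrite mem_setE in_itv.
have ims := intble_shift (- x) im.
have mms : measurable_fun setT (fun y : RB => m (y - x)) by exact: intble_measurable.
rewrite /Rintegral fineK; last first.
  by apply: integrable_fin_num => //; exact: (integrableS measurableT).
rewrite [LHS]integral_mkcond [RHS]integral_mkcond.
have mr : measurable_fun setT (EFin \o m \_ `]-oo, (q - x)%R]).
  rewrite -restrict_EFin; apply/measurable_restrict => //.
  by rewrite setTI; apply: measurable_funTS; exact/measurable_EFinP.
have := @ge0_integral_affine R 1 (- x) _ (oner_neq0 R) mr.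
rewrite normr1 mul1e => hh; rewrite [RHS](_ : _ = \int[mu]_y (EFin \o m \_ `]-oo, (q - x)%R]) y); last first.
  by apply: eq_integral => y _; rewrite /= !patchE; case: ifP.
rewrite hh; last by move=> y; rewrite /= patchE lee_fin; case: ifP.
apply: eq_integral => y _; rewrite /= !patchE mul1r !mem_setE !in_itv/=.
have -> : (y - x <= q - x = (y <= q))%R by rewrite lerD2r.
by case: ifP.
Qed.

(** Around each outer atom either all or none of the mass falls left of q, so together they
    contribute wL. *)
Lemma perturbed_value (B : R) : supp B m -> (0 <= B)%R -> (B < D)%R -> (0 < D1)%R ->
  F q = (wL + p * ((1 - k) + (\int[mu]_(y in `]-oo, D1]) m y + \int[mu]_(y in `]-oo, (- D1)%R]) m y))
    + g0 * \int[mu]_(x in J) ((1 - k) * (x <= q)%R%:R + \int[mu]_(y in `]-oo, (q - x)%R]) m y))%R.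
Proof.
move=> sm B0 DB D10.
have mI : measurable (`]-oo, q]%classic : set RB) by [].
have FqE : cdf_law F [set` `]-oo, q]] = (F q)%:E by exact: (cdf_lebesgue_stieltjes_id F q).
have := cdf_law_set mI; rewrite FqE => E.
have big : (\int[mu]_(y in `]-oo, D]) m y = k)%R.
  rewrite Rintegral_mkcond; apply: eq_Rintegral => y _; rewrite patchE; case: ifPn => //.
  rewrite notin_setE/= in_itv/= => /negP; rewrite -ltNge => yD.
  by rewrite sm// (lt_le_trans _ (ler_norm _))//; lra.
have small : (\int[mu]_(y in `]-oo, (- D)%R]) m y = 0)%R.
  rewrite Rintegral_mkcond; apply: Rintegral_0 => y; rewrite patchE; case: ifPn => //.
  rewrite inE/= in_itv/= => yD; rewrite sm// ler0_norm; lra.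
have e1 : (q - (q - D) = D)%R by ring.
have e2 : (q - (q + D) = - D)%R by ring.
have e3 : (q - (q - D1) = D1)%R by ring.
have e4 : (q - (q + D1) = - D1)%R by ring.
have l1 : (q - D <= q)%R = true by apply/idP; lra.
have l2 : (q + D <= q)%R = false by apply/negP/negP; rewrite -ltNge; lra.
have l3 : (q - D1 <= q)%R = true by apply/idP; lra.
have l4 : (q + D1 <= q)%R = false by apply/negP/negP; rewrite -ltNge; lra.
move: E; rewrite !transported_below e1 e2 e3 e4 l1 l2 l3 l4 big small.
under eq_integral do rewrite transported_below.
pose f x := ((1 - k) * (x <= q)%R%:R + \int[mu]_(y in `]-oo, (q - x)%R]) m y)%R.
have fb (x : R) : (`|f x| <= 1)%R.
  have Mle : (0 <= \int[mu]_(y in `]-oo, (q - x)%R]) m y <= k)%R.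
    rewrite Rintegral_ge0//= Rintegral_mkcond; apply: Rint_le => //.
      rewrite /intble -restrict_EFin; apply/integrable_restrict => //; rewrite setTI.
      exact: (integrableS measurableT).
    by move=> y; rewrite patchE; case: ifP.
  move/andP: Mle => [M0 M1]; rewrite ger0_norm /f.
    case: (x <= q)%R; rewrite ?mulr1 ?mulr0 ?add0r ?(le_trans M1 (ltW k1))//.
    by rewrite -lerBrDl subKr.
  by rewrite addr_ge0// mulr_ge0// subr_ge0 ltW.
have muJ : mu J < +oo.
  by rewrite /J lebesgue_measure_itv/=; case: ifP; rewrite ?ltry// -EFinB ltry.
have fi : \int[mu]_(x in J) (f x)%:E = (\int[mu]_(x in J) f x)%:E.
  rewrite /Rintegral fineK//; apply: integrable_fin_num; first exact: measurable_itv.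
  apply: measurable_bounded_integrable.
  - exact: measurable_itv.
  - exact: muJ.
  - apply: measurable_funTS.
    (* [f] is nonincreasing, hence measurable. *)
    have nf : {homo (fun x : R => - f x)%R : x y / (x <= y)%R}.
      move=> x y xy; rewrite lerN2 /f lerD//.
        rewrite ler_wpM2l//; first by rewrite subr_ge0 ltW.
        by rewrite ler_nat; case: (leP y q) => [yq|//]; rewrite (le_trans xy yq).
      rewrite [leLHS]Rintegral_mkcond [leRHS]Rintegral_mkcond; apply: Rint_le.
      + rewrite /intble -restrict_EFin; apply/integrable_restrict => //; rewrite setTI.
        exact: (integrableS measurableT).
      + rewrite /intble -restrict_EFin; apply/integrable_restrict => //; rewrite setTI.
        exact: (integrableS measurableT).
      + move=> w; rewrite !patchE !mem_setE !in_itv/=.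
        case: (leP w (q - y)%R) => [wy|_]; last by case: ifP.
        by rewrite (le_trans wy)// lerD2l lerN2.
    have mn : measurable_fun setT (fun x : RB => - f x : RB)%R by exact: nondecreasing_measurable.
    rewrite (_ : f = (fun x => 0 - (- f x))%R); last by apply/funext => x; rewrite sub0r opprK.
    by apply: measurable_funB => //; exact: mn.
  - by exists 1%R; split=> // r r1 x _; exact: le_trans (fb x) (ltW r1).
rewrite fi -!EFinM -!EFinD => -[->]; rewrite -/f /=; ring.
Qed.

End perturbed_law.

End base_law.

(** * Scaled and shifted bumps *)

Section scaled_bump.
Context (R : realType).
Local Notation mu := (@lebesgue_measure R).
Local Notation RB := (measurableTypeR R).

Definition rescale (h : R -> R) (eta s D : R) : R -> R := fun y => eta / s * h ((y - D) / s).

Lemma supp_rescale h B eta s D : 0 < s <= 1 -> supp B h -> supp (`|D| + B) (rescale h eta s D).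
Proof.
move=> /andP[s0 s1] sh x hx; rewrite /rescale sh ?mulr0// normrM (gtr0_norm (_ : 0 < s^-1)) ?invr_gt0//.
have B0 : B < `|x - D|.
  by have := lerB_dist x D; lra.
by apply: lt_le_trans B0 _; rewrite ler_peMr// invf_ge1.
Qed.

Lemma lip_rescale h L eta s D : 0 < s -> lip L h ->
  lip (`|eta / s| * (L / s)) (rescale h eta s D).
Proof.
move=> s0 Lh x y; rewrite /rescale -mulrBr normrM -mulrA ler_wpM2l//.
apply: le_trans (Lh _ _) _.
have -> : (x - D) / s - (y - D) / s = (x - y) / s by ring.
by rewrite normrM (gtr0_norm (_ : 0 < s^-1)) ?invr_gt0// mulrA mulrAC.
Qed.

Lemma Rintegral_rescale h eta s D (w : R -> R) : 0 < s -> intble (fun y => w y * rescale h eta s D y) ->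
  \int[mu]_y (w y * rescale h eta s D y) = eta * \int[mu]_x (w (s * x + D) * h x).
Proof.
move=> s0 wi.
have sn : s != 0 by rewrite gt_eqF.
have [ii E] := Rintegral_affine D sn wi.
rewrite E (gtr0_norm s0) -(RintZ _ ii).
have e1 (x : R) : s * (w (s * x + D) * rescale h eta s D (s * x + D)) = eta * (w (s * x + D) * h x).
  rewrite /rescale addrK [s * x / s]mulrAC mulfV// mul1r.
  by field.
have [->|eta0] := eqVneq eta 0.
  rewrite mul0r; apply: Rintegral_0 => x.
  by rewrite /rescale !mul0r !mulr0.
have wi' : intble (fun x => w (s * x + D) * h x).
  have e2 (x : R) : eta^-1 * (s * (w (s * x + D) * rescale h eta s D (s * x + D))) = w (s * x + D) * h x.
    by rewrite e1 mulKf.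
  exact: (eq_intble e2 (intbleZ _ (intbleZ _ ii))).
by rewrite -(RintZ _ wi'); apply: eq_Rintegral => x _; exact: e1.
Qed.

(** The transform of the scaled bump is eta times that of [h] at s u with a shifted phase, and 1 /
    (1 + |s u|) <= s^-1 / (1 + |u|) for s <= 1. The constant is uniform in the centre, which later
    depends on s. *)
Lemma cost_rescale h L B Dm : 0 <= B -> 0 <= Dm -> lip L h -> supp B h ->
  exists2 C : R, 0 < C & forall eta s D : R, 0 < s <= 1 -> `|D| <= Dm -> forall th u,
    `|cost (rescale h eta s D) th u| <= C * `|eta / s| / (1 + `|u|) /\
    `|cost (fun y => y * rescale h eta s D y) th u| <= C * `|eta / s| / (1 + `|u|).
Proof.
move=> B0 Dm0 Lh sh.
have L0 : 0 <= L by have := Lh 1 0; rewrite subr0 normr1 mulr1; exact: le_trans.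
pose C1 := 32 * (B + 1) ^+ 2 * L; pose C2 := 32 * (B + 1) ^+ 2 * (L * (3 * B + 1)).
have B2 : 0 <= 32 * (B + 1) ^+ 2 by apply: mulr_ge0 => //; exact: sqr_ge0.
have C10 : 0 <= C1 by exact: mulr_ge0.
have C20 : 0 <= C2 by apply: mulr_ge0 => //; apply: mulr_ge0 => //; lra.
have Lx := lip_mulx B0 Lh sh; have sx := supp_mulx sh.
have [hi _] := lip_supp_intble B0 Lh sh.
have [xhi _] := lip_supp_intble B0 Lx sx.
exists (C1 + (Dm * C1 + C2) + 1); first by rewrite ltr_wpDl// !addr_ge0// mulr_ge0.
move=> eta s D s01 DDm th u; have /andP[s0 s1] := s01.
have DB : 0 <= `|D| + B by rewrite addr_ge0.
have Lr := lip_rescale eta D s0 Lh; have sr : supp (`|D| + B) (rescale h eta s D) by exact: supp_rescale.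
have [ri _] := lip_supp_intble DB Lr sr.
have [xri _] := lip_supp_intble DB (lip_mulx DB Lr sr) (supp_mulx sr).
have u1 : 0 < 1 + `|u| by rewrite ltr_pwDl.
have su1 : 0 < 1 + `|s * u| by rewrite ltr_pwDl.
have key A : 0 <= A -> A / (1 + `|s * u|) <= s^-1 * (A / (1 + `|u|)).
  move=> A0; rewrite mulrCA ler_wpM2l// -invfM lef_pV2 ?posrE ?mulr_gt0//.
  by rewrite normrM (gtr0_norm s0); nra.
have phase (x : R) : th + u * (s * x + D) = th + u * D + s * u * x by ring.
have E1 : cost (rescale h eta s D) th u = eta * cost h (th + u * D) (s * u).
  rewrite /cost (Rintegral_rescale (w := fun y => cos (th + u * y)) s0 (intble_cos th u ri)).
  by congr (_ * _); apply: eq_Rintegral => x _; rewrite phase.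
have E2 : cost (fun y => y * rescale h eta s D y) th u =
    eta * (D * cost h (th + u * D) (s * u) + s * cost (fun x => x * h x) (th + u * D) (s * u)).
  have i1 := intble_cos (th + u * D) (s * u) hi.
  have i2 := intble_cos (th + u * D) (s * u) xhi.
  have xri' := intble_cos th u xri.
  have e3 (y : R) : cos (th + u * y) * (y * rescale h eta s D y) = cos (th + u * y) * y * rescale h eta s D y.
    by rewrite mulrA.
  rewrite /cost -(RintZ D i1) -(RintZ s i2) -(RintD (intbleZ D i1) (intbleZ s i2)).
  transitivity (\int[mu]_y (cos (th + u * y) * y * rescale h eta s D y)).
    by apply: eq_Rintegral => y _; exact: e3.
  rewrite (Rintegral_rescale (w := fun y => cos (th + u * y) * y) s0); last first.
    exact: (eq_intble e3 xri').
  by congr (_ * _); apply: eq_Rintegral => x _; rewrite phase; ring.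
have b1 := cost_lip (th + u * D) (s * u) B0 Lh sh; rewrite -/C1 in b1.
have b2 := cost_lip (th + u * D) (s * u) B0 Lx sx; rewrite -/C2 in b2.
have fin A X : 0 <= A -> A <= C1 + (Dm * C1 + C2) + 1 -> `|X| <= A / (1 + `|s * u|) ->
    `|eta * X| <= (C1 + (Dm * C1 + C2) + 1) * `|eta / s| / (1 + `|u|).
  move=> A0 AC hX; rewrite normrM.
  apply: le_trans (ler_wpM2l (normr_ge0 eta) (le_trans hX (key _ A0))) _.
  rewrite [`|eta / s|]normrM (gtr0_norm (_ : 0 < s^-1)) ?invr_gt0//.
  have -> : `|eta| * (s^-1 * (A / (1 + `|u|))) = A * (`|eta| * s^-1 / (1 + `|u|)) by ring.
  rewrite -[leRHS]mulrA; apply: ler_wpM2r => //.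
  by apply: mulr_ge0; [apply: mulr_ge0 => //; rewrite invr_ge0 ltW|rewrite invr_ge0 ltW].
have p1 : 0 <= Dm * C1 by rewrite mulr_ge0.
split; [rewrite E1; apply: (fin C1) => //; lra|rewrite E2; apply: (fin (Dm * C1 + C2)); [lra|lra|]].
apply: le_trans (ler_normD _ _) _; rewrite mulrDl; apply: lerD; rewrite normrM.
  by rewrite -mulrA; apply: ler_pM.
by rewrite (gtr0_norm s0); apply: le_trans b2; rewrite ler_piMl.
Qed.

End scaled_bump.

(** * Hoelder norms *)

Section holder_bump.
Context (R : realType).
Local Notation mu := (@lebesgue_measure R).

(** Each point of a nondegenerate interval can be approached from the side of the longer half; the
    limits of [diff_quot] are therefore unique, endpoints included. *)
Lemma within_itv_dnbhs_proper (a b x : R) : a < b -> `[a, b]%classic x ->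
  ProperFilter (within `[a, b]%classic x^').
Proof.
move=> ab; rewrite /= in_itv/= => /andP[ax xb].
split; last exact: within_filter.
move=> /nbhs_ballP[e/= e0 h].
pose d := Num.min (e / 2) ((b - a) / 2).
have d0 : 0 < d by rewrite lt_min; apply/andP; split; lra.
have de : d <= e / 2 by rewrite ge_min lexx.
have dab : d <= (b - a) / 2 by rewrite ge_min lexx orbT.
have [xm|xm] := lerP x ((a + b) / 2).
- apply: (h (x + d)).
  + by rewrite /ball/= opprD addNKr normrN gtr0_norm//; lra.
  + by apply/eqP; lra.
  + by rewrite /= in_itv/=; apply/andP; split; lra.
- apply: (h (x - d)).
  + by rewrite /ball/= opprB addrC subrK gtr0_norm//; lra.
  + by apply/eqP; lra.
  + by rewrite /= in_itv/=; apply/andP; split; lra.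
Qed.

Lemma diff_quot_cvg (I : set R) f g x df : I x -> (forall y, I y -> g y = f y) ->
  is_derive x (1 : R) f df -> diff_quot I g x --> df.
Proof.
move=> Ix gf /is_derive1_caratheodory[h [hE hc hx]].
rewrite /diff_quot; apply: (@cvg_trans _ (h y @[y --> within I x^'])).
  apply: near_eq_cvg; rewrite near_withinE; near=> y => Iy.
  rewrite !gf// hE mulfK// subr_eq0.
  near: y; exact: nbhs_dnbhs_neq.
apply: cvg_within_filter; rewrite -hx.
exact: (@cvg_within_filter _ _ h (nbhs x) _ (nbhs (h x)) _ hc).
Unshelve. all: by end_near. Qed.

Variables (D : nat -> R -> R) (M : R) (n : nat).
Hypotheses (dD : forall j x, (j < n)%N -> is_derive x (1 : R) (D j) (D j.+1 x))
  (bD : forall j x, (j <= n)%N -> `|D j x| <= M).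

(** The j-th derivative of rho + e D_0 ((x - c) t); the constant survives only at order 0. *)
Let smooth (rho e t c : R) (j : nat) (x : R) :=
  (j == 0%N)%:R * rho + e * t ^+ j * D j ((x - c) * t).

Lemma is_derive_smooth rho e t c j x : (j < n)%N ->
  is_derive x (1 : R) (smooth rho e t c j) (smooth rho e t c j.+1 x).
Proof.
move=> jn.
have A : is_derive x (1 : R) (fun x => (x - c) * t) t.
  apply: (@is_derive_eq _ _ _ _ _ _ _ _
    (is_deriveM (is_deriveB (is_derive_id x 1) (is_derive_cst c x 1)) (is_derive_cst t x 1))).
  by rewrite scaler0 add0r subr0 /GRing.scale/= mulr1.
have B := @is_derive1_comp _ (D j) (fun x => (x - c) * t) x _ _ (dD _ jn) A.
apply: (@is_derive_eq _ _ _ _ _ _ _ _ (is_deriveD (is_derive_cst ((j == 0%N)%:R * rho) x 1)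
  (is_deriveM (is_derive_cst (e * t ^+ j) x 1) B))).
by rewrite scaler0 addr0 add0r /smooth /= mul0r add0r /GRing.scale/= exprS; ring.
Qed.

Lemma derive_in_n_smooth a b rho e t c j x : a < b -> (j <= n)%N -> `[a, b]%classic x ->
  derive_in_n `[a, b] j (smooth rho e t c 0) x = smooth rho e t c j x.
Proof.
move=> ab; elim: j x => [//|j IH] x jn Ix.
rewrite /derive_in_n iterS -/(derive_in_n _ j _) /derive_in.
have := within_itv_dnbhs_proper ab Ix => PF.
apply: cvg_lim => //.
apply: (diff_quot_cvg Ix (f := smooth rho e t c j)).
  by move=> y Iy; rewrite IH// ltnW.
exact: is_derive_smooth.
Qed.

Lemma strict_floorP (al : R) : 0 < al ->
  (strict_floor al)%:R < al /\ al <= (strict_floor al)%:R + 1.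
Proof.
move=> al0; have := ceil_itv al; rewrite /strict_floor.
have : (0 < Num.ceil al)%R by rewrite ceil_gt_int.
case: (Num.ceil al) => [[|k]|k]// _ /andP[h1 h2].
have -> : `|(Posz k.+1 - 1)|%N = k by lia.
move: h1 h2; rewrite intrB -!pmulrn -natr1; split; lra.
Qed.

Lemma powR_ge_min (a u : R) : 0 < a <= 1 -> 0 <= u -> Num.min 1 u <= u `^ a.
Proof.
move=> /andP[a0 a1] u0; have [u1|u1] := lerP u 1.
  have [->|un0] := eqVneq u 0; first exact: powR_ge0.
  have {}u0 : 0 < u by rewrite lt_neqAle eq_sym un0.
  by rewrite -{1}(powRr1 (ltW u0)) ger_powR// u0.
have : 1 `^ a <= u `^ a by apply: ge0_ler_powR; [exact: ltW a0|by rewrite nnegrE|by rewrite nnegrE|exact: ltW u1].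
by rewrite powR1.
Qed.

Lemma Lnorm_itv_le (I : set R) (f : R -> R) (c : R) : 0 <= c ->
  (forall x, I x -> `|f x| <= c) ->
  ('N[mu]_+oo [(EFin \o f) \_ I] <= c%:E)%E.
Proof.
move=> c0 fc; rewrite unlock /=; case: ifP => _; last by rewrite lee_fin.
apply/ess_sup_inf.ess_supP; apply: aeW => x /=; rewrite patchE.
case: ifPn => [/set_mem Ix|_]; last by rewrite abse0 lee_fin.
by rewrite lee_fin fc.
Qed.

(** Apart from rho, a derivative of order j <= k is at most M |eta| s^-(j + 1), and s^-1 >= 1 lets j
    + 1 be raised to al + 1. The k + 1 sup norms and a seminorm of twice that size give the factor k
    + 3. *)
Lemma holder_bump (al rho eta s c a b : R) : 0 < al -> (strict_floor al < n)%N ->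
  0 <= rho -> 0 < s <= 1 -> a < b ->
  holder_ball `[a, b] al (rho + ((strict_floor al)%:R + 3) * M * (`|eta| * s^-1 `^ (al + 1)))
    (fun x => rho + eta / s * D 0 ((x - c) / s)).
Proof.
move=> al0 kn rho0 /andP[s0 s1] ab.
set k := strict_floor al in kn *.
have [kal alk] := strict_floorP al0; rewrite -/k in kal alk.
pose t := s^-1; pose e := eta * t.
have t1 : 1 <= t by rewrite invf_ge1.
have t0 : 0 < t by lra.
pose E := `|eta| * t `^ (al + 1).
have E0 : 0 <= E by rewrite mulr_ge0 ?powR_ge0.
have M0 : 0 <= M by exact: le_trans (normr_ge0 _) (bD 0 (leq0n n)).
have -> : (fun x => rho + eta / s * D 0 ((x - c) / s)) = smooth rho e t c 0.
  by apply/funext => x; rewrite /smooth /= mul1r expr0 mulr1.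
have eE j : (j <= k)%N -> `|e * t ^+ j| <= E.
  move=> jk; rewrite /e -mulrA -exprS normrM ler_wpM2l//.
  rewrite ger0_norm ?exprn_ge0 ?(ltW t0)// -powR_mulrn ?(ltW t0)// ler_powR// -natr1 lerD2r.
  by rewrite (le_trans _ (ltW kal))// ler_nat.
have sb j x : (j <= k)%N -> `|smooth rho e t c j x| <= (j == 0%N)%:R * rho + M * E.
  move=> jk; rewrite /smooth (le_trans (ler_normD _ _))// lerD//.
    by rewrite ger0_norm// mulr_ge0.
  rewrite normrM mulrC ler_pM//; [exact: bD (leq_trans jk (ltnW kn))|exact: eE].
have dE j x : (j <= k)%N -> `[a, b]%classic x ->
    derive_in_n `[a, b] j (smooth rho e t c 0) x = smooth rho e t c j x.
  by move=> jk; apply: derive_in_n_smooth => //; exact: leq_trans jk (ltnW kn).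
split.
- apply: continuous_subspaceT => x.
  have n0 : (0 < n)%N by exact: leq_ltn_trans kn.
  apply/differentiable_continuous/derivable1_diffP.
  by have [] := is_derive_smooth rho e t c x n0.
- exists (rho + M * E); split; first exact: num_real.
  move=> u hu x _ /=; apply: le_trans (ltW hu).
  by have := sb 0%N x (leq0n k); rewrite mul1r.
- move=> j x jk Ix; apply/cvg_ex; exists (smooth rho e t c j.+1 x).
  apply: (diff_quot_cvg Ix (f := smooth rho e t c j)).
    by move=> y Iy; rewrite dE// ltnW.
  by apply: is_derive_smooth; exact: ltn_trans jk kn.
- rewrite /holder_norm -/k.
  apply: (@le_trans _ _ ((rho + k.+1%:R * (M * E))%:E + (2 * (M * E))%:E)%E); last first.
    by rewrite -EFinD lee_fin -natr1 -/t -/E; nra.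
  apply: leeD.
    have -> : (rho + k.+1%:R * (M * E))%:E = (\sum_(j < k.+1) ((j == 0%N :> nat)%:R * rho + M * E)%:E)%E.
      rewrite sumEFin big_split/= sumr_const card_ord big_ord_recl/= mul1r big1; last first.
        by move=> i _; rewrite mul0r.
      by rewrite addr0 mulr_natl.
    apply: lee_sum => j _; apply: Lnorm_itv_le.
      by rewrite addr_ge0// mulr_ge0.
    by move=> x Ix; rewrite dE ?sb// -ltnS.
  apply: ge_ereal_sup => _ [[x y] /= [Ix Iy xy] <-]; rewrite lee_fin.
  have xy0 : 0 < `|x - y| by rewrite normr_gt0 subr_eq0.
  rewrite !dE// ler_pdivrMr ?powR_gt0//.
  have -> : smooth rho e t c k x - smooth rho e t c k y =
      e * t ^+ k * (D k ((x - c) * t) - D k ((y - c) * t)).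
    by rewrite /smooth; ring.
  rewrite normrM.
  set X := (x - c) * t; set Y := (y - c) * t; set u := `|X - Y|.
  have uE : u = t * `|x - y|.
    by rewrite /u /X /Y -mulrBl normrM (gtr0_norm t0) mulrC; congr (_ * `|_|); ring.
  have h1 : `|D k X - D k Y| <= M * u.
    have := @derive_bound R (D k) (D k.+1) Y (X - Y) M (fun z => dD z kn) (fun z _ => bD z kn).
    by rewrite [Y + _]addrC subrK.
  have h2 : `|D k X - D k Y| <= 2 * M.
    have := bD X (ltnW kn); have := bD Y (ltnW kn); have := ler_normB (D k X) (D k Y); lra.
  (* Interpolation: the increment is at most 2 M min (1, u), and min (1, u) <= u ^ (al - k) because
     0 < al - k <= 1. *)
  have h3 : `|D k X - D k Y| <= 2 * M * u `^ (al - k%:R).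
    apply: (@le_trans _ _ (2 * M * Num.min 1 u)); last first.
      rewrite ler_wpM2l//; first by rewrite mulr_ge0.
      by apply: powR_ge_min; [apply/andP; split; lra|exact: normr_ge0].
    have [u1|u1] := lerP 1 u; first by rewrite mulr1.
    have u0 : 0 <= u by exact: normr_ge0.
    by nra.
  have h4 : `|e * t ^+ k| * t `^ (al - k%:R) = E.
    rewrite /e -mulrA -exprS normrM [`|t ^+ _|]ger0_norm ?exprn_ge0 ?(ltW t0)//.
    rewrite -powR_mulrn ?(ltW t0)// -mulrA -powRD; last by rewrite (gt_eqF t0) implybT.
    by rewrite /E; congr (_ * _ `^ _); rewrite -natr1; ring.
  apply: le_trans (ler_wpM2l (normr_ge0 _) h3) _.
  rewrite uE powRM ?(ltW t0)// -h4.
  by rewrite le_eqVlt; apply/orP; left; apply/eqP; ring.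
Qed.

End holder_bump.

(** * Quantiles, and the value at the point q *)

Section quantile_bounds.
Context (R : realType).
Local Notation mu := (@lebesgue_measure R).
Local Notation RB := (measurableTypeR R).
Variables (F : cdf_fun R) (rho : R -> R) (a0 b0 r K : R).
Hypotheses (dF : has_density_on `[a0, b0] F rho) (mrho : measurable_fun setT (rho : RB -> RB))
  (r0 : 0 < r) (rK : forall x, `[a0, b0]%classic x -> r <= rho x <= K).

Lemma cdf_increment x y : a0 <= x -> x <= y -> y <= b0 -> r * (y - x) <= F y - F x <= K * (y - x).
Proof.
move=> ax xy yb; move: xy; rewrite le_eqVlt => /predU1P[->|xy]; first by rewrite !subrr !mulr0 lexx.
have mI : measurable (`]x, y]%classic : set RB) by exact: measurable_itv.
have IJ : `]x, y]%classic `<=` `[a0, b0]%classic.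
  by move=> u; rewrite /= !in_itv/= => /andP[? ?]; apply/andP; split; lra.
have E : lebesgue_stieltjes_measure F `]x, y]%classic = (F y - F x)%:E.
  rewrite /lebesgue_stieltjes_measure /measure_extension measurable_mu_extE/=; last exact: is_ocitv.
  by rewrite wlength_itv_bnd// ltW.
have muI : mu `]x, y]%classic = (y - x)%:E.
  by rewrite lebesgue_measure_itv/= lte_fin xy -EFinB.
have := dF mI IJ; rewrite E => E2.
have mr : measurable_fun `]x, y]%classic (EFin \o rho).
  by apply: measurable_funTS; exact/measurable_EFinP.
apply/andP; split; rewrite -lee_fin E2 EFinM -muI -integral_cst//; apply: ge0_le_integral => //=;
  by move=> u Iu; rewrite lee_fin; have /andP[] := rK (IJ _ Iu); move: r0; lra.
Qed.

(** Going left from q, F falls at a rate between r and K, so it loses the excess d within a distance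
    between d / K and d / r. The condition on d keeps this inside the interval where the density is
    controlled. *)
Lemma quantile_bounds tau q d : a0 <= q <= b0 -> 0 <= d -> d < r * (q - a0) -> r <= K ->
  F q = tau + d -> q - d / r <= quantile tau F <= q - d / K.
Proof.
move=> /andP[aq qb] d0 dr rleK Fq.
have K0 : 0 < K by exact: lt_le_trans rleK.
have dr' : d / r < q - a0 by rewrite ltr_pdivrMr// mulrC.
have dr0 : 0 <= d / r by rewrite divr_ge0// ltW.
have dK0 : 0 <= d / K by rewrite divr_ge0// ltW.
have dKr : d / K <= d / r by rewrite ler_wpM2l// lef_pV2.
have lb : lbound [set x | tau <= F x] (q - d / r).
  move=> y /= ty; rewrite leNgt; apply/negP => yl.
  have [ya|ya] := lerP a0 y.
    have : r * (q - y) <= F q - F y.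
      have yq : y <= q by lra.
      by have /andP[] := cdf_increment ya yq qb.
    have : r * (d / r) < r * (q - y) by rewrite ltr_pM2l//; lra.
    have -> : r * (d / r) = d by rewrite mulrC divfK// gt_eqF.
    by lra.
  have : r * (q - a0) <= F q - F a0 by have /andP[] := cdf_increment (lexx a0) aq qb.
  have : F y <= F a0 by apply: cumulative_is_nondecreasing; exact: ltW.
  by lra.
have up : tau <= F (q - d / K).
  have h1 : a0 <= q - d / K by lra.
  have h2 : q - d / K <= q by lra.
  have /andP[_] := cdf_increment h1 h2 qb.
  have -> : K * (q - (q - d / K)) = d by field; rewrite gt_eqF.
  by lra.
apply/andP; split; first by apply: lb_le_inf => //; exists (q - d / K).
by apply: ge_inf; [exists (q - d / r)|].
Qed.

End quantile_bounds.

Section symmetric_value.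
Context (R : realType).
Local Notation mu := (@lebesgue_measure R).
Local Notation RB := (measurableTypeR R).

Lemma intble_restrict (A : set RB) (f : R -> R) : measurable A -> intble f -> intble (f \_ A).
Proof.
move=> mA fi; rewrite /intble -restrict_EFin; apply/integrable_restrict => //; rewrite setTI.
exact: (integrableS measurableT).
Qed.

Lemma Rintegral_point (x a : R) : intble (fun y => (y == a)%:R * x : R) /\
  \int[mu]_y ((y == a)%:R * x) = 0.
Proof.
have [ai aE] := @Rint_indic R [set a] 0 (measurable_set1 a) (lebesgue_measure_set1 a).
have e (y : R) : \1_[set a] y = (y == a)%:R :> R.
  by rewrite indicE; case: eqP => [->|ya]; [rewrite mem_set|rewrite memNset].
have e' (y : R) : x * \1_[set a] y = (y == a)%:R * x by rewrite e mulrC.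
split; first exact: (eq_intble e' (intbleZ x ai)).
have <- : x * \int[mu]_y (\1_[set a] y : R) = \int[mu]_y ((y == a)%:R * x).
  by rewrite -(RintZ x ai); apply: eq_Rintegral => y _; exact: e'.
by rewrite aE mulr0.
Qed.

(** Reflection turns y <= - a into y >= a, and the two half-lines overlap only in a null set. *)
Lemma Rintegral_below_reflect (m : R -> R) (a : R) : intble m -> (forall y, m (- y) = m y) ->
  \int[mu]_(y in `]-oo, a]) m y + \int[mu]_(y in `]-oo, (- a)%R]) m y = \int[mu]_y m y.
Proof.
move=> im me.
have mI b : measurable (`]-oo, b]%classic : set RB) by [].
rewrite ![\int[mu]_(y in `]-oo, _]) _]Rintegral_mkcond.
have i1 := intble_restrict (mI a) im.
have i2 := intble_restrict (mI (- a)) im.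
have [ip pE] := Rintegral_point (m a) a.
rewrite -(Rintegral_opp i2).
have n1 : (-1 : R) != 0 by rewrite oppr_eq0 oner_neq0.
have [i2' _] := Rintegral_affine 0 n1 i2.
have i3 : intble (fun y => (m \_ `]-oo, (- a)%R]) (- y)).
  by apply: (eq_intble _ i2') => y; rewrite mulN1r addr0.
rewrite -(RintD i1 i3).
transitivity (\int[mu]_y (m y + (y == a)%:R * m a)); last by rewrite (RintD im ip) pE addr0.
apply: eq_Rintegral => y _; rewrite !patchE !mem_setE !in_itv/= me lerN2.
by case: (ltgtP y a) => [||->]; rewrite ?mul0r ?mul1r ?addr0 ?add0r.
Qed.

Definition base_value (q D1 z wL p g0 : R) (m : R -> R) : R :=
  wL + p * ((1 - \int[mu]_y m y) +
    (\int[mu]_(y in `]-oo, D1]) m y + \int[mu]_(y in `]-oo, (- D1)%R]) m y)) +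
  g0 * \int[mu]_(x in `[(q - z)%R, (q + z)%R])
    ((1 - \int[mu]_y m y) * (x <= q)%R%:R + \int[mu]_(y in `]-oo, (q - x)%R]) m y).

Lemma itv_reflect (q z x : R) : (q - z <= 2 * q - x <= q + z) = (q - z <= x <= q + z).
Proof. by apply/andP/andP => -[? ?]; split; lra. Qed.

(** The masses left of q coming from x and from its mirror image 2 q - x add up to 1 unless x = q.
    Hence the uniform part contributes half of its mass 2 z g0, and the inner atoms contribute p
    together. *)
Lemma base_value_even (q D1 z wL p g0 : R) m : 0 < z -> intble m -> (forall y, 0 <= m y) ->
  (forall y, m (- y) = m y) -> \int[mu]_y m y < 1 ->
  base_value q D1 z wL p g0 m = wL + p + g0 * z.
Proof.
move=> z0 im m0 me k1; rewrite /base_value (Rintegral_below_reflect D1 im me).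
set k := \int[mu]_y m y in k1 *.
pose J : set RB := `[(q - z)%R, (q + z)%R]%classic.
pose f (x : R) := (1 - k) * (x <= q)%R%:R + \int[mu]_(y in `]-oo, (q - x)%R]) m y.
have mJ : measurable J by exact: measurable_itv.
have muJ : mu J = (2 * z)%:E.
  have zz : q - z < q + z by lra.
  by rewrite /J lebesgue_measure_itv/= lte_fin zz -EFinB; congr EFin; ring.
have [Ji JE] := Rint_indic mJ muJ.
have mI b : measurable (`]-oo, b]%classic : set RB) by [].
have fN (x : R) : f x + f (2 * q - x) = 1 + (1 - k) * (x == q)%:R.
  have E : \int[mu]_(y in `]-oo, (q - x)%R]) m y + \int[mu]_(y in `]-oo, (q - (2 * q - x))%R]) m y = k.
    have -> : q - (2 * q - x) = - (q - x) by ring.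
    exact: Rintegral_below_reflect.
  transitivity ((1 - k) * ((x <= q)%R%:R + (2 * q - x <= q)%R%:R) + k).
    by rewrite /f addrACA E -mulrDr.
  have -> : (2 * q - x <= q) = (q <= x) by apply/idP/idP; lra.
  by case: (ltgtP x q) => _ /=; ring.
have fm : measurable_fun setT (f : RB -> RB).
  have nf : {homo (fun x : R => - f x) : x y / x <= y}.
    move=> x y xy; rewrite lerN2 /f lerD//.
      rewrite ler_wpM2l//; first by rewrite subr_ge0 ltW.
      by rewrite ler_nat; case: (leP y q) => [yq|//]; rewrite (le_trans xy yq).
    rewrite [leLHS]Rintegral_mkcond [leRHS]Rintegral_mkcond.
    apply: Rint_le; [exact: intble_restrict|exact: intble_restrict|].
    move=> w; rewrite !patchE !mem_setE !in_itv/=.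
    case: (leP w (q - y)) => [wy|_]; last by case: ifP.
    by rewrite (le_trans wy)// lerD2l lerN2.
  have mn : measurable_fun setT (fun x : RB => - f x : RB) by exact: nondecreasing_measurable.
  rewrite (_ : f = (fun x => 0 - (- f x))); last by apply/funext => x; rewrite sub0r opprK.
  by apply: measurable_funB => //; exact: mn.
have fb (x : R) : `|f x| <= 1.
  have Mle : \int[mu]_(y in `]-oo, (q - x)%R]) m y <= k.
    rewrite Rintegral_mkcond; apply: Rint_le; [exact: intble_restrict|exact: im|].
    by move=> y; rewrite patchE; case: ifP.
  have M0 : 0 <= \int[mu]_(y in `]-oo, (q - x)%R]) m y by exact: Rintegral_ge0.
  rewrite ger0_norm /f.
    case: (x <= q)%R; rewrite ?mulr1 ?mulr0 ?add0r ?(le_trans Mle (ltW k1))//.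
    by rewrite -lerBrDl subKr.
  by rewrite addr_ge0// mulr_ge0// subr_ge0 ltW.
have Jf : intble (fun x => \1_J x * f x).
  apply: (eq_intble _ (intbleM Ji fm fb)) => x; exact: mulrC.
rewrite -/J -/f subrK.
have IE : \int[mu]_(x in J) f x = \int[mu]_x (\1_J x * f x).
  rewrite Rintegral_mkcond; apply: eq_Rintegral => x _.
  by rewrite patchE indicE; case: (x \in J); rewrite ?mul1r ?mul0r.
have n1 : (-1 : R) != 0 by rewrite oppr_eq0 oner_neq0.
have [Jf' E2] := Rintegral_affine (2 * q) n1 Jf.
rewrite normrN1 mul1r in E2.
have [ip pE] := Rintegral_point (1 - k) q.
have sumE : \int[mu]_x (\1_J x * f x) + \int[mu]_x (\1_J x * f x) = 2 * z.
  rewrite [X in _ + X]E2 -(RintD Jf Jf').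
  transitivity (\int[mu]_x (\1_J x + (x == q)%:R * (1 - k))); last by rewrite (RintD Ji ip) JE pE addr0.
  apply: eq_Rintegral => x _.
  have -> : -1 * x + 2 * q = 2 * q - x by ring.
  have -> : \1_J (2 * q - x) = \1_J x :> R.
    by rewrite !indicE /J !mem_setE !in_itv/= itv_reflect.
  rewrite -mulrDr fN indicE; have [xJ|xJ] := boolP (x \in J).
    by rewrite mul1r mulrC.
  have -> : (x == q) = false.
    apply/negbTE/negP => /eqP xq; move/negP: xJ; apply.
    by rewrite xq /J mem_setE in_itv/= lerDl gerBl ltW.
  by rewrite !mul0r addr0.
rewrite IE mulr1; congr (_ + _ * _).
by move: sumE; move: (\int[mu]_x (\1_J x * f x)) => w; clear; lra.
Qed.

(** As [n] has integral 0 and vanishes up to z, the only term that feels it is the left inner atom,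
    which sees its primitive at D1. *)
Lemma base_value_add (q D1 z wL p g0 : R) m n : 0 < z -> z < D1 -> intble m -> intble n ->
  \int[mu]_y n y = 0 -> (forall y, y <= z -> n y = 0) ->
  base_value q D1 z wL p g0 (fun y => m y + n y) =
  base_value q D1 z wL p g0 m + p * \int[mu]_(y in `]-oo, D1]) n y.
Proof.
move=> z0 zD im ni n0 nz; rewrite /base_value (RintD im ni) n0 addr0.
have mI b : measurable (`]-oo, b]%classic : set RB) by [].
have add b : \int[mu]_(y in `]-oo, b]) (m y + n y) =
    \int[mu]_(y in `]-oo, b]) m y + \int[mu]_(y in `]-oo, b]) n y.
  rewrite ![\int[mu]_(y in `]-oo, _]) _]Rintegral_mkcond.
  rewrite -(RintD (intble_restrict (mI b) im) (intble_restrict (mI b) ni)).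
  by apply: eq_Rintegral => y _; rewrite !patchE; case: ifP; rewrite ?addr0.
have zero b : b <= z -> \int[mu]_(y in `]-oo, b]) n y = 0.
  move=> bz; rewrite Rintegral_mkcond; apply: Rintegral_0 => y; rewrite patchE.
  case: ifPn => //; rewrite mem_setE in_itv/= => yb; apply: nz; exact: le_trans bz.
rewrite !add (zero (- D1)); last lra.
pose I := \int[mu]_(x in `[(q - z)%R, (q + z)%R])
  ((1 - \int[mu]_y m y) * (x <= q)%R%:R + \int[mu]_(y in `]-oo, (q - x)%R]) m y).
rewrite [X in _ + g0 * X = _](_ : _ = I); last first.
  apply: eq_Rintegral => x; rewrite mem_setE in_itv/= => /andP[qx _].
  by rewrite add zero ?addr0// lerBlDl -lerBlDr.
by rewrite -/I; ring.
Qed.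

End symmetric_value.

(** * The two hypotheses *)

Section mixtures.
Context (R : realType).
Local Notation mu := (@lebesgue_measure R).
Local Notation RB := (measurableTypeR R).

Definition trapezoid (k M x : R) : R := k * Num.max 0 (Num.min 1 (M + 1 - `|x|)).

Lemma clip_lip (x y : R) :
  `|Num.max 0 (Num.min 1 x) - Num.max 0 (Num.min 1 y)| <= `|x - y|.
Proof.
have h1 := ler_norm (x - y); have h2 := ler_norm (- (x - y)); rewrite normrN in h2.
by have h3 := normr_ge0 (x - y); rewrite ler_norml;
  have [? | ?] := lerP 1 x; have [?|?] := lerP 1 y;
  rewrite ?(max_r (ler01)); have [?|?] := lerP 0 x; have [?|?] := lerP 0 y;
  apply/andP; split; lra.
Qed.

Section trapezoid.
Variables (k M : R).
Hypotheses (k0 : 0 <= k) (M0 : 0 <= M).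

Lemma trapezoid_lip : lip k (trapezoid k M).
Proof.
move=> x y; rewrite /trapezoid -mulrBr normrM (ger0_norm k0) ler_wpM2l//.
apply: le_trans (clip_lip _ _) _.
have -> : M + 1 - `|x| - (M + 1 - `|y|) = `|y| - `|x| by ring.
by rewrite distrC; exact: ler_dist_dist.
Qed.

Lemma trapezoid_supp : supp (M + 1) (trapezoid k M).
Proof.
move=> x hx; rewrite /trapezoid max_l ?mulr0// ge_min; apply/orP; right.
by rewrite subr_le0 ltW.
Qed.

Lemma trapezoid_ge0 x : 0 <= trapezoid k M x.
Proof. by rewrite mulr_ge0// le_max lexx. Qed.

Lemma trapezoid_even x : trapezoid k M (- x) = trapezoid k M x.
Proof. by rewrite /trapezoid normrN. Qed.

Lemma trapezoid_flat x : `|x| <= M -> trapezoid k M x = k.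
Proof.
move=> xM; rewrite /trapezoid min_l; first by rewrite max_r ?mulr1.
by move: xM; lra.
Qed.

End trapezoid.

Lemma trapezoid_Rintegral_gt0 (k M : R) : 0 < k -> 0 < M -> 0 < \int[mu]_x trapezoid k M x.
Proof.
move=> k0 M0; have M1 : 0 <= M + 1 by rewrite addr_ge0// ltW.
have [ti _] := lip_supp_intble M1 (trapezoid_lip M (ltW k0)) (@trapezoid_supp k M).
have mJ : measurable (`[0, M]%classic : set RB) by exact: measurable_itv.
have muJ : mu (`[0, M]%classic : set RB) = M%:E.
  by rewrite lebesgue_measure_itv/= lte_fin M0 sube0.
have [Ji JE] := Rint_indic mJ muJ.
apply: (@lt_le_trans _ _ (k * \int[mu]_x (\1_(`[0, M]%classic : set RB) x : R))).
  by rewrite JE mulr_gt0.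
rewrite -(RintZ k Ji); apply: (Rint_le (intbleZ k Ji) ti) => x; rewrite indicE.
have [xJ|xJ] := boolP (x \in (`[0, M]%classic : set RB)); last by rewrite mulr0 trapezoid_ge0// ltW.
move: xJ; rewrite mem_setE in_itv/= => /andP[x0 xM].
by rewrite mulr1 trapezoid_flat ?ger0_norm.
Qed.

Lemma reference_density (b gamma K K' : R) (f : density R) : 0 <= b -> 0 < K -> K < K' ->
  error_class b K gamma f ->
  exists (g : density R) (L : R), [/\ 0 < L, supp L g, cost_class b K' g &
    (\int[mu]_x (`|x| `^ gamma * g x)%:E <= K'%:E)%E].
Proof.
move=> b0 K0 KK /error_classE[fC fM].
have [g [L [L0 sg gC gf]]] := cost_class_truncate b0 K0 KK fC.
exists g, L; split => //.
have mp : measurable_fun setT (fun x : RB => `|x| `^ gamma : RB).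
  by apply: (measurableT_comp (measurable_powR gamma)); apply: continuous_measurable_fun; exact: norm_continuous.
have c0 : 0 <= K' / K by rewrite divr_ge0// ltW// (lt_trans K0).
apply: (@le_trans _ _ (\int[mu]_x ((K' / K)%:E * (`|x| `^ gamma * f x)%:E))%E).
  apply: ge0_le_integral => //=.
  - by move=> x _; rewrite lee_fin mulr_ge0 ?powR_ge0 ?density_ge0.
  - by apply/measurable_EFinP; apply: measurable_funM => //; exact: density_measurable.
  - apply: measurable_funeM; apply/measurable_EFinP; apply: measurable_funM => //.
    exact: density_measurable.
  - by move=> x _; rewrite -EFinM lee_fin mulrCA ler_wpM2l ?powR_ge0.
rewrite ge0_integralZl//=; last 2 first.
- by apply/measurable_EFinP; apply: measurable_funM => //; exact: density_measurable.
- by move=> x _; rewrite lee_fin mulr_ge0 ?powR_ge0 ?density_ge0.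
rewrite (_ : K'%:E = (K' / K)%:E * K%:E)%E; last by rewrite -EFinM divfK// gt_eqF.
by apply: lee_wpmul2l => //; rewrite lee_fin.
Qed.

Lemma cv_add (f : density R) (m n : R -> R) x : intble (fun t => m (x - t) * f t) ->
  intble (fun t => n (x - t) * f t) ->
  cv (fun y => m y + n y) f x = cv m f x + cv n f x.
Proof.
move=> mi ni; rewrite /cv -(RintD mi ni); apply: eq_Rintegral => t _; exact: mulrDl.
Qed.

Lemma cv_ge_flat (f : density R) (m : R -> R) (k L M x : R) : supp L f ->
  intble (fun t => m (x - t) * f t) -> (forall y, `|y| <= M -> m y = k) ->
  `|x| + L <= M -> cv m f x = k.
Proof.
move=> sf mi mk xM; rewrite /cv.
transitivity (\int[mu]_t (k * f t)); last first.
  by rewrite (RintZ k (density_intble f)) density_Rint1 mulr1.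
apply: eq_Rintegral => t _; have [tL|tL] := lerP `|t| L; last by rewrite sf// !mulr0.
by rewrite mk// (le_trans (ler_normB _ _))// (le_trans _ xM)// lerD2l.
Qed.

(** With d = n * f one has g1 = g0 + d and g1 ^ 2 / g0 = g0 + 2 d + d ^ 2 / g0, whose middle term
    integrates to 0. Wherever d is not 0 one has |x| <= Bn + L; there m * f = k because m is flat up
    to Bn + 2 L, so g0 >= k. *)
Lemma chi2_mix (f g0 g1 : density R) (m n : R -> R) (k L B Bn M e en c : R) :
  0 < k -> 0 < L -> 0 <= B -> 0 <= Bn -> supp L f ->
  lip e m -> supp B m -> lip en n -> supp Bn n -> \int[mu]_y n y = 0 ->
  (forall y, `|y| <= M -> m y = k) -> \int[mu]_y m y <= 1 -> Bn + 2 * L <= M ->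
  density_fun g0 = mix m f -> density_fun g1 = mix (fun y => m y + n y) f ->
  1 + k^-1 * \int[mu]_x (cv n f x) ^+ 2 <= c ->
  chi2_map id c (error_law g0) (error_law g1).
Proof.
move=> k0 L0 B0 Bn0 sf lm sm ln sn n0 mk m1 BM g0E g1E cE.
have bm := lip_bsupp B0 lm sm; have bn := lip_bsupp Bn0 ln sn.
have [mi _] := lip_supp_intble B0 lm sm; have [ni _] := lip_supp_intble Bn0 ln sn.
pose d := cv n f.
have dl : lip en d := cv_lip f Bn0 ln sn.
have ds : supp (Bn + L) d := cv_supp sn sf.
have BL : 0 <= Bn + L by rewrite addr_ge0// ltW.
have [_ md db _] := lip_bsupp BL dl ds.
have [di _] := lip_supp_intble BL dl ds.
have d2i : intble (fun x => d x ^+ 2) := intbleM di md db.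
have d0 : \int[mu]_x d x = 0.
  rewrite -cost_cost0 (cost_cv 0 0 bn sf) [cost n 0 0]cost_cost0 n0 mulr0 add0r.
  rewrite [cost n (pi / 2) 0](_ : _ = 0) ?mulr0//.
  by apply: Rintegral_0 => x; rewrite mul0r addr0 cos_pihalf mul0r.
have g1D x : g1 x = g0 x + d x.
  rewrite g0E g1E /mix (RintD mi ni) n0 addr0 (cv_add (cv_intble f x bm) (cv_intble f x bn)).
  by rewrite addrA.
have g0k x : `|x| <= Bn + L -> k <= g0 x.
  move=> xB; rewrite g0E /mix (cv_ge_flat sf (cv_intble f x bm) mk); last by lra.
  by rewrite lerDr mulr_ge0 ?density_ge0// subr_ge0.
have gi := density_intble g0.
pose w x := g0 x + (2 * d x + k^-1 * d x ^+ 2).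
have wi : intble w := intbleD gi (intbleD (intbleZ 2 di) (intbleZ k^-1 d2i)).
have wI : \int[mu]_x w x = 1 + k^-1 * \int[mu]_x (d x) ^+ 2.
  rewrite (RintD gi (intbleD (intbleZ 2 di) (intbleZ k^-1 d2i))) density_Rint1.
  by rewrite (RintD (intbleZ 2 di) (intbleZ k^-1 d2i)) (RintZ 2 di) (RintZ k^-1 d2i) d0 mulr0 add0r.
have I0 : 0 <= \int[mu]_x (d x) ^+ 2 by apply: Rintegral_ge0 => x _; exact: sqr_ge0.
have ki0 : 0 < k^-1 by rewrite invr_gt0.
have kk : k^-1 * k = 1 by rewrite mulVf// gt_eqF.
have c0 : 0 < c by apply: lt_le_trans cE; rewrite ltr_wpDr// mulr_ge0// ltW.
apply: (chi2_density wi _ c0); first by rewrite wI.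
- move=> x; rewrite /w; have := density_ge0 g0 x; have [xB|xB] := lerP `|x| (Bn + L); last first.
    by rewrite ds// expr0n/= !mulr0 !addr0.
  have := g0k x xB; move: (d x) (density_fun g0 x) => a g gk _.
  have : 0 <= k^-1 * (k + a) ^+ 2 by rewrite mulr_ge0 ?sqr_ge0// ltW.
  have -> : k^-1 * (k + a) ^+ 2 = k^-1 * k * k + (k^-1 * k) * (2 * a) + k^-1 * a ^+ 2 by ring.
  by rewrite kk !mul1r; move: gk; clear; lra.
- move=> x; rewrite /w g1D; have [xB|xB] := lerP `|x| (Bn + L); last first.
    by rewrite ds// expr0n/= !mulr0 !addr0.
  have := g0k x xB; move: (d x) (density_fun g0 x) => a g gk.
  have : a ^+ 2 * (k^-1 * k) <= a ^+ 2 * (k^-1 * g) by rewrite !ler_wpM2l ?sqr_ge0// ltW.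
  rewrite kk mulr1 => h.
  have -> : (g + (2 * a + k^-1 * a ^+ 2)) * g = g * g + 2 * a * g + a ^+ 2 * (k^-1 * g) by ring.
  have -> : (g + a) * (g + a) = g * g + 2 * a * g + a ^+ 2 by ring.
  by rewrite lerD2l.
Qed.

End mixtures.

Section perturbed_model.
Context (R : realType).
Local Notation mu := (@lebesgue_measure R).
Local Notation RB := (measurableTypeR R).

Lemma perturbed_model (G : probability RB R) (q D D1 z wL wR p g0 h : R)
    (f g : density R) (m : R -> R) (B e : R) :
  is_base_law G q D D1 z wL wR p g0 -> 0 < p -> 0 < g0 -> 0 < z -> 0 <= B -> B + z < D ->
  z < D1 -> 0 <= h -> (forall y, - (D1 + z) <= y <= 2 * z -> m y = h) ->
  lip e m -> supp B m -> (forall x, 0 <= m x) -> 0 < \int[mu]_x m x < 1 ->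
  density_fun g = mix m f ->
  exists (U : probability RB R) (F : cdf_fun R),
    [/\ is_conv (cdf_law F) G U, is_conv (error_law g) (error_law f) U,
      has_density_on `[q - z, q + z] F (fun x => (1 - \int[mu]_x m x) * g0 +
        2 * z * g0 * h + p * h + p * m (x - q + D1)) &
      F q = base_value q D1 z wL p g0 m].
Proof.
move=> HG p0 g00 z0 B0 BD zD h0 mh lm sm m0 k01 gE.
have /andP[k0 k1] := k01.
have [mi _] := lip_supp_intble B0 lm sm.
have mm := lip_measurable lm.
have bm := lip_bsupp B0 lm sm.
have [U HU] := perturbation_law_exists mm m0 mi k01.
have [S HS] := conv_exists G U.
have [F HF] := cdf_exists S.
have FS : is_conv (cdf_law F) G U.
  move=> phi mphi phi0; rewrite -(HS phi mphi phi0).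
  by apply: eq_measure_integral => A mA _; exact: HF.
exists U, F; split.
- exact: FS.
- move=> phi mphi phi0.
  exact: (integral_mix mm m0 (ltW k1) (fun x => cv_intble f x bm) gE HU mphi phi0).
- exact: (perturbed_density HG p0 g00 z0 mm m0 k1 HU FS sm B0 BD zD h0 mh).
- have BD' : B < D by apply: lt_trans BD; rewrite ltrDl.
  exact: (perturbed_value HG mm m0 mi k1 HU FS sm B0 BD' (lt_trans z0 zD)).
Qed.

End perturbed_model.

Section shifted_bump.
Context (R : realType).
Local Notation mu := (@lebesgue_measure R).
Local Notation RB := (measurableTypeR R).
Variables (psi : R -> R) (Lp Bp Mp x0 z s eta : R).
Hypotheses (lpsi : lip Lp psi) (spsi : supp Bp psi) (bpsi : forall x, `|psi x| <= Mp)
  (ipsi : \int[mu]_x psi x = 0) (Bp0 : 0 <= Bp) (z0 : 0 < z) (s01 : 0 < s <= 1).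
(** The bump is centred at D1 - s x0, so that for every s the point x0 of psi lands exactly on D1
    and the primitive there is eta times that of psi at x0. [D1] is large enough to keep the bump to
    the right of 2 z for all s <= 1. *)
Let D1 := 2 * z + (Bp + `|x0|) + 1.
Let nu := rescale psi eta s (D1 - s * x0).

Let s0 : 0 < s. Proof. by case/andP: s01. Qed.
Let s1 : s <= 1. Proof. by case/andP: s01. Qed.

Lemma shift_le : `|D1 - s * x0| <= D1 + `|x0|.
Proof.
apply: le_trans (ler_normB _ _) _; apply: lerD.
  by rewrite ger0_norm// !addr_ge0// mulr_ge0// ltW.
by rewrite normrM (gtr0_norm s0) ler_piMl.
Qed.

Lemma supp_shifted : supp (D1 + (Bp + `|x0|)) nu.
Proof.
have h : supp (`|D1 - s * x0| + Bp) nu by exact: supp_rescale.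
move=> x hx; apply: h; apply: le_lt_trans hx.
by have := shift_le; lra.
Qed.

Lemma shifted_eq0 y : y <= 2 * z -> nu y = 0.
Proof.
move=> yz; rewrite /nu /rescale spsi ?mulr0//.
rewrite normrM (gtr0_norm (_ : 0 < s^-1)) ?invr_gt0//.
have h1 : s * x0 <= `|x0|.
  by apply: le_trans (ler_norm _) _; rewrite normrM (gtr0_norm s0) ler_piMl.
have h2 : Bp < `|y - (D1 - s * x0)|.
  apply: (@lt_le_trans _ _ (D1 - s * x0 - y)); first by rewrite /D1; lra.
  by rewrite distrC ler_norm.
by apply: lt_le_trans h2 _; rewrite ler_peMr// invf_ge1.
Qed.

Lemma shifted_le y : `|nu y| <= `|eta / s| * Mp.
Proof. by rewrite /nu /rescale normrM ler_wpM2l. Qed.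

Let Bn0 : 0 <= D1 + (Bp + `|x0|).
Proof. by rewrite /D1 !addr_ge0// mulr_ge0// ltW. Qed.

Let nui : intble nu.
Proof. by have [] := lip_supp_intble Bn0 (lip_rescale eta (D1 - s * x0) s0 lpsi) supp_shifted. Qed.

Lemma shifted_Rint0 : \int[mu]_y nu y = 0.
Proof.
have i1 : intble (fun y => cst 1 y * nu y).
  by apply: (eq_intble _ nui) => y; rewrite mul1r.
have := Rintegral_rescale (w := cst 1) s0 i1.
have -> : \int[mu]_x (cst 1 (s * x + (D1 - s * x0)) * psi x) = 0.
  by rewrite -ipsi; apply: eq_Rintegral => x _; rewrite mul1r.
by rewrite mulr0 => <-; apply: eq_Rintegral => x _; rewrite mul1r.
Qed.

Lemma shifted_Rint_below :
  \int[mu]_(y in `]-oo, D1]) nu y = eta * \int[mu]_(y in `]-oo, x0]) psi y.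
Proof.
pose w (y : R) : R := (y <= D1)%R%:R.
have wE (b : R) (h : R -> R) (y : R) : (h \_ `]-oo, b]) y = (y <= b)%R%:R * h y.
  by rewrite patchE mem_setE in_itv/=; case: (y <= b); rewrite ?mul1r ?mul0r.
have i1 : intble (fun y => w y * nu y).
  have mI : measurable (`]-oo, D1]%classic : set RB) by [].
  by apply: (eq_intble _ (intble_restrict mI nui)) => y; exact: wE.
rewrite [LHS]Rintegral_mkcond [in RHS]Rintegral_mkcond.
transitivity (\int[mu]_y (w y * nu y)); first by apply: eq_Rintegral => y _; exact: wE.
rewrite (Rintegral_rescale s0 i1); congr (_ * _); apply: eq_Rintegral => x _.
rewrite wE /w; congr (_%:R * _); congr nat_of_bool.
have -> : (s * x + (D1 - s * x0) <= D1) = (s * x <= s * x0) by apply/idP/idP; lra.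
by rewrite ler_pM2l.
Qed.

End shifted_bump.

Section regular_cdf.
Context (R : realType).
Local Notation mu := (@lebesgue_measure R).
Local Notation RB := (measurableTypeR R).

(** The Hoelder bound is asked on every compact interval, since the quantile class uses a window
    centred at the quantile, which the perturbation moves. *)
Definition regular_cdf (J : set R) (al K r : R) (F : cdf_fun R) := exists rho : R -> R,
  [/\ has_density_on J F rho, measurable_fun setT (rho : RB -> RB),
      forall x, J x -> r <= rho x <= K &
      forall a b, a < b -> holder_ball `[a, b] al K rho].

Lemma eq_has_density_on (J : set R) (F : cdf_fun R) (f g : R -> R) :
  (forall x, J x -> f x = g x) -> has_density_on J F f -> has_density_on J F g.
Proof.
move=> fg Ff A mA AJ; rewrite Ff//; apply: eq_integral => x /set_mem Ax.
by rewrite fg//; exact: AJ.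
Qed.

Lemma regular_bump (D : nat -> R -> R) (M al K r dlt c1 eta s c : R) (J : set R) (F : cdf_fun R) :
  (forall j x, (j < (strict_floor al).+1)%N -> is_derive x (1 : R) (D j) (D j.+1 x)) ->
  (forall j x, (j <= (strict_floor al).+1)%N -> `|D j x| <= M) ->
  0 < al -> 0 < r -> 0 < s <= 1 -> r + dlt <= c1 -> c1 <= K - dlt -> 0 <= dlt ->
  ((strict_floor al)%:R + 3) * M * (`|eta| * s^-1 `^ (al + 1)) <= dlt ->
  has_density_on J F (fun x => c1 + eta / s * D 0 ((x - c) / s)) ->
  regular_cdf J al K r F.
Proof.
move=> dD bD al0 r0 s01 c1r c1K dlt0 small dF.
have /andP[s0 s1] := s01.
have M0 : 0 <= M by exact: le_trans (normr_ge0 _) (bD 0%N 0 isT).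
have sb x : `|eta / s * D 0 ((x - c) / s)| <= dlt.
  apply: le_trans small; rewrite normrM.
  have p0 : 0 <= `|eta| * s^-1 `^ (al + 1) by rewrite mulr_ge0 ?powR_ge0.
  apply: (@le_trans _ _ (`|eta| * s^-1 `^ (al + 1) * M)).
    apply: ler_pM => //; last exact: bD.
    rewrite normrM ler_wpM2l// ger0_norm ?invr_ge0 ?(ltW s0)//.
    rewrite -[leLHS]powRr1 ?invr_ge0 ?(ltW s0)// ler_powR ?invf_ge1//.
    by rewrite lerDr ltW.
  rewrite mulrC ler_wpM2r// ler_peMl//.
  by have := ler0n R (strict_floor al); lra.
exists (fun x => c1 + eta / s * D 0 ((x - c) / s)); split => //.
- apply: continuous_measurable_fun => x.
  apply/differentiable_continuous/derivable1_diffP.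
  have h : is_derive x (1 : R) (fun x : R => (x - c) / s) s^-1.
    apply: (@is_derive_eq _ _ _ _ _ _ _ _
      (is_deriveM (is_deriveB (is_derive_id x 1) (is_derive_cst c x 1)) (is_derive_cst s^-1 x 1))).
    by rewrite scaler0 add0r subr0 /GRing.scale/= mulr1.
  have h' := @is_derive1_comp _ (D 0%N) (fun x => (x - c) / s) x _ _ (dD 0%N _ isT) h.
  by have [] := is_deriveD (is_derive_cst c1 x 1) (is_deriveM (is_derive_cst (eta / s) x 1) h').
- move=> x _; have := sb x; rewrite ler_norml => /andP[h1 h2].
  by apply/andP; split; lra.
- move=> a b ab.
  have c10 : 0 <= c1 by lra.
  have [h1 h2 h3 h4] := holder_bump dD bD eta c al0 (ltnSn _) c10 s01 ab.
  split => //; apply: le_trans h4 _; rewrite lee_fin; lra.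
Qed.

End regular_cdf.

Section perturbation.
Context (R : realType).
Local Notation mu := (@lebesgue_measure R).
Local Notation RB := (measurableTypeR R).

Lemma trapezoid_cost (k M th u : R) : 0 <= k -> 0 <= M ->
  `|cost (trapezoid k M) th u| <= 32 * (M + 2) ^+ 2 * (3 * (M + 1) + 1) * k / (1 + `|u|) /\
  `|cost (fun y => y * trapezoid k M y) th u| <=
    32 * (M + 2) ^+ 2 * (3 * (M + 1) + 1) * k / (1 + `|u|).
Proof.
move=> k0 M0; have M1 : 0 <= M + 1 by rewrite addr_ge0.
have lm := trapezoid_lip M k0; have sm := @trapezoid_supp _ k M.
have u1 : 0 <= (1 + `|u|)^-1 by rewrite invr_ge0 addr_ge0.
have e : M + 1 + 1 = M + 2 by ring.
have P : 0 <= 32 * (M + 2) ^+ 2 by rewrite mulr_ge0// sqr_ge0.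
split.
  apply: le_trans (cost_lip th u M1 lm sm) _; rewrite e ler_wpM2r// ler_wpM2r//.
  by rewrite ler_peMr//; move: M0; lra.
apply: le_trans (cost_lip th u M1 (lip_mulx M1 lm sm) (supp_mulx sm)) _.
by rewrite e ler_wpM2r// [k * _]mulrC mulrA.
Qed.

Variables (tau q z al b K r gamma : R) (f : density R) (L rho : R).
Variables (psi : R -> R) (Lp Bp Mp x0 : R) (D : nat -> R -> R).
Variables (G : probability RB R) (wL wR p g0 kap eps dlt Cn : R).
Let D1 := 2 * z + (Bp + `|x0|) + 1.
Let Bn := D1 + (Bp + `|x0|).
(** M exceeds Bn + 2 L, for the lower bound on the mixed density around the perturbation, and D1 +
    z, for the flatness that [perturbed_density] requires. *)
Let M := Bn + 2 * L + z + 1.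
Let B := M + 1.
Let m0 := trapezoid kap M.
Let k0 := \int[mu]_x m0 x.
Hypotheses (z0 : 0 < z) (al0 : 0 < al) (r0 : 0 < r) (L0 : 0 < L) (Bp0 : 0 < Bp)
  (p0 : 0 < p) (g00 : 0 < g0) (kap0 : 0 < kap) (Cn0 : 0 < Cn) (dlt0 : 0 < dlt).
Hypotheses (lpsi : lip Lp psi) (spsi : supp Bp psi) (ipsi : \int[mu]_x psi x = 0)
  (Dpsi : D 0%N = psi)
  (dD : forall j x, (j < (strict_floor al).+1)%N -> is_derive x (1 : R) (D j) (D j.+1 x))
  (bD : forall j x, (j <= (strict_floor al).+1)%N -> `|D j x| <= Mp).
Hypotheses (HG : is_base_law G q (B + z + 1) D1 z wL wR p g0) (wE : wL + p + g0 * z = tau).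
Hypothesis Hrho : forall (m : R -> R) (e : R), lip e m -> supp B m -> (forall x, 0 <= m x) ->
  (forall th u, `|cost m th u| <= rho / (1 + `|u|)) ->
  (forall th u, `|cost (fun y => y * m y) th u| <= rho / (1 + `|u|)) ->
  \int[mu]_y m y < 1 /\
  (exists g : density R, density_fun g = mix m f /\ error_class b K gamma g).
Hypothesis HCn : forall eta s D, 0 < s <= 1 -> `|D| <= D1 + `|x0| -> forall th u,
  `|cost (rescale psi eta s D) th u| <= Cn * `|eta / s| / (1 + `|u|) /\
  `|cost (fun y => y * rescale psi eta s D y) th u| <= Cn * `|eta / s| / (1 + `|u|).
Hypotheses (Hkap : 32 * (M + 2) ^+ 2 * (3 * (M + 1) + 1) * kap <= rho / 2)
  (Cneps : Cn * eps <= rho / 2) (Mpeps : Mp * eps <= kap)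
  (c1r : r + dlt <= (1 - k0) * g0 + 2 * z * g0 * kap + p * kap + p * kap)
  (c1K : (1 - k0) * g0 + 2 * z * g0 * kap + p * kap + p * kap <= K - dlt)
  (Hdlt : ((strict_floor al)%:R + 3) * Mp * (p * eps) <= dlt).

Let D10 : 0 < D1. Proof. by rewrite /D1 ltr_wpDl// addr_ge0 ?addr_ge0 ?mulr_ge0// ltW. Qed.

Let Bx0 : 0 < Bp + `|x0|. Proof. by rewrite ltr_pwDl. Qed.

Let M0 : 0 < M. 
Proof.
have := D10; have := Bx0; have := L0; have := z0; rewrite /M /Bn.
by move: (D1) (Bp + _) => a b'; lra.
Qed.

Let MB : Bn + 2 * L <= M.
Proof. by have := z0; rewrite /M; move: (Bn) => a; lra. Qed.

Let MBn : Bn <= M.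
Proof. by apply: le_trans MB; have := L0; move: (Bn) => a; lra. Qed.

Let D1M : D1 + z <= M.
Proof. by have := Bx0; have := L0; rewrite /M /Bn; move: (D1) (Bp + _) => a b'; lra. Qed.

Let flat x : - (D1 + z) <= x <= D1 + z -> m0 x = kap.
Proof.
by move=> h; apply: trapezoid_flat; apply: le_trans D1M; rewrite ler_norml.
Qed.

(** Both hypotheses are instances: eta = 0 gives F_0, and the sign of eta is left free so that F_1
    (q) can be placed above tau. *)
Lemma perturbation_exists eta s : 0 < s <= 1 -> `|eta| * s^-1 `^ (al + 1) <= eps ->
  exists (U : probability RB R) (F : cdf_fun R) (g : density R),
  [/\ is_conv (cdf_law F) G U, is_conv (error_law g) (error_law f) U,
      error_class b K gamma g &
      density_fun g = mix (fun y => m0 y + rescale psi eta s (D1 - s * x0) y) f] /\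
  F q = tau + p * (eta * \int[mu]_(y in `]-oo, x0]) psi y) /\
  regular_cdf `[q - z, q + z] al K r F.
Proof.
move=> s01 small; have /andP[s0 s1] := s01.
set n := rescale psi eta s (D1 - s * x0).
have bpsi x : `|psi x| <= Mp by rewrite -Dpsi; exact: bD.
have Mp0 : 0 <= Mp by exact: le_trans (normr_ge0 _) (bpsi 0).
have Bp0' := ltW Bp0.
have etas : `|eta / s| <= eps.
  apply: le_trans small; rewrite normrM ler_wpM2l// ger0_norm ?invr_ge0 ?(ltW s0)//.
  rewrite -[leLHS]powRr1 ?invr_ge0 ?(ltW s0)// ler_powR ?invf_ge1//.
  by rewrite lerDr ltW.
have sn : supp Bn n := @supp_shifted R psi Bp x0 z s eta spsi Bp0' z0 s01.
have nE0 y : y <= 2 * z -> n y = 0 := @shifted_eq0 R psi Bp x0 z s eta spsi s01 y.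
have nle y : `|n y| <= kap.
  apply: le_trans (@shifted_le R psi Bp Mp x0 z s eta bpsi y) _.
  by apply: le_trans Mpeps; rewrite mulrC ler_wpM2l.
have n0 : \int[mu]_y n y = 0 := @shifted_Rint0 R psi Lp Bp x0 z s eta lpsi spsi ipsi Bp0' z0 s01.
have nP : \int[mu]_(y in `]-oo, D1]) n y = eta * \int[mu]_(y in `]-oo, x0]) psi y :=
  @shifted_Rint_below R psi Lp Bp x0 z s eta lpsi spsi Bp0' z0 s01.
have ln : lip (`|eta / s| * (Lp / s)) n := lip_rescale eta _ s0 lpsi.
have lm0 : lip kap m0 := trapezoid_lip M (ltW kap0).
have sm0 : supp B m0 := @trapezoid_supp _ kap M.
have B0 : 0 <= B by rewrite addr_ge0// ltW.
have Bn0 : 0 <= Bn by rewrite addr_ge0// ltW.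
have [m0i xm0i] := lip_supp_intble B0 lm0 sm0.
have [ni _] := lip_supp_intble Bn0 ln sn.
have [xm0i' _] := lip_supp_intble B0 (lip_mulx B0 lm0 sm0) (supp_mulx sm0).
have [xni _] := lip_supp_intble Bn0 (lip_mulx Bn0 ln sn) (supp_mulx sn).
set e := `|eta / s| * (Lp / s) in ln.
pose m y := m0 y + n y.
have lm : lip (kap + e) m.
  move=> x y; rewrite /m opprD addrACA mulrDl.
  exact: le_trans (ler_normD _ _) (lerD (lm0 x y) (ln x y)).
have BnB : Bn <= B by apply: le_trans MBn _; rewrite lerDl.
have sm : supp B m.
  by move=> x hx; rewrite /m sm0// sn ?addr0//; exact: le_lt_trans hx.
(* The bump lives where the trapezoid has its full height, which dominates it. *)
have m_ge0 x : 0 <= m x.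
  rewrite /m; have [xM|xM] := lerP `|x| M.
    rewrite /m0 trapezoid_flat//; have := nle x; rewrite ler_norml => /andP[h _].
    by rewrite -lerBlDl sub0r.
  by rewrite sn ?addr0 ?trapezoid_ge0 ?(ltW kap0)//; exact: le_lt_trans xM.
have mI : \int[mu]_x m x = k0 by rewrite (RintD m0i ni) n0 addr0.
have bound X Y u : `|X| <= 32 * (M + 2) ^+ 2 * (3 * (M + 1) + 1) * kap / (1 + `|u|) ->
    `|Y| <= Cn * `|eta / s| / (1 + `|u|) -> `|X + Y| <= rho / (1 + `|u|).
  move=> hX hY; apply: le_trans (ler_normD _ _) _.
  have u1 : 0 <= (1 + `|u|)^-1 by rewrite invr_ge0 addr_ge0.
  have -> : rho / (1 + `|u|) = rho / 2 / (1 + `|u|) + rho / 2 / (1 + `|u|).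
    by rewrite -mulrDl -splitr.
  apply: lerD; [apply: le_trans hX _|apply: le_trans hY _]; rewrite ler_wpM2r//.
  by apply: le_trans Cneps; rewrite ler_wpM2l// ltW.
have sD : `|D1 - s * x0| <= D1 + `|x0| := @shift_le R Bp x0 z s Bp0' z0 s01.
have a1 th u : `|cost m th u| <= rho / (1 + `|u|).
  rewrite (costD _ _ m0i ni); apply: bound.
    by have [] := trapezoid_cost th u (ltW kap0) (ltW M0).
  by have [] := HCn eta s01 sD th u.
have a2 th u : `|cost (fun y => y * m y) th u| <= rho / (1 + `|u|).
  have -> : (fun y => y * m y) = (fun y => y * m0 y + y * n y).
    by apply/funext => y; exact: mulrDr.
  rewrite (costD _ _ xm0i' xni); apply: bound.
    by have [] := trapezoid_cost th u (ltW kap0) (ltW M0).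
  by have [] := HCn eta s01 sD th u.
have [k1 [g [gE gC]]] := Hrho lm sm m_ge0 a1 a2.
have k01 : 0 < \int[mu]_x m x < 1.
  by rewrite k1 mI andbT; exact: trapezoid_Rintegral_gt0.
have BD : B + z < B + z + 1 by rewrite ltrDl.
have zD1 : z < D1.
  rewrite /D1 ltr_wpDr// (lt_le_trans (_ : z < 2 * z))//.
    by rewrite mulrDl mul1r ltrDl.
  by rewrite lerDl ltW.
have mflat y : - (D1 + z) <= y <= 2 * z -> m y = kap.
  move=> /andP[y1 y2]; rewrite /m nE0// addr0 flat// y1/=; apply: le_trans y2 _.
  by move: zD1; lra.
have [U [F [FU gU dF FE]]] := perturbed_model HG p0 g00 z0 B0 BD zD1 (ltW kap0) mflat lm sm m_ge0 k01 gE.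
exists U, F, g; split => //; split.
  rewrite FE; have kE : k0 < 1 by rewrite -mI.
  rewrite (base_value_add q wL p g0 z0 zD1 m0i ni n0); last first.
    by move=> y yz; apply: nE0; apply: le_trans yz _; move: z0; lra.
  rewrite (base_value_even q D1 wL p g0 z0 m0i) ?wE ?nP//.
  - by move=> y; exact: trapezoid_ge0 (ltW kap0) _.
  - by move=> y; exact: trapezoid_even.
apply: (@regular_bump _ D Mp al K r dlt _ (p * eta) s (q - s * x0) _ F dD bD al0 r0 s01 c1r c1K (ltW dlt0)).
  apply: le_trans Hdlt; apply: ler_wpM2l; first by rewrite mulr_ge0// addr_ge0.
  by rewrite normrM (gtr0_norm p0) -mulrA; apply: ler_wpM2l => //; exact: ltW.
apply: eq_has_density_on dF => x; rewrite /= in_itv/= => /andP[x1 x2].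
rewrite mI /m flat; last by apply/andP; split; move: x1 x2 D10; lra.
rewrite /n /rescale Dpsi.
have -> : x - q + D1 - (D1 - s * x0) = x - (q - s * x0) by ring.
ring.
Qed.

End perturbation.

Section hypotheses.
Context (R : realType).
Local Notation mu := (@lebesgue_measure R).
Local Notation RB := (measurableTypeR R).

Lemma small_exists (A1 A2 A3 t1 t2 t3 : R) : 0 < A1 -> 0 < A2 -> 0 < A3 ->
  0 < t1 -> 0 < t2 -> 0 < t3 ->
  exists2 k : R, 0 < k & [/\ A1 * k <= t1, A2 * k <= t2 & A3 * k <= t3].
Proof.
move=> A10 A20 A30 t10 t20 t30.
exists (Num.min (t1 / A1) (Num.min (t2 / A2) (t3 / A3))).
  by rewrite !lt_min !divr_gt0.
split; rewrite mulrC -ler_pdivlMr//; first by rewrite ge_min lexx.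
  by rewrite !ge_min lexx !orbT.
by rewrite !ge_min lexx !orbT.
Qed.

(** All constants are fixed before eta and s. The height [kap] comes after the widths, on which the
    transform bounds depend, and [eps] after [kap], so that the bump stays below the trapezoid. *)
Lemma hypotheses_exist (tau q z al b K r gamma : R) :
  0 < al -> 0 < b -> 0 < r -> r < K -> 0 <= gamma -> 0 < z ->
  r * z < Num.min tau (1 - tau) ->
  (exists2 K' : R, 0 < K' < K & error_class b K' gamma !=set0) ->
  exists d0 c0 eps : R, [/\ 0 < d0, 0 < c0 & 0 < eps] /\
  forall eta s, 0 <= eta -> 0 < s <= 1 -> eta * s^-1 `^ (al + 1) <= eps ->
  exists (F0 F1 : cdf_fun R) (g0 g1 : density R),
  [/\ error_class b K gamma g0, error_class b K gamma g1, F0 q = tau & F1 q = tau + d0 * eta] /\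
  (regular_cdf `[q - z, q + z] al K r F0 /\ regular_cdf `[q - z, q + z] al K r F1) /\
  forall n m,
    chi2_map (@observations R n m) ((1 + c0 * eta ^+ 2 * s `^ (2 * b - 1)) ^+ n)
      (model_prob n m F0 g0) (model_prob n m F1 g0) /\
    chi2_map (@observations R n m) ((1 + c0 * eta ^+ 2 * s `^ (2 * b - 1)) ^+ m)
      (model_prob n m F1 g0) (model_prob n m F0 g1).
Proof.
move=> al0 b0 r0 rK gam0 z0 rz [K' /andP[K'0 K'K] [f0 f0C]].
(* The slack between K' and K is shared: truncation spends the part up to K1, mixing the rest. *)
pose K1 := (K' + K) / 2.
have K'K1 : K' < K1 by rewrite /K1; lra.
have K1K : K1 < K by rewrite /K1; lra.
have K10 : 0 < K1 := lt_trans K'0 K'K1.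
have [f [L [L0 sf fC fM]]] := reference_density (ltW b0) K'0 K'K1 f0C.
(* Then 2 N is at least b, as [sin_weight] requires. *)
pose N := (Num.bound b).+1.
have bN : 0 <= b <= N.*2%:R.
  rewrite (ltW b0)/=; apply: le_trans (ltW (archi_boundP (ltW b0))) _.
  by rewrite ler_nat -addnn (leq_trans (leqnSn _))// leq_addr.
have [psi [k [D [c [Lp [Bp [Mp [[c0 Lp0 Bp0 Mp0] [[lpsi spsi ipsi [x0 Px0]] [[ki hk kh kb] [D0 dD bD]]]]]]]]]]] :=
  bump_exists R (strict_floor al).+1 (ltn0Sn (Num.bound b)).
have [CE CE0 HE] := energy_bound K1 L (ltn0Sn (Num.bound b)) bN c0 (ltW Bp0) lpsi spsi ki hk kh kb.
pose D1 := 2 * z + (Bp + `|x0|) + 1.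
pose Bn := D1 + (Bp + `|x0|).
pose M := Bn + 2 * L + z + 1.
have D10 : 0 < D1 by rewrite /D1 ltr_wpDl// addr_ge0 ?addr_ge0 ?mulr_ge0// ltW.
have Bn0 : 0 < Bn by rewrite ltr_wpDr// addr_ge0// ltW.
have M0 : 0 < M by rewrite /M ltr_wpDl// addr_ge0 ?addr_ge0 ?mulr_ge0// ltW.
have B0 : 0 <= M + 1 by rewrite addr_ge0// ltW.
have [rho rho0 Hrho] := error_class_mix K10 K1K B0 gam0 L0 sf fC fM.
have Dm0 : 0 <= D1 + `|x0| by rewrite addr_ge0// ltW.
have [Cn Cn0 HCn] := cost_rescale (ltW Bp0) Dm0 lpsi spsi.
have mn0 : 0 < Num.min tau (1 - tau) by apply: lt_trans rz; rewrite mulr_gt0.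
(* A level g0 below K2 is less than K, and the mass g0 z of the uniform part on each side of q is
   less than tau and 1 - tau. *)
pose K2 := Num.min K (Num.min tau (1 - tau) / z).
have rK2 : r < K2 by rewrite lt_min rK ltr_pdivlMr.
have [K2K K2z] : K2 <= K /\ K2 * z <= Num.min tau (1 - tau).
  by split; [rewrite ge_min lexx|rewrite -ler_pdivlMr// ge_min lexx orbT].
have [g0 [rg0 g0K2]] : exists g0, r < g0 /\ g0 < K2.
  by exists ((r + K2) / 2); split; [rewrite ltr_pdivlMr//|rewrite ltr_pdivrMr//];
    rewrite mulrDr mulr1 ?ltrD2l ?ltrD2r.
have g00 : 0 < g0 := lt_trans r0 rg0.
have g0K : g0 < K := lt_le_trans g0K2 K2K.
have g0z : g0 * z < Num.min tau (1 - tau) by apply: lt_le_trans K2z; rewrite ltr_pM2r.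
have [g0z1 g0z2] : g0 * z < tau /\ g0 * z < 1 - tau by move: g0z; rewrite lt_min => /andP[].
have [G [wL [wR [p [wL0 wR0 p0 wE HG]]]]] := base_law_exists q (M + 1 + z + 1) D1 z0 g00 g0z1 g0z2.
have p1 : p <= 1.
  have : 0 < g0 * z by rewrite mulr_gt0.
  by move: wL0 wE g0z2; move: (g0 * z) => a; clear; lra.
(* One half of the room around g0 absorbs the constant contributions of the trapezoid, the other
   half the bump. *)
pose dlt := Num.min (g0 - r) (K - g0) / 2.
have dlt0 : 0 < dlt by rewrite divr_gt0// lt_min !subr_gt0 rg0.
have [dr dK] : 2 * dlt <= g0 - r /\ 2 * dlt <= K - g0.
  by rewrite /dlt [2 * _]mulrC divfK// !ge_min !lexx orbT.
pose CT := 32 * (M + 2) ^+ 2 * (3 * (M + 1) + 1).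
have M2 : 0 < M + 2 by rewrite addr_gt0.
have CT0 : 0 < CT.
  by rewrite mulr_gt0 ?mulr_gt0 ?exprn_gt0// ltr_wpDl// mulr_ge0.
have zg : 0 < 2 * z * g0 + 2 by rewrite ltr_wpDl// !mulr_ge0// ltW.
have [kap kap0 [Hkap Hkap2 Hkap3]] := small_exists CT0 (mulr_gt0 CT0 g00) zg
  (divr_gt0 rho0 (ltr0Sn R 1)) dlt0 dlt0.
pose k0 := \int[mu]_x trapezoid kap M x.
have [k00 k0C] : 0 <= k0 /\ k0 <= CT * kap.
  split; first exact: ltW (trapezoid_Rintegral_gt0 kap0 M0).
  have [h _] := trapezoid_cost 0 0 (ltW kap0) (ltW M0).
  by move: h; rewrite cost_cost0 normr0 addr0 divr1; exact: le_trans (ler_norm _).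
have [c1r c1K] : r + dlt <= (1 - k0) * g0 + 2 * z * g0 * kap + p * kap + p * kap /\
    (1 - k0) * g0 + 2 * z * g0 * kap + p * kap + p * kap <= K - dlt.
  have h1 : k0 * g0 <= dlt.
    by apply: le_trans Hkap2; rewrite mulrAC ler_wpM2r// ltW.
  have h2 : 0 <= k0 * g0 by rewrite mulr_ge0// ltW.
  have h3 : 0 <= 2 * z * g0 * kap by rewrite !mulr_ge0// ltW.
  have h4 : 0 <= p * kap by rewrite mulr_ge0// ltW.
  have h5 : p * kap <= kap by rewrite ler_piMl// ltW.
  move: h1 h2 h3 h4 h5 Hkap3 dr dK dlt0; rewrite mulrDl mulrBl mul1r.
  move: (k0 * g0) (2 * z * g0 * kap) (p * kap) => a a' a''; clear; lra.
pose J3 : R := (strict_floor al)%:R + 3.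
have J30 : 0 < J3 by rewrite ltr_wpDl.
have [eps eps0 [He1 He2 He3]] := small_exists Cn0 Mp0 (mulr_gt0 (mulr_gt0 J30 Mp0) p0)
  (divr_gt0 rho0 (ltr0Sn R 1)) kap0 dlt0.
have He3' : J3 * Mp * (p * eps) <= dlt by rewrite mulrA.
pose Psi := \int[mu]_(y in `]-oo, x0]) psi y.
have Psi0 : 0 < `|Psi| by rewrite normr_gt0.
exists (p * `|Psi|), (kap^-1 * CE), eps; split.
  by rewrite eps0 !mulr_gt0// invr_gt0.
move=> eta s eta0 s01 small; have /andP[s0 s1] := s01.
have PE := @perturbation_exists R tau q z al b K r gamma f L rho psi Lp Bp Mp x0 D G wL wR p g0
  kap eps dlt Cn z0 al0 r0 L0 Bp0 p0 g00 kap0 Cn0 dlt0 lpsi spsi ipsi D0 dD bD HG wE Hrho HCn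
  Hkap He1 He2 c1r c1K He3'.
(* Multiplying eta by the sign of the primitive of psi makes the shift of F_1 (q) nonnegative. *)
have sgn : Num.sg Psi != 0 by rewrite sgr_eq0 -normr_gt0.
have small1 : `|Num.sg Psi * eta| * s^-1 `^ (al + 1) <= eps.
  by rewrite normrM normr_sg -sgr_eq0 sgn mul1r (ger0_norm eta0).
have small0 : `|0 : R| * s^-1 `^ (al + 1) <= eps by rewrite normr0 mul0r ltW.
have [U0 [F0 [h0 [[F0U h0U h0C h0E] [F0q F0r]]]]] := PE 0 s s01 small0.
have [U1 [F1 [h1 [[F1U h1U h1C h1E] [F1q F1r]]]]] := PE _ s s01 small1.
have h0E' : density_fun h0 = mix (trapezoid kap M) f.
  rewrite h0E; congr (mix _ f); apply/funext => y.
  by rewrite /rescale !mul0r addr0.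
set n := rescale psi (Num.sg Psi * eta) s (D1 - s * x0) in h1E.
have sn : supp Bn n := @supp_shifted R psi Bp x0 z s _ spsi (ltW Bp0) z0 s01.
have n0 : \int[mu]_y n y = 0 := @shifted_Rint0 R psi Lp Bp x0 z s _ lpsi spsi ipsi (ltW Bp0) z0 s01.
have ln := lip_rescale (Num.sg Psi * eta) (D1 - s * x0) s0 lpsi; rewrite -/n in ln.
have E : \int[mu]_x (cv n f x) ^+ 2 <= CE * eta ^+ 2 * s `^ (2 * b - 1).
  apply: le_trans (HE f fC sf _ s _ s01) _.
  by rewrite exprMn sqr_sg -sgr_eq0 sgn mul1r.
pose c' := 1 + kap^-1 * CE * eta ^+ 2 * s `^ (2 * b - 1).
have c'0 : 0 <= c'.
  by rewrite addr_ge0// !mulr_ge0 ?powR_ge0 ?sqr_ge0 ?invr_ge0// ltW.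
have c'E : 1 + kap^-1 * \int[mu]_x (cv n f x) ^+ 2 <= c'.
  rewrite lerD2l (_ : _ * _ * _ * _ = kap^-1 * (CE * eta ^+ 2 * s `^ (2 * b - 1))); last by rewrite !mulrA.
  by apply: ler_wpM2l E; rewrite invr_ge0 ltW.
have tc (u : R) : CT * kap / (1 + `|u|) <= rho / (1 + `|u|).
  rewrite ler_wpM2r ?invr_ge0 ?addr_ge0//; apply: le_trans Hkap _.
  by move: rho0; clear; lra.
have k01 : k0 <= 1.
  have a1 (th u : R) : `|cost (trapezoid kap M) th u| <= rho / (1 + `|u|).
    by apply: le_trans (tc u); have [] := trapezoid_cost th u (ltW kap0) (ltW M0).
  have a2 (th u : R) : `|cost (fun y => y * trapezoid kap M y) th u| <= rho / (1 + `|u|).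
    by apply: le_trans (tc u); have [] := trapezoid_cost th u (ltW kap0) (ltW M0).
  have [h _] := Hrho _ _ (trapezoid_lip M (ltW kap0)) (@trapezoid_supp R kap M)
    (trapezoid_ge0 M (ltW kap0)) a1 a2.
  exact: ltW.
have BnM : Bn + 2 * L <= M by move: z0; rewrite /M; move: (Bn) => a; clear; lra.
have chi := chi2_mix kap0 L0 B0 (ltW Bn0) sf (trapezoid_lip M (ltW kap0)) (@trapezoid_supp R kap M)
  ln sn n0 (@trapezoid_flat R kap M) k01 BnM h0E' h1E c'E.
exists F0, F1, h0, h1; split; [|split].
- split => //; first by rewrite F0q mul0r mulr0 addr0.
  rewrite F1q -/Psi; congr (_ + _); rewrite -mulrA; congr (_ * _).
  by rewrite [`|Psi|]normrEsg mulrAC.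
- by split.
- move=> N1 N2; split.
    exact: (chi2_model_n F0U F1U h0U h1U c'0 chi).
  exact: (chi2_model_m F0U F1U h0U h1U c'0 chi).
Qed.

End hypotheses.

(** * Rates *)

Section lower_bounds.
Context (R : realType).
Local Notation mu := (@lebesgue_measure R).
Local Notation RB := (measurableTypeR R).

Lemma powR_small (rho A t : R) : 0 < rho -> 0 < A -> 0 < t ->
  exists N0 : nat, forall N, (N0 <= N)%N -> A * N%:R `^ (- rho) <= t.
Proof.
move=> rho0 A0 t0; pose u := (A / t) `^ rho^-1.
have u0 : 0 <= u by exact: powR_ge0.
exists (Num.bound u) => N hN.
have uN : u <= N%:R by apply: le_trans (ltW (archi_boundP u0)) _; rewrite ler_nat.
have At : 0 < A / t by rewrite divr_gt0.
have h : A / t <= N%:R `^ rho.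
  have -> : A / t = u `^ rho by rewrite /u -powRrM mulVf ?gt_eqF// powRr1// ltW.
  by apply: ge0_ler_powR; rewrite ?nnegrE// ltW.
have P0 : 0 < N%:R `^ rho := lt_le_trans At h.
rewrite powRN ler_pdivrMr// mulrC -ler_pdivrMr//.
Qed.

(** For 2 b > 1, s saturates the Hoelder constraint, so eta ^ 2 s ^ (2 b - 1) is of order eta ^ (2 +
    x); the rate exponent equals 1 / (2 + x), which makes this of order 1 / N. For 2 b <= 1 a
    smaller s would not reduce the energy, so s = 1 and x = 0. *)
Lemma scale_exists (al b A eps c0 : R) : 0 < al -> 0 < b -> 0 < A -> 0 < eps -> 0 < c0 ->
  exists2 c1 : R, 0 < c1 & forall N : nat, (0 < N)%N ->
    let eta := A * N%:R `^ (- ((al + 1) / (2 * al + Num.max (2 * b) 1 + 1))) in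
    eta <= eps ->
    exists s, [/\ 0 < s <= 1, eta * s^-1 `^ (al + 1) <= eps &
      c0 * eta ^+ 2 * s `^ (2 * b - 1) <= c1 / N%:R].
Proof.
move=> al0 b0 A0 eps0 c00.
have al1 : 0 < al + 1 by rewrite addr_gt0.
have al1n : al + 1 != 0 by rewrite gt_eqF.
pose x := Num.max (2 * b - 1) 0 / (al + 1).
pose E := 2 * al + Num.max (2 * b) 1 + 1.
have E0 : 0 < E by rewrite /E ltr_wpDl// addr_ge0 ?mulr_ge0 ?(ltW al0)// le_max ler01 orbT.
have xE : (al + 1) / E * (2 + x) = 1.
  have -> : 2 + x = E / (al + 1).
    rewrite /x /E; have [h|h] := lerP (2 * b - 1) 0.
      rewrite (max_r (_ : 2 * b <= 1)); last by rewrite -subr_le0.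
      by field.
    rewrite (max_l (_ : 1 <= 2 * b)); last by rewrite -subr_ge0 ltW.
    by field.
  by rewrite mulrA divfK ?gt_eqF// divff.
pose c1 := c0 * (A `^ (2 + x) * eps^-1 `^ x).
exists c1; first by rewrite !mulr_gt0 ?powR_gt0 ?invr_gt0.
move=> N N0; rewrite -/E => eta etaeps.
have N0' : 0 < N%:R :> R by rewrite ltr0n.
have eta0 : 0 < eta by rewrite mulr_gt0// powR_gt0.
have key : c0 * eta ^+ 2 * (eta / eps) `^ x <= c1 / N%:R.
  rewrite -powR_mulrn ?(ltW eta0)// powRM ?invr_ge0 ?(ltW eta0) ?(ltW eps0)//.
  rewrite -mulrA [_ `^ 2%:R * _]mulrA -powRD; last by rewrite (gt_eqF eta0) implybT.
  rewrite {1}/eta powRM ?powR_ge0 ?(ltW A0)// -powRrM mulNr xE.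
  rewrite powR_inv1 ?(ltW N0')// /c1 le_eqVlt; apply/orP; left; apply/eqP; ring.
have [h|h] := lerP (2 * b - 1) 0.
- exists 1; split; first by rewrite ltr01 lexx.
    by rewrite invr1 powR1 mulr1.
  rewrite powR1; move: key; rewrite /x (max_r h) mul0r powRr0; exact.
- pose s := (eta / eps) `^ (al + 1)^-1.
  have ee : 0 < eta / eps by rewrite divr_gt0.
  have s0 : 0 < s by exact: powR_gt0.
  exists s; split.
  + rewrite s0 -(powRr0 (eta / eps)) /s ger_powR ?invr_ge0 ?(ltW al1)//.
    by rewrite ee ler_pdivrMr// mul1r.
  + have -> : s^-1 `^ (al + 1) = (eta / eps)^-1.
      rewrite -powR_inv1 ?(ltW s0)// /s -!powRrM -[RHS]powR_inv1 ?(ltW ee)//.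
      by congr (_ `^ _); field.
    by rewrite invf_div mulrC divfK// gt_eqF.
  + have -> : s `^ (2 * b - 1) = (eta / eps) `^ x; last exact: key.
    by rewrite /s -powRrM /x (max_l (ltW h)) [(al + 1)^-1 * _]mulrC.
Qed.

(** A divergence of order 1 / N per observation stays bounded over N independent observations. *)
Lemma exprn_le_expR (c x : R) (N : nat) : 0 <= c -> (0 < N)%N -> x <= c / N%:R -> 0 <= x ->
  (1 + x) ^+ N <= expR c.
Proof.
move=> c0 N0 xc x0.
have -> : expR c = expR (c / N%:R) ^+ N.
  by rewrite -expRM_natr divfK// pnatr_eq0 -lt0n.
apply: lerXn2r; rewrite ?nnegrE ?addr_ge0 ?expR_ge0//.
by apply: le_trans (expR_ge1Dx _); rewrite lerD2l.
Qed.

(** The class and the parameter are left general, to serve both the value at q and the quantile. The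
    bound of the shift by [t] keeps the quantile window inside the interval in the second use. *)
Lemma rate_hypotheses (tau q z al b K r gamma A t : R) :
  0 < al -> 0 < b -> 0 < r -> r < K -> 0 <= gamma -> 0 < z ->
  r * z < Num.min tau (1 - tau) ->
  (exists2 K' : R, 0 < K' < K & error_class b K' gamma !=set0) ->
  0 < A -> 0 < t ->
  exists2 delta : R, 0 < delta & exists N0 : nat, forall n m, (N0 <= minn n m)%N ->
  let d := A * (minn n m)%:R `^ (- ((al + 1) / (2 * al + Num.max (2 * b) 1 + 1))) in
  [/\ 0 < (minn n m)%:R `^ (- ((al + 1) / (2 * al + Num.max (2 * b) 1 + 1))) & d <= t] /\
  exists F0 F1 : cdf_fun R,
  [/\ F0 q = tau, F1 q = tau + d, regular_cdf `[q - z, q + z] al K r F0 &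
      regular_cdf `[q - z, q + z] al K r F1] /\
  forall (C : set (cdf_fun R)) (theta : cdf_fun R -> R) (s : R),
    C F0 -> C F1 -> 2 * s < `|theta F0 - theta F1| ->
    (delta%:E <= minimax_deviation n m C (error_class b K gamma) theta s)%E.
Proof.
move=> al0 b0 r0 rK gam0 z0 rz HK A0 t0.
have [d0 [c0 [eps [[d00 c00 eps0] H]]]] := hypotheses_exist q al0 b0 r0 rK gam0 z0 rz HK.
have Ad0 : 0 < A / d0 by rewrite divr_gt0.
have [c1 c10 Hs] := scale_exists al0 b0 Ad0 eps0 c00.
pose rho := (al + 1) / (2 * al + Num.max (2 * b) 1 + 1).
have rho0 : 0 < rho.
  apply: divr_gt0; first exact: addr_gt0.
  by rewrite ltr_wpDl// addr_ge0 ?mulr_ge0 ?(ltW al0)// le_max ler01 orbT.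
have [N1 HN1] := powR_small rho0 Ad0 eps0.
have [N2 HN2] := powR_small rho0 A0 t0.
have ec0 : 0 < 4 * expR c1 by rewrite mulr_gt0// expR_gt0.
exists ((4 * expR c1)^-1); first by rewrite invr_gt0.
exists (maxn 1 (maxn N1 N2)) => n m; rewrite !geq_max => /andP[N0 /andP[hN1 hN2]].
rewrite -/rho in Hs *; set N := minn n m in N0 hN1 hN2 *.
have etaeps := HN1 _ hN1.
have [s [s01 small csmall]] := Hs N N0 etaeps.
have Nr0 : 0 < N%:R `^ (- rho) :> R by rewrite powR_gt0// ltr0n.
set eta := A / d0 * N%:R `^ (- rho) in etaeps small csmall.
have eta0 : 0 <= eta by rewrite mulr_ge0// ltW.
have [F0 [F1 [g0 [g1 [[g0C g1C F0q F1q] [[F0r F1r] chi]]]]]] := H eta s eta0 s01 small.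
split; first by split => //; exact: HN2.
exists F0, F1; split.
  split => //; rewrite F1q; congr (_ + _).
  by rewrite /eta mulrA [d0 * _]mulrC divfK// gt_eqF.
move=> C theta u CF0 CF1 sep.
set x := c0 * eta ^+ 2 * s `^ (2 * b - 1) in csmall chi.
have x0 : 0 <= x := mulr_ge0 (mulr_ge0 (ltW c00) (sqr_ge0 eta)) (powR_ge0 _ _).
have cN := exprn_le_expR (ltW c10) N0 csmall x0.
have c1N : 1 <= (1 + x) ^+ N by rewrite exprn_ege1// lerDl.
have dl : (4 * expR c1)^-1 <= (4 * (1 + x) ^+ N)^-1.
  rewrite lef_pV2 ?posrE// ?ler_wpM2l// mulr_gt0//.
  exact: lt_le_trans ltr01 c1N.
apply: (@le_trans _ _ ((4 * (1 + x) ^+ N)^-1)%:E); first by rewrite lee_fin.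
have [chin chim] := chi n m.
(* The pair is chosen so that only the smaller sample is informative: in the first case the error
   laws agree, in the second the laws of the Y_j. *)
have [nm|mn] := leqP n m.
  have NE : N = n by exact/minn_idPl.
  rewrite NE in c1N *.
  exact: (minimax_ge CF0 CF1 g0C g0C c1N (@measurable_observations R n m) chin sep).
have NE : N = m by apply/minn_idPr; exact: ltnW.
rewrite NE in c1N *.
rewrite distrC in sep.
exact: (minimax_ge CF1 CF0 g0C g1C c1N (@measurable_observations R n m) chim sep).
Qed.

Lemma regular_cdf_class (al K r q z a b : R) (F : cdf_fun R) : a < b ->
  q - z <= a -> b <= q + z -> regular_cdf `[q - z, q + z] al K r F ->
  cdf_class al K r `[a, b] F.
Proof.
move=> ab qa bq [rho [dF mrho rhoK hF]].
have sub : `[a, b]%classic `<=` `[q - z, q + z]%classic.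
  by apply: subset_itv; rewrite bnd_simp.
exists rho; split.
- by move=> B mB BI; apply: dF => //; exact: subset_trans sub.
- exact: hF.
- by move=> x /sub/rhoK/andP[].
Qed.

End lower_bounds.

(** A density at least r gives mass 2 zeta r or more to the window, and zeta r or more to each side
    of the quantile. The strict inequalities on these masses, r < K and K' < K provide the room in
    which the two hypotheses are built. *)
Theorem theorem2p10 (R : realType) (tau q alpha beta K r zeta gamma : R)
  (tau01 : 0 < tau < 1)
  (alpha_gt0 : 0 < alpha) (beta_gt0 : 0 < beta) (K_gt0 : 0 < K)
  (r_gt0 : 0 < r) (zeta_gt0 : 0 < zeta) (gamma_ge0 : 0 <= gamma)
  (rK : r < K)
  (error_class_nondegenerate :
    exists2 K' : R, 0 < K' < K & error_class beta K' gamma !=set0)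
  (C : R) (C_gt0 : 0 < C) :
  exists2 delta : R, 0 < delta &
  exists N : nat, forall n m : nat, (N <= minn n m)%N ->
    let rate := (minn n m)%:R `^
      (- ((alpha + 1) / (2 * alpha + Num.max (2 * beta) 1 + 1))) in
    (2 * zeta * r < 1 ->
     (delta%:E <= minimax_deviation n m
        (cdf_class alpha K r `[(q - zeta)%R, (q + zeta)%R])
        (error_class beta K gamma) (fun F : cdf_fun R => F q) (C * rate)%R)%E) /\
    (zeta * r < Num.min tau (1 - tau) ->
     (delta%:E <= minimax_deviation n m
        (quantile_cdf_class tau alpha K r zeta)
        (error_class beta K gamma) (quantile tau) (C * rate)%R)%E).
Proof.
set rho := (alpha + 1) / _.
have part1 : exists2 delta : R, 0 < delta & exists N : nat, forall n m, (N <= minn n m)%N ->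
    2 * zeta * r < 1 ->
    (delta%:E <= minimax_deviation n m
        (cdf_class alpha K r `[(q - zeta)%R, (q + zeta)%R])
        (error_class beta K gamma) (fun F : cdf_fun R => F q)
        (C * (minn n m)%:R `^ (- rho))%R)%E.
  (* If the condition fails, the claim is empty and any constant does. *)
  have [zr|nzr] := boolP (2 * zeta * r < 1); last by exists 1 => //; exists 0%N.
  (* The value at q is free here; with the level 1 / 2 the constraint on the masses is exactly the
     condition 2 zeta r < 1. *)
  have rz : r * zeta < Num.min (2^-1) (1 - 2^-1).
    rewrite lt_min; have -> : 1 - 2^-1 = 2^-1 :> R by rewrite {1}[1 in LHS](splitr 1) mul1r addrK.
    by rewrite andbb -[X in _ < X]mul1r ltr_pdivlMr// [r * _]mulrC mulrAC [zeta * 2]mulrC.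
  (* A separation of 2 C + 1 times the rate strictly exceeds twice the deviation. *)
  have A0 : 0 < 2 * C + 1 by rewrite addr_gt0// mulr_gt0.
  have [delta d0 [N H]] := rate_hypotheses q alpha_gt0 beta_gt0 r_gt0 rK gamma_ge0 zeta_gt0 rz
    error_class_nondegenerate A0 ltr01.
  exists delta => //; exists N => n m Nnm _.
  have [[rate0 _] [F0 [F1 [[F0q F1q F0r F1r] h]]]] := H n m Nnm.
  have ab : q - zeta < q + zeta by rewrite ltrD2l (lt_trans _ zeta_gt0)// oppr_lt0.
  apply: (h _ (fun F : cdf_fun R => F q)); [exact: regular_cdf_class F0r|exact: regular_cdf_class F1r|].
  rewrite F0q F1q opprD addNKr normrN ger0_norm; last by rewrite mulr_ge0// ltW.
  by rewrite mulrA ltr_pM2r// ltrDl.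
have part2 : exists2 delta : R, 0 < delta & exists N : nat, forall n m, (N <= minn n m)%N ->
    zeta * r < Num.min tau (1 - tau) ->
    (delta%:E <= minimax_deviation n m (quantile_cdf_class tau alpha K r zeta)
        (error_class beta K gamma) (quantile tau) (C * (minn n m)%:R `^ (- rho))%R)%E.
  have [zr|nzr] := boolP (zeta * r < Num.min tau (1 - tau)); last by exists 1 => //; exists 0%N.
  (* z is strictly larger than zeta, so that the window around the moved quantile stays inside
     [q - z, q + z]. *)
  pose z := (zeta + Num.min tau (1 - tau) / r) / 2.
  have zr' : zeta < Num.min tau (1 - tau) / r by rewrite ltr_pdivlMr.
  have zz : zeta < z by rewrite /z; lra.
  have zr2 : z < Num.min tau (1 - tau) / r by rewrite /z; lra.
  have z0 : 0 < z := lt_trans zeta_gt0 zz.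
  have rz : r * z < Num.min tau (1 - tau) by rewrite mulrC -ltr_pdivlMr.
  (* A shift d of the value at q is only known to move the quantile by at least d / K, hence the
     factor K. *)
  have A0 : 0 < (2 * C + 1) * K by rewrite mulr_gt0// addr_gt0// mulr_gt0.
  have t0 : 0 < r * (z - zeta) by rewrite mulr_gt0// subr_gt0.
  have [delta d0 [N H]] := rate_hypotheses q alpha_gt0 beta_gt0 r_gt0 rK gamma_ge0 z0 rz
    error_class_nondegenerate A0 t0.
  exists delta => //; exists N => n m Nnm _.
  have [[rate0 dt] [F0 [F1 [[F0q F1q F0r F1r] h]]]] := H n m Nnm.
  move: rate0 dt F1q; rewrite -/rho; set rate := _ `^ _ => rate0 dt F1q.
  set d := _ * rate in dt F1q.
  have d_ge0 : 0 <= d by rewrite mulr_ge0// ltW.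
  have dr : d / r <= z - zeta by rewrite ler_pdivrMr// mulrC.
  have Jq : q - z <= q <= q + z by rewrite gerBl lerDl ltW.
  have drz : d < r * (q - (q - z)).
    by rewrite subKr; apply: le_lt_trans dt _; rewrite ltr_pM2l// gtrBl.
  have zrz : 0 < r * (q - (q - z)) := le_lt_trans d_ge0 drz.
  have class F : regular_cdf `[q - z, q + z] alpha K r F ->
      q - d / r <= quantile tau F <= q -> quantile_cdf_class tau alpha K r zeta F.
    move=> Fr /andP[q1 q2]; rewrite /quantile_cdf_class/=.
    apply: regular_cdf_class Fr; move: q1 q2 dr zz zeta_gt0; move: (d / r) (quantile tau F) => a a';
      clear; lra.
  have Q0 : quantile tau F0 = q.
    have [rho0 [dF mrho rhoK _]] := F0r.
    have F0q' : F0 q = tau + 0 by rewrite addr0.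
    have := quantile_bounds dF mrho r_gt0 rhoK Jq (lexx 0) zrz (ltW rK) F0q'.
    by rewrite !mul0r subr0 -eq_le => /eqP.
  have [rho1 [dF mrho rhoK _]] := F1r.
  have /andP[Q1 Q2] := quantile_bounds dF mrho r_gt0 rhoK Jq d_ge0 drz (ltW rK) F1q.
  have dK0 : 0 <= d / K by rewrite divr_ge0// ltW.
  have dr0 : 0 <= d / r by rewrite divr_ge0// ltW.
  have Q2' : quantile tau F1 <= q by apply: le_trans Q2 _; rewrite gerBl.
  apply: h.
  - by apply: class => //; rewrite Q0 lexx gerBl dr0.
  - by apply: class => //; rewrite Q1.
  - rewrite Q0 ger0_norm ?subr_ge0//; apply: (@lt_le_trans _ _ (d / K)).
      by rewrite /d mulrAC mulfK ?gt_eqF// mulrA ltr_pM2r// ltrDl.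
    by rewrite lerBrDl -lerBrDr.
have [d1 d10 [N1 h1]] := part1.
have [d2 d20 [N2 h2]] := part2.
exists (Num.min d1 d2); first by rewrite lt_min d10.
exists (maxn N1 N2) => n m; rewrite geq_max => /andP[n1 n2] rate; split => hyp.
- by apply: le_trans (h1 n m n1 hyp); rewrite lee_fin ge_min lexx.
- by apply: le_trans (h2 n m n2 hyp); rewrite lee_fin ge_min lexx orbT.
Qed.
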